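(* Suppose $|R(s,a)|\le U_R$ for all $(s,a)\in\mathcal S\times\mathcal A$, and that $\pi_\theta$ is differentiable in $\theta$ with score function $\nabla\log\pi_\theta(a\mid s)$ that exists and satisfies, for all $(s,a)$ and all $\theta,\theta^1,\theta^2\in\mathbb R^d$, $\|\nabla\log\pi_{\theta^1}(a\mid s)-\nabla\log\pi_{\theta^2}(a\mid s)\|\le L_\Theta\|\theta^1-\theta^2\|$ and $\|\nabla\log\pi_\theta(a\mid s)\|\le B_\Theta$. Suppose the stepsizes $\{\alpha_k\}_{k\ge0}$ satisfy the Robbins–Monro condition $\sum_{k=0}^\infty\alpha_k=\infty$, $\sum_{k=0}^\infty\alpha_k^2<\infty$. Let $\{\theta_k\}_{k\ge0}$ be the sequence of policy parameters generated by the random-horizon policy gradient (RPG) algorithm with these stepsizes. Then, almost surely, $\lim_{k\to\infty}\theta_k\in\Theta^*$, where $\Theta^*$ is the set of stationary points of $J(\theta)$ (points where $\nabla J(\theta)=0$).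
   Context: A Markov decision process $(\mathcal S,\mathcal A,\mathbb P,R,\gamma)$ has state space $\mathcal S$ and action space $\mathcal A$ (each a finite set or a compact subset of a real vector space), transition kernel $\mathbb P(s'\mid s,a)$, deterministic reward $R:\mathcal S\times\mathcal A\to\mathbb R$ and discount factor $\gamma\in(0,1)$. For a policy $\pi$, $V_\pi(s)=\mathbb E[\sum_{t\ge0}\gamma^tR(s_t,a_t)\mid s_0=s]$ with $a_t\sim\pi(\cdot\mid s_t)$, $s_{t+1}\sim\mathbb P(\cdot\mid s_t,a_t)$. Policies are parameterized as $\pi_\theta$, $\theta\in\mathbb R^d$; the initial state $s_0$ is fixed and $J(\theta)=V_{\pi_\theta}(s_0)$. $\nabla$ is the gradient in $\theta$. $\mathrm{Geom}(1-q)$ denotes the law $P(T=t)=(1-q)q^t$, $t=0,1,2,\dots$. Stepsizes are positive. RPG algorithm: start from a given $\theta_0$. At iteration $k\ge0$, draw $T_{k+1}\sim\mathrm{Geom}(1-\gamma)$ and simulate a trajectory from $s_0$ under $\pi_{\theta_k}$ up to time $T_{k+1}$, with last pair $(s_{T_{k+1}},a_{T_{k+1}})$. Then compute $\hat Q_{\pi_{\theta_k}}(s_{T_{k+1}},a_{T_{k+1}})$, where for a pair $(s,a)$, $\hat Q_{\pi_\theta}(s,a)=\sum_{t=0}^{T'}\gamma^{t/2}R(s_t,a_t)$ along a fresh trajectory under $\pi_\theta$ started at $s_0=s,a_0=a$, with independent $T'\sim\mathrm{Geom}(1-\gamma^{1/2})$. Update $$\theta_{k+1}=\theta_k+\frac{\alpha_k}{1-\gamma}\,\hat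 Q_{\pi_{\theta_k}}(s_{T_{k+1}},a_{T_{k+1}})\,\nabla\log\pi_{\theta_k}(a_{T_{k+1}}\mid s_{T_{k+1}}).$$ All random draws are independent across iterations given the current iterate.
   Formalization: As stated the claim fails (one state, two actions, sigmoid policy: no stationary point exists); instead of lim θ_k ∈ Θ*, it is proved that J is differentiable and, almost surely, every limit point of θ_k lies in Θ* and ∇J(θ_k) → 0. *)

(* Defs.v *)
From HB Require Import structures.
From mathcomp Require Import all_boot all_order all_algebra.
From mathcomp Require Import all_classical all_reals all_analysis.
Set Implicit Arguments.
Unset Strict Implicit.
Unset Printing Implicit Defensive.
Import Order.TTheory GRing.Theory Num.Theory.
Import numFieldNormedType.Exports.
Local Open Scope classical_set_scope.
Local Open Scope ring_scope.

(** The norm that the library puts on ['rV[R]_d] is the sup norm; this is the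
    Euclidean one. *)
Definition norm2 (R : realType) (d : nat) (v : 'rV[R]_d) : R :=
  Num.sqrt (\sum_(i < d) v 0 i ^+ 2).

(** As ['D_v f th] is an unspecified value where the derivative does not exist,
    [grad f th] is only meaningful together with [differentiable f th]. *)
Definition grad (R : realType) (d : nat) (f : 'rV[R]_d -> R) (th : 'rV[R]_d) :
    'rV[R]_d :=
  \row_(i < d) 'D_(delta_mx 0 i) f th.

Definition stationary_points (R : realType) (d : nat) (f : 'rV[R]_d -> R) :
    set 'rV[R]_d :=
  [set th | differentiable f th /\ grad f th = 0].

(** A finite set with the discrete sigma-algebra or, up to Borel isomorphism, a
    compact subset of a real topological vector space. *)
Definition finite_or_compact (R : realType) (dT : measure_display)
    (T : measurableType dT) : Prop :=
  (finite_set [set: T] /\ forall B : set T, measurable B) \/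
  exists (V : topologicalLmodType R) (f : T -> V),
    [/\ injective f, compact (range f) &
        @measurable dT T = preimage_set_system setT f <<s open >>].

(** The events that can be expressed in terms of [X]. *)
Definition events (Om : Type) (dT : measure_display) (T : measurableType dT)
    (X : Om -> T) : set_system Om :=
  preimage_set_system setT X measurable.

Section Sampling.
Context {R : realType} {dO : measure_display} {Om : measurableType dO}.
Variable P : probability Om R.

(** [X] is drawn from the random law [law]: the conditional distribution of [X]
    given the sigma-algebra [<<s G >>] is [law].  Below [law] is always a
    function of variables generating part of [G]. *)
Definition drawn (G : set_system Om) (dT : measure_display)
    (T : measurableType dT) (X : Om -> T) (law : Om -> set T -> \bar R) : Prop :=
  measurable_fun setT X /\
  forall (H : set Om) (B : set T), <<s G >> H -> measurable B ->
    P (H `&` X @^-1` B) = (\int[P]_(w in H) law w B)%E.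

(** [N] has law [Geom(1 - q)] and is independent of [<<s G >>]. *)
Definition drawn_geom (G : set_system Om) (N : Om -> nat) (q : R) : Prop :=
  measurable_fun setT N /\
  forall (H : set Om) (t : nat), <<s G >> H ->
    P (H `&` N @^-1` [set t]) = (((1 - q) * q ^+ t)%:E * P H)%E.

Section Trajectory.
Context {dS dA : measure_display} {S : measurableType dS} {A : measurableType dA}.
(** Policies are given by densities [pi s a] with respect to a reference measure
    [nu] on actions (counting measure when [A] is finite). *)
Variables (nu : {sigma_finite_measure set A -> \bar R}).
Variable p : R.-pker (S * A)%type ~> S.

Definition action_law (pi : S -> A -> R) (s : S) (B : set A) : \bar R :=
  (\int[nu]_(a in B) (pi s a)%:E)%E.

(** What is known after [m] states and [n] actions, on top of [G]. *)
Definition history (G : set_system Om) (s : nat -> Om -> S) (a : nat -> Om -> A)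
    (m n : nat) : set_system Om :=
  G `|` \bigcup_(i in `I_m) events (s i) `|` \bigcup_(i in `I_n) events (a i).

(** Everything after the first state-action pair; the policy [pi w] may be
    random, but is meant to be known from [G]. *)
Definition continues (G : set_system Om) (pi : Om -> S -> A -> R)
    (s : nat -> Om -> S) (a : nat -> Om -> A) : Prop :=
  (forall t, drawn (history G s a t.+1 t.+1) (s t.+1)
               (fun w => p (s t w, a t w))) /\
  (forall t, drawn (history G s a t.+2 t.+1) (a t.+1)
               (fun w => action_law (pi w) (s t.+1 w))).

Definition trajectory_from_state (G : set_system Om) (pi : Om -> S -> A -> R)
    (s0 : S) (s : nat -> Om -> S) (a : nat -> Om -> A) : Prop :=
  [/\ forall w, s 0 w = s0,
      drawn (history G s a 1 0) (a 0) (fun w => action_law (pi w) (s 0 w)) &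
      continues G pi s a].

Definition trajectory_from_pair (G : set_system Om) (pi : Om -> S -> A -> R)
    (s0 : Om -> S) (a0 : Om -> A) (s : nat -> Om -> S) (a : nat -> Om -> A) :
    Prop :=
  [/\ forall w, s 0 w = s0 w, forall w, a 0 w = a0 w & continues G pi s a].

End Trajectory.
End Sampling.

(** The draws of one iteration: horizon and trajectory locating the pair
    [(s_T, a_T)], then horizon and trajectory of the estimator [Qhat].  The
    trajectories are indexed by all times, but the algorithm only reads them up
    to the independent horizons. *)
Record draws (S A Om : Type) := Draws {
  hor1 : Om -> nat; st1 : nat -> Om -> S; ac1 : nat -> Om -> A;
  hor2 : Om -> nat; st2 : nat -> Om -> S; ac2 : nat -> Om -> A }.

Section MDP.
Context {R : realType} {dS dA : measure_display}.
Context {S : measurableType dS} {A : measurableType dA}.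
Variables (nu : {sigma_finite_measure set A -> \bar R}).
Variables (p : R.-pker (S * A)%type ~> S) (r : S * A -> R) (gamma : R).

Definition is_policy (pi : S -> A -> R) : Prop :=
  [/\ forall s a, 0 <= pi s a,
      measurable_fun setT (fun x : S * A => pi x.1 x.2) &
      forall s, (\int[nu]_a (pi s a)%:E = 1)%E].

(** [v] is [E[\sum_t gamma ^ t * r (s_t, a_t) | s_0 = s0]] along a trajectory
    under [pi].  The law of the trajectory, hence [v], is determined by [pi] and
    [s0]; the probability space carrying it is immaterial. *)
Definition is_value (pi : S -> A -> R) (s0 : S) (v : R) : Prop :=
  exists (dO : measure_display) (Om : measurableType dO) (P : probability Om R)
         (s : nat -> Om -> S) (a : nat -> Om -> A),
    trajectory_from_state P nu p set0 (fun=> pi) s0 s a /\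
    v%:E = ('E_P[fun w => limn (series (fun t => (gamma ^+ t * r (s t w, a t w))%R))])%E.

Section RPG.
Context {d : nat}.
Variables (pol : 'rV[R]_d -> S -> A -> R) (s0 : S).

Definition score (s : S) (a : A) (th : 'rV[R]_d) : 'rV[R]_d :=
  grad (fun th' => ln (pol th' s a)) th.

Context {dO : measure_display} {Om : measurableType dO}.
Variable P : probability Om R.

Definition last_state (x : draws S A Om) (w : Om) : S := st1 x (hor1 x w) w.
Definition last_action (x : draws S A Om) (w : Om) : A := ac1 x (hor1 x w) w.

Definition Qhat (x : draws S A Om) (w : Om) : R :=
  \sum_(0 <= t < (hor2 x w).+1) gamma `^ (t%:R / 2) * r (st2 x t w, ac2 x t w).

Definition events1 (x : draws S A Om) : set_system Om :=
  events (hor1 x) `|` \bigcup_t events (st1 x t) `|` \bigcup_t events (ac1 x t).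

Definition events2 (x : draws S A Om) : set_system Om :=
  events (hor2 x) `|` \bigcup_t events (st2 x t) `|` \bigcup_t events (ac2 x t).

(** [G] is what was drawn before, [th] the current iterate. *)
Definition iteration_draws (G : set_system Om) (th : Om -> 'rV[R]_d)
    (x : draws S A Om) : Prop :=
  [/\ drawn_geom P G (hor1 x) gamma,
      trajectory_from_state P nu p (G `|` events (hor1 x))
        (fun w => pol (th w)) s0 (st1 x) (ac1 x),
      drawn_geom P (G `|` events1 x) (hor2 x) (gamma `^ (1 / 2)) &
      trajectory_from_pair P nu p (G `|` events1 x `|` events (hor2 x))
        (fun w => pol (th w)) (last_state x) (last_action x) (st2 x) (ac2 x)].

Fixpoint rpg (th0 : 'rV[R]_d) (alpha : nat -> R) (x : nat -> draws S A Om) (k : nat)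
    (w : Om) : 'rV[R]_d :=
  if k is k'.+1 then
    rpg th0 alpha x k' w +
    (alpha k' / (1 - gamma) * Qhat (x k') w) *:
      score (last_state (x k') w) (last_action (x k') w) (rpg th0 alpha x k' w)
  else th0.

Definition past (x : nat -> draws S A Om) (k : nat) : set_system Om :=
  \bigcup_(j in `I_k) (events1 (x j) `|` events2 (x j)).

Definition rpg_draws (th0 : 'rV[R]_d) (alpha : nat -> R) (x : nat -> draws S A Om) :
    Prop :=
  forall k, iteration_draws (past x k) (rpg th0 alpha x k) (x k).

End RPG.
End MDP.

(* Main.v *)
(** The increments of the iterates are bounded by a constant times [alpha k], and the
    conditional expectation of the update direction is the gradient [G] of [J].

    Smoothness.  Writing [rho] for the ratio of two policies, the performance difference
    formula [J th' - J th = \sum_t gamma ^+ t * E ((rho - 1) * Q_th') (s_t, a_t)], along the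
    trajectory under [th], reduces everything to the expansion of [rho = expR (ln pol_th' -
    ln pol_th)], which is uniform in states and actions.  Hence
    [`|J (th + h) - J th - dot (G th) h| <= C * `|h| ^+ 2], which makes [J] differentiable with
    gradient [G] and [G] Lipschitz.

    Convergence.  Taking expectations in this expansion along the algorithm gives
    [\sum_k alpha k * E (`|G (theta k)| ^+ 2) < +oo], so [\sum_k alpha k * `|G (theta k)| ^+ 2]
    is almost surely finite.  As [G (theta k)] moves by at most a constant times [alpha k]
    while [\sum_k alpha k] diverges, it must tend to [0]; no martingale convergence theorem
    is involved.

    Conditional expectations are computed by disintegration: every draw with a prescribed
    random law allows one to integrate out the drawn variable, on the sigma-algebra of what
    was drawn before. *)
Require Import Defs.
From HB Require Import structures.
From mathcomp Require Import all_boot all_order all_algebra.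
From mathcomp Require Import all_classical all_reals all_analysis measurable_realfun finmap.
From mathcomp Require Import ring lra.
Set Implicit Arguments.
Unset Strict Implicit.
Unset Printing Implicit Defensive.
Import Order.TTheory GRing.Theory Num.Theory.
Import numFieldNormedType.Exports.
Local Open Scope classical_set_scope.
Local Open Scope ring_scope.

(** * Integral functionals *)

Section IntegralFunctional.
Context {R : realType} {dX : measure_display} {X : measurableType dX}.
Import HBNNSimple.
Implicit Types (I J : (X -> \bar R) -> \bar R).

(** No law of a whole trajectory is ever constructed: [Qval] is defined analytically, as the Neumann
    series of the one-step operator [step]. The policy at iteration [k] is random, known from the
    past, so objects must be measurable jointly in the sample point and the state-action pair; this
    is why the operators are studied with a parameter, and why the score calls for a Caratheodory
    argument. Rewards and scores are bounded, hence so are values and gradients; discounted sums are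
    truncated at [n] with a geometrically small error, and equalities follow by letting [n] grow.
    Boundedness also gives the quadratic estimate for large displacements, where the policy ratio
    has no uniform bound. Nothing keeps the iterates bounded; what is shown about them is that the
    gradient along them tends to [0], and continuity of [G] then makes every cluster point
    stationary. *)

Definition nnmeas (f : X -> \bar R) :=
  measurable_fun setT f /\ (forall x, 0 <= f x)%E.

(** These axioms characterise integration against a measure, namely [C |-> I (eindic C)]. Only
    nonnegative functions occur, so that no difference of infinities arises. *)
Definition integral_functional I := [/\
  forall f, nnmeas f -> (0 <= I f)%E,
  forall f g, nnmeas f -> nnmeas g -> (forall x, f x <= g x)%E -> (I f <= I g)%E,
  forall f g, nnmeas f -> nnmeas g -> (I (fun x => f x + g x) = I f + I g)%E,
  forall (c : R) f, 0 <= c -> nnmeas f ->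
    (I (fun x => c%:E * f x) = c%:E * I f)%E &
  forall f_ : nat -> X -> \bar R, (forall n, nnmeas (f_ n)) ->
    (forall x, nondecreasing_seq (f_ ^~ x)) ->
    I (fun x => limn (f_ ^~ x)) = limn (fun n => I (f_ n))].

Definition eindic (C : set X) (x : X) : \bar R := (\1_C x)%:E.

Lemma nnmeas_eindic C : measurable C -> nnmeas (eindic C).
Proof.
move=> mC; split; last by move=> x; rewrite lee_fin.
by apply/measurable_EFinP; exact: measurable_indic.
Qed.

Lemma nnmeasD f g : nnmeas f -> nnmeas g -> nnmeas (fun x => f x + g x)%E.
Proof.
move=> [mf f0] [mg g0]; split; first exact: emeasurable_funD.
by move=> x; rewrite adde_ge0.
Qed.

Lemma nnmeasZ (c : R) f : 0 <= c -> nnmeas f -> nnmeas (fun x => c%:E * f x)%E.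
Proof.
move=> c0 [mf f0]; split; first exact: measurable_funeM.
by move=> x; rewrite mule_ge0.
Qed.

Lemma integral_functional_sum I (T : Type) (s : seq T) (c : T -> R) (C : T -> set X) :
  integral_functional I -> (forall t, 0 <= c t) -> (forall t, measurable (C t)) ->
  nnmeas (fun x => \sum_(t <- s) (c t)%:E * eindic (C t) x)%E /\
  I (fun x => \sum_(t <- s) (c t)%:E * eindic (C t) x)%E =
  (\sum_(t <- s) (c t)%:E * I (eindic (C t)))%E.
Proof.
move=> [I0 _ ID IZ _] c0 mC; elim: s => [|t s [mS IS]].
  have n0 : nnmeas (fun=> 0%E) by [].
  under eq_fun do rewrite big_nil; rewrite big_nil; split => //.
  by have := IZ 0 _ (lexx _) n0; rewrite !mul0e.
have mt : nnmeas (fun x => (c t)%:E * eindic (C t) x)%E.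
  exact/nnmeasZ/nnmeas_eindic.
under eq_fun do rewrite big_cons; split; first exact: nnmeasD.
by rewrite ID// IS big_cons IZ//; exact: nnmeas_eindic.
Qed.

Lemma integral_functional_eq I J :
  integral_functional I -> integral_functional J ->
  (forall C, measurable C -> I (eindic C) = J (eindic C)) ->
  forall f, nnmeas f -> I f = J f.
Proof.
move=> II JJ IJ f [mf f0].
pose g := nnsfun_approx measurableT mf.
have fE : f = (fun x => limn ((fun n x => (g n x)%:E) ^~ x)).
  apply/funext => x; apply/esym/cvg_lim => //; exact: cvg_nnsfun_approx.
have mg n : nnmeas (fun x => (g n x)%:E).
  by split; [exact/measurable_EFinP|move=> x; rewrite lee_fin].
have ndg x : nondecreasing_seq ((fun n x => (g n x)%:E) ^~ x).
  by move=> a b ab; rewrite lee_fin; exact/lefP/nd_nnsfun_approx.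
have [_ _ _ _ IL] := II; have [_ _ _ _ JL] := JJ.
rewrite fE IL// JL//; congr (limn _); apply/funext => n.
(* [integral_functional_sum] wants nonnegative coefficients at every index, hence the [Num.max r 0];
   on the range of [g n] it equals [r]. *)
have gE : (fun x => (g n x)%:E) = (fun x => \sum_(r <- fset_set (range (g n)))
    (Num.max r 0)%:E * eindic (g n @^-1` [set r]) x)%E.
  apply/funext => x; rewrite fimfunE fsbig_finite//= sumEFin; congr (_%:E).
  rewrite big_seq [RHS]big_seq; apply: eq_bigr => r.
  rewrite in_fset_set// => /set_mem[y _ <-]; congr (_ * _).
  by rewrite max_l.
rewrite gE; have c0 (r : R) : 0 <= Num.max r 0 by rewrite le_max lexx orbT.
have mC r : measurable (g n @^-1` [set r]).
  by rewrite -[_ @^-1` _]setTI; exact: measurable_funP.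
have [_ ->] := integral_functional_sum (fset_set (range (g n))) II c0 mC.
have [_ ->] := integral_functional_sum (fset_set (range (g n))) JJ c0 mC.
by apply: eq_bigr => r _; rewrite IJ.
Qed.

(* The pi-lambda theorem, phrased for functionals so that no measure has to be built. *)
Lemma integral_functional_eq_pi I J (C : set_system X) :
  integral_functional I -> integral_functional J ->
  setI_closed C -> C setT -> @measurable _ X = <<s C >> ->
  (I (fun=> 1) < +oo)%E ->
  (forall B, C B -> I (eindic B) = J (eindic B)) ->
  forall f, nnmeas f -> I f = J f.
Proof.
move=> II JJ CI CT mC I1 IJ; apply: integral_functional_eq => //.
pose H := [set B : set X | measurable B /\ I (eindic B) = J (eindic B)].
suff mH : <<s C >> `<=` H by move=> B; rewrite mC => /mH[].
have I1E : I (eindic setT) = I (fun=> 1%E).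
  by congr I; apply/funext => x; rewrite /eindic indicT.
(* Finiteness allows [I (eindic B)] to be cancelled when the class is shown to be stable under
   proper differences. *)
have Ifin B : measurable B -> I (eindic B) \is a fin_num.
  move=> mB; rewrite ge0_fin_numE; last by case: II => + _ _ _ _; apply; exact: nnmeas_eindic.
  rewrite (le_lt_trans _ I1)// -I1E; case: II => _ + _ _ _; apply => //.
  - exact: nnmeas_eindic.
  - exact: nnmeas_eindic.
  - by move=> x; rewrite /eindic lee_fin indicT /= indicE; case: (_ \in _).
have CH : C `<=` H.
  by move=> B CB; split; [rewrite mC; exact: sub_sigma_algebra|exact: IJ].
apply: lambda_system_subset => //; split => //.
- exact: CH.
- move=> A B BA [mA IA] [mB IB].
  have mAB : measurable (A `\` B) by exact: measurableD.
  split => //.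
  have AE : eindic A = (fun x => eindic B x + eindic (A `\` B) x)%E.
    apply/funext => x; rewrite /eindic -EFinD; congr (_%:E).
    rewrite !indicE in_setD; case: (boolP (x \in B)) => xB /=.
      by rewrite andbF addr0 (mem_set (BA _ (set_mem xB))).
    by rewrite andbT add0r.
  case: II => I0 _ ID _ _; case: JJ => _ _ JD _ _.
  move: (IA); rewrite AE ID ?JD; [|exact: nnmeas_eindic..].
  rewrite -IB => /eqP.
  rewrite addeC [X in _ == X]addeC => /eqP /(congr1 (fun x => x - I (eindic B))%E).
  by rewrite !addeK ?Ifin.
- move=> F ndF FH.
  have mF n : measurable (F n) by case: (FH n).
  have mU : measurable (\bigcup_n F n) by exact: bigcup_measurable.
  split => //.
  have nd x : nondecreasing_seq ((fun n => eindic (F n)) ^~ x).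
    move=> m n mn; rewrite /eindic lee_fin !indicE.
    case: (boolP (x \in F m)) => //= xFm; rewrite mem_set//.
    by move/subsetPset : (ndF _ _ mn); apply; exact: set_mem.
  have UE : eindic (\bigcup_n F n) = (fun x => limn ((fun n => eindic (F n)) ^~ x)).
    apply/funext => x; apply/esym/cvg_lim => //.
    have [[k _ Fkx]|nFx] := pselect ((\bigcup_n F n) x).
      apply: cvg_near_cst; exists k => // n /= kn.
      rewrite /eindic !indicE !mem_set//; first by exists k.
      by move/subsetPset : (ndF _ _ kn); apply.
    apply: cvg_near_cst; apply: nearW => n.
    rewrite /eindic !indicE !memNset// => Fnx; apply: nFx; by exists n.
  rewrite UE; case: II => _ _ _ _ ->//; last by move=> n; exact: nnmeas_eindic.
  case: JJ => _ _ _ _ ->//; last by move=> n; exact: nnmeas_eindic.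
  by congr (limn _); apply/funext => n; case: (FH n).
Qed.

End IntegralFunctional.

(** This is the image under [h] of [mu] restricted to [D]. The map [h] may pair a sample point with
    a drawn variable, or be the identity onto a coarser sigma-algebra. *)
Lemma integral_functional_integral {R : realType} {dX dY : measure_display}
    {X : measurableType dX} {Y : measurableType dY}
    (mu : {measure set Y -> \bar R}) (h : Y -> X) (D : set Y) :
  measurable D -> measurable_fun setT h ->
  integral_functional (fun f => \int[mu]_(y in D) f (h y))%E.
Proof.
move=> mD mh; have mc f : nnmeas f -> measurable_fun D (fun y => f (h y)).
  by move=> [mf _]; apply: measurable_funS (measurableT) _ _ => //; exact: measurableT_comp.
have n0 f y : nnmeas f -> (0 <= f (h y))%E by move=> [_ +]; exact.
split.
- by move=> f nf; apply: integral_ge0 => y _; exact: n0.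
- move=> f g nf ng fg.
  by apply: ge0_le_integral => //; try exact: mc; move=> y _; exact: n0.
- by move=> f g nf ng; rewrite ge0_integralD//; try exact: mc; move=> y _; exact: n0.
- by move=> c f c0 nf; rewrite ge0_integralZl//; [exact: mc|move=> y _; exact: n0].
- move=> f_ nf ndf; rewrite -monotone_convergence//.
  + by move=> n; exact: mc.
  + by move=> n x _; exact: n0.

Qed.

(* [law w B] is only known through sets; [K w] is the integral it stands for.  Measurability
   with respect to [<<s G >>] is measurability on the type [W]. *)
Section Disintegration.
Context {R : realType} {dO dT : measure_display} {Om : measurableType dO}
  {T : measurableType dT}.
Variables (P : probability Om R) (G : set_system Om).
Hypothesis GM : G `<=` measurable.
Local Notation W := (g_sigma_algebraType G).

Lemma sub_sigma_measurable (A : set Om) : <<s G >> A -> measurable A.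
Proof.
suff : <<s G >> `<=` measurable by exact.
by apply: smallest_sub => //; exact: sigma_algebra_measurable.
Qed.

Lemma measurable_fun_sub d (Y : measurableType d) (f : Om -> Y) :
  measurable_fun setT (f : W -> Y) -> measurable_fun setT f.
Proof. by move=> mf _ B mB; apply: sub_sigma_measurable; exact: mf. Qed.

Lemma measurable_to_sub : measurable_fun setT (id : Om -> W).
Proof. exact: (@measurable_fun_sub _ W id). Qed.

Variables (X : Om -> T) (law : Om -> set T -> \bar R)
  (K : Om -> (T -> \bar R) -> \bar R).
Hypothesis XG : drawn P G X law.
Hypothesis KI : forall w, integral_functional (K w).
Hypothesis Klaw : forall w B, measurable B -> law w B = K w (eindic B).
Hypothesis mK : forall f : W * T -> \bar R, nnmeas f ->
  measurable_fun setT (fun w : W => K w (fun y => f (w, y))).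

Lemma nnmeas_pair1 (f : W * T -> \bar R) (w : W) :
  nnmeas f -> nnmeas (fun y => f (w, y)).
Proof. by move=> [mf f0]; split=> //; exact: measurableT_comp. Qed.

(** Both sides are integral functionals of [f]. On a rectangle with first side in [<<s G >>] their
    equality is the definition of [drawn], and such rectangles generate the sigma-algebra of
    [W * T]. *)
Lemma drawn_nnintegral (f : W * T -> \bar R) : nnmeas f ->
  (\int[P]_w f (w, X w) = \int[P]_w K w (fun y => f (w, y)))%E.
Proof.
have [mX XE] := XG; move: f.
have mpair : measurable_fun setT (fun w : Om => (w, X w) : (W * T)%type).
  by apply: measurable_fun_pair => //; exact: measurable_to_sub.
have mK' (f : W * T -> \bar R) : nnmeas f ->
    measurable_fun setT (fun w : Om => K w (fun y => f (w, y))).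
  by move=> nf; exact: (measurable_fun_sub (mK nf)).
have K0 (f : W * T -> \bar R) w : nnmeas f -> (0 <= K w (fun y => f (w, y)))%E.
  by move=> nf; case: (KI w) => + _ _ _ _; apply; exact: nnmeas_pair1.
pose I (f : W * T -> \bar R) := (\int[P]_w f (w, X w))%E.
pose J (f : W * T -> \bar R) := (\int[P]_w K w (fun y => f (w, y)))%E.
have II : integral_functional I by exact: integral_functional_integral.
have JJ : integral_functional J.
  rewrite /J; split.
  - by move=> f nf; apply: integral_ge0 => w _; exact: K0.
  - move=> f g nf ng fg; apply: ge0_le_integral => //; try exact: mK'.
    + by move=> w _; exact: K0.
    + by move=> w _; case: (KI w) => _ + _ _ _; apply; [exact: nnmeas_pair1..|move=> y; exact: fg].
  - move=> f g nf ng; rewrite -ge0_integralD//; try exact: mK'; try by move=> w _; exact: K0.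
    apply: eq_integral => w _; case: (KI w) => _ _ + _ _; apply; exact: nnmeas_pair1.
  - move=> c f c0 nf; rewrite -ge0_integralZl//; try exact: mK'; try by move=> w _; exact: K0.
    apply: eq_integral => w _; case: (KI w) => _ _ _ + _; apply => //; exact: nnmeas_pair1.
  - move=> f_ nf ndf; rewrite -monotone_convergence//; last 3 first.
    + by move=> n; exact: mK'.
    + by move=> n w _; exact: K0.
    + move=> w _ m n mn.
      by case: (KI w) => _ + _ _ _; apply; [exact: nnmeas_pair1..|move=> y; exact: ndf].
    apply: eq_integral => w _; case: (KI w) => _ _ _ _; apply => //.
    by move=> n; exact: nnmeas_pair1.
apply: (integral_functional_eq_pi II JJ (C := [set A `*` B | A in measurable & B in measurable])).
- move=> _ _ [X1 mX1 [X2 mX2 <-]] [Y1 mY1 [Y2 mY2 <-]].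
  exists (X1 `&` Y1); first exact: measurableI.
  by exists (X2 `&` Y2); [exact: measurableI|rewrite setXI].
- by exists setT => //; exists setT => //; rewrite setXTT.
- by rewrite measurable_prod_measurableType.
- rewrite /I integral_cst// mul1e. exact: fin_num_fun_lty.
- move=> _ [A mA [B mB <-]]; rewrite /I /J.
  have EAB w y : eindic (A `*` B) (w, y) = (eindic A w * eindic B y)%E.
    rewrite /eindic -EFinM !indicE in_setX; case: (_ \in A); case: (_ \in B);
      by rewrite /= ?mulr1 ?mulr0 ?mul0r.
  have mA' : @measurable _ Om A by exact: sub_sigma_measurable.
  have mXB : measurable (X @^-1` B) by rewrite -[_ @^-1` _]setTI; exact: mX.
  have -> : (\int[P]_w eindic (A `*` B) (w, X w) = P (A `&` X @^-1` B))%E.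
    have mAB : @measurable _ Om (A `&` X @^-1` B) by exact: measurableI.
    rewrite -[A `&` _]setIT -(integral_indic P measurableT mAB).
    apply: eq_integral => w _; rewrite EAB /eindic -EFinM; congr (_%:E).
    by rewrite !indicE in_setI; case: (w \in A) => /=; rewrite ?mul1r ?mul0r.
  rewrite XE// integral_mkcond; apply: eq_integral => w _.
  rewrite patchE Klaw//.
  have -> : (fun y : T => eindic (A `*` B) (w, y) : \bar R) =
      (fun y : T => ((\1_A w : R)%:E * eindic B y)%E).
    by apply/funext => y; rewrite EAB.
  case: (KI w) => _ _ _ -> //; last exact: nnmeas_eindic.
  by rewrite indicE; case: ifP; rewrite ?mul1e ?mul0e.
Qed.

End Disintegration.

(** * Averages of bounded measurable functions *)

Section BoundedMeasurable.
Context {R : realType} {d : measure_display} {X : measurableType d}.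
Implicit Types f g : X -> R.

(** Bounded functions are integrable against every density, so no integrability condition has to be
    carried along. *)
Definition bmeas f := measurable_fun setT f /\ exists M, forall x, `|f x| <= M.

Lemma bmeas_cst (c : R) : bmeas (fun=> c).
Proof. by split => //; exists `|c|. Qed.

Lemma bmeasD f g : bmeas f -> bmeas g -> bmeas (fun x => f x + g x).
Proof.
move=> [mf [M hM]] [mg [N hN]]; split; first exact: measurable_funD.
by exists (M + N) => x; rewrite (le_trans (ler_normD _ _))// lerD.
Qed.

Lemma bmeasM f g : bmeas f -> bmeas g -> bmeas (fun x => f x * g x).
Proof.
move=> [mf [M hM]] [mg [N hN]]; split; first exact: measurable_funM.
by exists (M * N) => x; rewrite normrM ler_pM.
Qed.

Lemma bmeasZ c f : bmeas f -> bmeas (fun x => c * f x).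
Proof. exact/bmeasM/bmeas_cst. Qed.

Lemma bmeasB f g : bmeas f -> bmeas g -> bmeas (fun x => f x - g x).
Proof.
move=> bf bg; have -> : (fun x => f x - g x) = (fun x => f x + -1 * g x).
  by apply/funext => x; rewrite mulN1r.
by apply: bmeasD => //; exact: bmeasZ.
Qed.

Lemma bmeas_sum (I : Type) (s : seq I) (f : I -> X -> R) :
  (forall i, bmeas (f i)) -> bmeas (fun x => \sum_(i <- s) f i x).
Proof.
move=> bf; elim: s => [|i s IH].
  by under eq_fun do rewrite big_nil; exact: bmeas_cst.
by under eq_fun do rewrite big_cons; exact: bmeasD.
Qed.

End BoundedMeasurable.

Lemma bmeas_comp {R : realType} {d d' : measure_display} {X : measurableType d}
    {Y : measurableType d'} (f : Y -> R) (h : X -> Y) :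
  bmeas f -> measurable_fun setT h -> bmeas (fun x => f (h x)).
Proof.
move=> [mf [M hM]] mh; split; first exact: measurableT_comp.
by exists M => x; exact: hM.
Qed.

Lemma bmeas_nat_pred {R : realType} {dZ : measure_display} {Z : measurableType dZ}
    (N : Z -> nat) (b : pred nat) :
  measurable_fun setT N -> bmeas (fun z => (b (N z))%:R : R).
Proof.
move=> mN; split; last by exists 1 => z; case: (b _); rewrite ?normr1 ?normr0.
by apply: (measurableT_comp (f := fun n : nat => (b n)%:R : R)).
Qed.

Section Average.
Context {R : realType} {d : measure_display} {Y : measurableType d}.
Variables (m : {measure set Y -> \bar R}).

Definition density (k : Y -> R) := [/\ forall y, 0 <= k y,
  measurable_fun setT k & (\int[m]_y (k y)%:E = 1)%E].

(** One notion covers the choice of an action (density [pi s] with respect to [nu]), the transition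
    to a state and the expectation (both with weight [1]). *)
Definition avg (k g : Y -> R) : R := \int[m]_y (k y * g y).

Variable k : Y -> R.
Hypothesis dk : density k.
Implicit Types g : Y -> R.

Lemma density_integrable : m.-integrable setT (EFin \o k).
Proof.
have [k0 mk k1] := dk; apply/integrableP; split; first exact/measurable_EFinP.
rewrite (eq_integral (fun y => (k y)%:E)) ?k1 ?ltry// => y _ /=.
by rewrite ger0_norm.
Qed.

Lemma avg_integrable g : bmeas g -> m.-integrable setT (EFin \o (fun y => k y * g y)).
Proof.
move=> [mg [M hM]]; have [k0 mk k1] := dk.
apply: (@le_integrable _ _ _ m setT measurableT _ (EFin \o (fun y => M * k y))).
- by apply/measurable_EFinP; exact: measurable_funM.
- move=> y _ /=; rewrite lee_fin normrM (ger0_norm (k0 y)) normrM (ger0_norm (k0 y)).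
  by rewrite mulrC ler_wpM2r// (le_trans (hM y))// ler_norm.
- rewrite -[_ \o _]/(fun y => (M%:E * (k y)%:E)%E).
  by apply: integrableZl => //; exact: density_integrable.
Qed.

Lemma avgD g1 g2 : bmeas g1 -> bmeas g2 ->
  avg k (fun y => g1 y + g2 y) = avg k g1 + avg k g2.
Proof.
move=> b1 b2; rewrite /avg -RintegralD//; try exact: avg_integrable.
by apply: eq_Rintegral => y _; rewrite mulrDr.
Qed.

Lemma avgZ c g : bmeas g -> avg k (fun y => c * g y) = c * avg k g.
Proof.
move=> b; rewrite /avg -RintegralZl//; try exact: avg_integrable.
by apply: eq_Rintegral => y _; rewrite mulrCA.
Qed.

Lemma avgB g1 g2 : bmeas g1 -> bmeas g2 ->
  avg k (fun y => g1 y - g2 y) = avg k g1 - avg k g2.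
Proof.
move=> b1 b2; rewrite /avg -RintegralB//; try exact: avg_integrable.
by apply: eq_Rintegral => y _; rewrite mulrBr.
Qed.

Lemma avg_cst c : avg k (fun=> c) = c.
Proof.
rewrite -[X in avg _ X](_ : (fun=> c * 1) = _); last by rewrite mulr1.
rewrite avgZ; last exact: bmeas_cst.
have [_ _ k1] := dk; rewrite /avg /Rintegral; under eq_integral do rewrite mulr1.
by rewrite k1/= mulr1.
Qed.

Lemma avg_le g1 g2 : bmeas g1 -> bmeas g2 -> (forall y, g1 y <= g2 y) ->
  avg k g1 <= avg k g2.
Proof.
move=> b1 b2 g12; have [k0 _ _] := dk.
by apply: le_Rintegral => //; [exact: avg_integrable..|move=> y _; rewrite ler_wpM2l].
Qed.

Lemma avg_bound g M : bmeas g -> (forall y, `|g y| <= M) -> `|avg k g| <= M.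
Proof.
move=> b gM; rewrite ler_norml -{2}(avg_cst M) -{1}(avg_cst (- M)).
by apply/andP; split; apply: avg_le => //; try exact: bmeas_cst;
  by move=> y; have := gM y; rewrite ler_norml => /andP[].
Qed.

Lemma avg_ge0E g : bmeas g -> (forall y, 0 <= g y) ->
  (\int[m]_y ((k y)%:E * (g y)%:E) = (avg k g)%:E)%E.
Proof.
move=> b g0; rewrite /avg /Rintegral fineK//; last exact/integrable_fin_num/avg_integrable.
Qed.

Lemma avg_sum (I : Type) (s : seq I) (g : I -> Y -> R) :
  (forall i, bmeas (g i)) ->
  avg k (fun y => \sum_(i <- s) g i y) = \sum_(i <- s) avg k (g i).
Proof.
move=> bg; elim: s => [|i s IH].
  by under eq_fun do rewrite big_nil; rewrite big_nil avg_cst.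
under eq_fun do rewrite big_cons; rewrite big_cons avgD ?IH//.
exact: bmeas_sum.
Qed.

End Average.

(** * Disintegration along random draws *)

Section Expectation.
Context {R : realType} {dO : measure_display} {Om : measurableType dO}.
Variable P : probability Om R.

(* The weight [1] makes the theory of [avg] apply to expectations. *)
Definition Ex (u : Om -> R) : R := avg P (fun=> 1) u.

Lemma density_probability : density P (fun=> 1).
Proof.
split => //; rewrite integral_cst// mul1e; exact: probability_setT.
Qed.

Lemma ExE u : bmeas u -> (forall w, 0 <= u w) -> (\int[P]_w (u w)%:E = (Ex u)%:E)%E.
Proof.
move=> bu u0; rewrite -(avg_ge0E density_probability)//.
by apply: eq_integral => w _; rewrite mul1e.
Qed.

End Expectation.

Section MeasurableIntegral.
Context {R : realType} {dU dT : measure_display} {U : measurableType dU}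
  {T : measurableType dT}.

(** Common interface of the two cases that occur: the fixed sigma-finite measure on actions, handled
    by Fubini-Tonelli, and the transition kernel. *)
Definition measurable_integral (m : U -> {measure set T -> \bar R}) :=
  forall f : U * T -> \bar R, nnmeas f ->
    measurable_fun setT (fun u => \int[m u]_y f (u, y))%E.

Lemma measurable_integral_cst (nu : {sigma_finite_measure set T -> \bar R}) :
  measurable_integral (fun=> nu).
Proof. by move=> f [mf f0]; exact: measurable_fun_fubini_tonelli_F. Qed.

Variables (m : U -> {measure set T -> \bar R}) (k : U -> T -> R).
Hypothesis mint : measurable_integral m.
Hypothesis mk : measurable_fun setT (fun z : U * T => k z.1 z.2).
Hypothesis dk : forall u, density (m u) (k u).

Lemma bmeas_pair1 (g : U * T -> R) u : bmeas g -> bmeas (fun y => g (u, y)).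
Proof. by move=> bg; apply: (bmeas_comp bg); exact: measurable_pair1. Qed.

Lemma measurable_density_integral (f : U * T -> \bar R) : nnmeas f ->
  measurable_fun setT (fun u => \int[m u]_y ((k u y)%:E * f (u, y)))%E.
Proof.
move=> [mf f0]; apply: (mint (f := fun z => ((k z.1 z.2)%:E * f z)%E)); split.
  by apply: emeasurable_funM => //; apply/measurable_EFinP.
by move=> z; rewrite mule_ge0// lee_fin; case: (dk z.1).
Qed.

Lemma bmeas_avg (g : U * T -> R) : bmeas g ->
  bmeas (fun u => avg (m u) (k u) (fun y => g (u, y))).
Proof.
move=> bg; have [mg [M hM]] := bg; split; last first.
  by exists M => u; apply: avg_bound => //; exact: bmeas_pair1.
(* Adding a bound reduces to nonnegative functions; as densities have mass one, the average just
   shifts by [M]. The same device serves in [drawn_Ex] and [drawn_geom_Ex]. *)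
pose g' z := g z + M.
have bg' : bmeas g' by apply: bmeasD => //; exact: bmeas_cst.
have g'0 z : 0 <= g' z.
  by rewrite /g' -lerBlDr sub0r; have := hM z; rewrite ler_norml => /andP[].
have -> : (fun u => avg (m u) (k u) (fun y => g (u, y))) =
    (fun u => fine (\int[m u]_y ((k u y)%:E * (g' (u, y))%:E))%E - M).
  apply/funext => u; rewrite (avg_ge0E (dk u))/=; last by [].
    by rewrite avgD ?avg_cst ?addrK//; [exact: bmeas_pair1|exact: bmeas_cst].
  exact: bmeas_pair1.
apply: measurable_funB => //; apply: measurableT_comp => //.
apply: (measurable_density_integral (f := fun z => (g' z)%:E)); split.
  by apply/measurable_EFinP; case: bg'.
by move=> z; rewrite lee_fin.
Qed.

End MeasurableIntegral.

Lemma integral_functional_density {R : realType} {d : measure_display}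
    {Y : measurableType d} (m : {measure set Y -> \bar R}) (k : Y -> R) :
  measurable_fun setT k -> (forall y, 0 <= k y) ->
  integral_functional (fun f => \int[m]_y ((k y)%:E * f y))%E.
Proof.
move=> mk k0.
have n0 f y : nnmeas f -> (0 <= (k y)%:E * f y)%E.
  by move=> [_ f0]; rewrite mule_ge0// lee_fin.
have mc f : nnmeas f -> measurable_fun setT (fun y => (k y)%:E * f y)%E.
  by move=> [mf _]; apply: emeasurable_funM => //; exact/measurable_EFinP.
split.
- by move=> f nf; apply: integral_ge0 => y _; exact: n0.
- move=> f g nf ng fg.
  apply: ge0_le_integral => //; try exact: mc; try by move=> y _; exact: n0.
  by move=> y _; rewrite lee_wpmul2l// lee_fin.
- move=> f g nf ng; rewrite -ge0_integralD//; try exact: mc; try by move=> y _; exact: n0.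
  by apply: eq_integral => y _; rewrite ge0_muleDr//; [case: nf|case: ng].
- move=> c f c0 nf; rewrite -ge0_integralZl//; try exact: mc; try by move=> y _; exact: n0.
  by apply: eq_integral => y _; rewrite muleCA.
- move=> f_ nf ndf; rewrite -monotone_convergence//.
  + apply: eq_integral => y _; rewrite limeMl//.
    exact: ereal_nondecreasing_is_cvgn.
  + by move=> n; exact: mc.
  + by move=> n x _; exact: n0.
  + by move=> x _ a b ab; rewrite lee_wpmul2l// ?lee_fin//; exact: ndf.
Qed.

Section DisintegrationBounded.
Context {R : realType} {dO dT : measure_display} {Om : measurableType dO}
  {T : measurableType dT}.
Variables (P : probability Om R) (G : set_system Om).
Hypothesis GM : G `<=` measurable.
Local Notation W := (g_sigma_algebraType G).
Variables (X : Om -> T) (law : Om -> set T -> \bar R).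
Variables (m : W -> {measure set T -> \bar R}) (k : W -> T -> R).
Hypothesis XG : drawn P G X law.
Hypothesis mint : measurable_integral m.
Hypothesis mk : measurable_fun setT (fun z : W * T => k z.1 z.2).
Hypothesis dk : forall u, density (m u) (k u).
Hypothesis lawE : forall w B, measurable B -> law w B = (\int[m w]_(y in B) (k w y)%:E)%E.

Lemma bmeas_sub (u : Om -> R) : @bmeas R _ W u -> bmeas u.
Proof. by move=> [mu bu]; split => //; exact: (measurable_fun_sub GM). Qed.

Lemma drawn_Ex (g : W * T -> R) : bmeas g ->
  Ex P (fun w => g (w, X w)) = Ex P (fun w => avg (m w) (k w) (fun y => g (w, y))).
Proof.
have Ex_nn (f : W * T -> R) : bmeas f -> (forall z, 0 <= f z) ->
    Ex P (fun w => f (w, X w)) = Ex P (fun w => avg (m w) (k w) (fun y => f (w, y))).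
  move=> bf f0; apply: EFin_inj.
  have mX : measurable_fun setT X by case: XG.
  have mpair : measurable_fun setT (fun w : Om => (w, X w) : (W * T)%type).
    by apply: measurable_fun_pair => //; exact: (measurable_to_sub GM).
  have ba : bmeas (fun w : W => avg (m w) (k w) (fun y => f (w, y))) by exact: bmeas_avg.
  have a0 w : 0 <= avg (m w) (k w) (fun y => f (w, y)).
    by apply: Rintegral_ge0 => y _; rewrite mulr_ge0//; case: (dk w).
  rewrite -(ExE P (bmeas_sub ba) a0) -(ExE P (bmeas_comp bf mpair))//.
  pose K w (h : T -> \bar R) := (\int[m w]_y ((k w y)%:E * h y))%E.
  have := @drawn_nnintegral _ _ _ _ _ P G GM X law K XG _ _ _ (fun z => (f z)%:E).
  move=> -> //.
  - apply: eq_integral => w _.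
    exact (avg_ge0E (dk w) (bmeas_pair1 (w : W) bf) (fun y => f0 (w, y))).
  - move=> w; apply: integral_functional_density; last by case: (dk w).
    by case: (dk w).
  - move=> w B mB; rewrite lawE// integral_mkcond; apply: eq_integral => y _.
    by rewrite patchE /eindic indicE; case: ifP; rewrite ?mule1 ?mule0.
  - by move=> h nh; exact: measurable_density_integral.
  - by split; [apply/measurable_EFinP; case: bf|move=> z; rewrite lee_fin].
move=> bg; have [mg [M hM]] := bg.
have mX : measurable_fun setT X by case: XG.
have mpair : measurable_fun setT (fun w : Om => (w, X w) : (W * T)%type).
  by apply: measurable_fun_pair => //; exact: (measurable_to_sub GM).
have bM d' (Z : measurableType d') : bmeas (fun _ : Z => M) by exact: bmeas_cst.
have := Ex_nn (fun z => g z + M) (bmeasD bg (bM _ _)).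
have g0 z : 0 <= g z + M.
  by rewrite -lerBlDr sub0r; have := hM z; rewrite ler_norml => /andP[].
move=> /(_ g0); have dP := density_probability P.
have ba : bmeas (fun w : W => avg (m w) (k w) (fun y => g (w, y))) by exact: bmeas_avg.
have -> : (fun w => avg (m w) (k w) (fun y => g (w, y) + M)) =
    (fun w : Om => avg (m w) (k w) (fun y => g (w, y)) + M).
  apply/funext => w.
  by rewrite (avgD (dk w) (bmeas_pair1 (w : W) bg) (bM _ _)) (avg_cst (dk w)).
rewrite /Ex (avgD dP (bmeas_comp bg mpair) (bM _ _)).
by rewrite (avgD dP (bmeas_sub ba) (bM _ _)) => /addIr.
Qed.

End DisintegrationBounded.

Lemma integral_functionalZ {R : realType} {d : measure_display}
    {X : measurableType d} (I : (X -> \bar R) -> \bar R) (c : R) : 0 <= c ->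
  integral_functional I -> integral_functional (fun f => c%:E * I f)%E.
Proof.
move=> c0 [I0 IM ID IZ IL]; split.
- by move=> f nf; rewrite mule_ge0 ?lee_fin ?I0.
- by move=> f g nf ng fg; rewrite lee_wpmul2l ?lee_fin ?IM.
- by move=> f g nf ng; rewrite ID// ge0_muleDr ?I0.
- by move=> a f a0 nf; rewrite IZ// muleCA.
- move=> f_ nf ndf; rewrite IL// -limeMl//.
  by apply: ereal_nondecreasing_is_cvgn => m n mn; apply: IM => // x; exact: ndf.
Qed.

(** * Independent geometric horizons *)

Section Geometric.
Context {R : realType} {dO : measure_display} {Om : measurableType dO}.
Variables (P : probability Om R) (G : set_system Om).
Hypothesis GM : G `<=` measurable.
Local Notation W := (g_sigma_algebraType G).
Variables (N : Om -> nat) (q : R).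
Hypotheses (q01 : 0 <= q <= 1) (NG : drawn_geom P G N q).

Lemma measurable_hor (t : nat) : measurable (N @^-1` [set t]).
Proof. by case: NG => mN _; rewrite -[_ @^-1` _]setTI; exact: mN. Qed.

Let bmeas_hor (t : nat) : bmeas (fun w => (N w == t)%:R : R).
Proof. by apply: (bmeas_nat_pred (pred1 t)); case: NG. Qed.

(** For indicators of sets in [<<s G >>] this is the definition of [drawn_geom], and both sides
    extend to integral functionals on [W]. *)
Lemma drawn_geom_Ex (u : Om -> R) (t : nat) : @bmeas R _ W u ->
  Ex P (fun w => (N w == t)%:R * u w) = (1 - q) * q ^+ t * Ex P u.
Proof.
have [q0 q1] := andP q01.
have c0 : 0 <= (1 - q) * q ^+ t by rewrite mulr_ge0 ?exprn_ge0// subr_ge0.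
have mid : measurable_fun setT (id : Om -> W) by exact: measurable_to_sub.
pose I (f : W -> \bar R) := (\int[P]_(w in N @^-1` [set t]) f w)%E.
pose J (f : W -> \bar R) := (((1 - q) * q ^+ t)%:E * \int[P]_w f w)%E.
have II : integral_functional I.
  exact: (integral_functional_integral P (measurable_hor t) mid).
have JJ : integral_functional J.
  apply: integral_functionalZ c0 _.
  exact: (integral_functional_integral P measurableT mid).
have IJ f : nnmeas f -> I f = J f.
  apply: integral_functional_eq => // C mC; rewrite /I /J.
  have mC' : @measurable _ Om C by exact: (sub_sigma_measurable GM).
  rewrite /eindic (integral_indic P (measurable_hor t) mC').
  rewrite (integral_indic P measurableT mC') setIT.
  by case: NG => _; apply.
have Ex_nn (v : W -> R) : bmeas v -> (forall w, 0 <= v w) ->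
    Ex P (fun w => (N w == t)%:R * v w) = (1 - q) * q ^+ t * Ex P v.
  move=> bv v0; have bv' := bmeas_sub GM bv.
  apply: EFin_inj; rewrite -ExE; last 2 first.
  - exact: (bmeasM (bmeas_hor t) bv').
  - by move=> w; rewrite mulr_ge0.
  rewrite EFinM -ExE//; have := IJ (fun w => (v w)%:E); rewrite /I /J => <-.
    rewrite [RHS]integral_mkcond; apply: eq_integral => w _.
    rewrite patchE; have [Nwt|Nwt] := eqVneq (N w) t.
      by rewrite mem_set// mul1r.
    by rewrite memNset ?mul0r// => /= Nwt'; rewrite Nwt' eqxx in Nwt.
  by split; [apply/measurable_EFinP; case: bv|move=> w; rewrite lee_fin].
move=> bu; have [mu [M hM]] := bu; have bu' := bmeas_sub GM bu.
have dP := density_probability P.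
have bM d' (Z : measurableType d') : bmeas (fun _ : Z => M) by exact: bmeas_cst.
have bh := bmeas_hor t.
have u0 w : 0 <= u w + M.
  by rewrite -lerBlDr sub0r; have := hM w; rewrite ler_norml => /andP[].
have M0 : 0 <= M by rewrite (le_trans _ (hM point)).
have := Ex_nn _ (bmeasD bu (bM _ _)) u0; rewrite {2}/Ex (avgD dP bu' (bM _ _)).
have -> : (fun w => (N w == t)%:R * (u w + M)) =
    (fun w => (N w == t)%:R * u w + (N w == t)%:R * M).
  by apply/funext => w; rewrite mulrDr.
rewrite /Ex (avgD dP (bmeasM bh bu') (bmeasM bh (bM _ _))).
have := Ex_nn _ (bM _ W) (fun=> M0); rewrite /Ex mulrDr => ->.
by move=> /addIr.
Qed.

(** The tail is never summed: starting from the sure event, each step removes the atom [N = t], and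
    [q ^+ t - (1 - q) * q ^+ t = q ^+ t.+1]. *)
Lemma drawn_geom_tail_Ex (u : Om -> R) (t : nat) : @bmeas R _ W u ->
  Ex P (fun w => (t <= N w)%N%:R * u w) = q ^+ t * Ex P u.
Proof.
move=> bu; have bu' := bmeas_sub GM bu; have dP := density_probability P.
elim: t => [|t IH]; first by rewrite expr0 mul1r; congr Ex; apply/funext => w; rewrite mul1r.
have -> : (fun w => (t < N w)%N%:R * u w) =
    (fun w => (t <= N w)%N%:R * u w - (N w == t)%:R * u w).
  apply/funext => w; rewrite -mulrBl [(t <= N w)%N]leq_eqVlt eq_sym.
  by case: eqVneq => [->|]; rewrite ?ltnn ?subrr ?subr0.
have bt : bmeas (fun w => (t <= N w)%N%:R * u w).
  by apply: bmeasM => //; apply: (bmeas_nat_pred (leq t)); case: NG.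
rewrite /Ex (avgB dP bt (bmeasM (bmeas_hor t) bu')) -!/(Ex _ _) IH drawn_geom_Ex//.
by rewrite exprS -mulrBl; congr (_ * _); rewrite mulrBl mul1r subKr.
Qed.

End Geometric.

(** * Discounted sums *)

Section GeometricSeries.
Context {R : realType}.
Variables (gamma : R).
Hypothesis g01 : 0 < gamma < 1.

Lemma series_geometric_tail (a : nat -> R) (M : R) (n k : nat) :
  (forall t, `|a t| <= M) ->
  `|series (fun t => gamma ^+ t * a t) (n + k)%N -
    series (fun t => gamma ^+ t * a t) n| <= gamma ^+ n * (M / (1 - gamma)).
Proof.
have /andP[g0 g1] := g01; have g1' : 0 < 1 - gamma by rewrite subr_gt0.
move=> aM; have M0 : 0 <= M by rewrite (le_trans _ (aM 0)).
(* The factor [1 - gamma ^+ k], that of a finite geometric sum, is what makes the induction on [k]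
   close. *)
suff : `|series (fun t => gamma ^+ t * a t) (n + k)%N -
    series (fun t => gamma ^+ t * a t) n| <=
    gamma ^+ n * (M / (1 - gamma)) * (1 - gamma ^+ k).
  move=> /le_trans; apply; rewrite ler_piMr//.
    by rewrite mulr_ge0 ?exprn_ge0 ?divr_ge0 ?(ltW g0) ?(ltW g1').
  by rewrite lerBlDr lerDl exprn_ge0// ltW.
elim: k => [|k IH]; first by rewrite addn0 subrr normr0 expr0 subrr mulr0.
rewrite addnS seriesEnat /= big_nat_recr//= -[X in X + _ - _]/(series _ (n + k)%N).
rewrite addrAC (le_trans (ler_normD _ _))//.
have -> : gamma ^+ n * (M / (1 - gamma)) * (1 - gamma ^+ k.+1) =
    gamma ^+ n * (M / (1 - gamma)) * (1 - gamma ^+ k) + gamma ^+ (n + k) * M.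
  rewrite exprS exprD; field; lra.
by rewrite lerD// normrM ger0_norm ?ler_wpM2l ?exprn_ge0 ?(ltW g0).
Qed.

Lemma geometric_cvg0 (M : R) : (fun n => gamma ^+ n * M) @ \oo --> 0.
Proof.
have /andP[g0 g1] := g01.
rewrite -[X in _ --> X](mul0r M); apply: cvgMl; apply: cvg_expr.
by rewrite ger0_norm// ltW.
Qed.

Lemma series_geometric_cvg (a : nat -> R) (M : R) :
  (forall t, `|a t| <= M) -> cvgn (series (fun t => gamma ^+ t * a t)).
Proof.
have /andP[g0 g1] := g01; have g1' : 0 < 1 - gamma by rewrite subr_gt0.
move=> aM; have M0 : 0 <= M by rewrite (le_trans _ (aM 0)).
apply: normed_cvg; apply: (@series_le_cvg _ _ (geometric M gamma)).
- by move=> n; exact: normr_ge0.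
- by move=> n; rewrite /geometric /= mulr_ge0// exprn_ge0// ltW.
- move=> n; rewrite /geometric /= normrM (@ger0_norm _ (gamma ^+ n)) ?exprn_ge0 ?(ltW g0)//.
  by rewrite mulrC ler_wpM2r ?exprn_ge0 ?(ltW g0).
- by apply: is_cvg_geometric_series; rewrite ger0_norm// ltW.
Qed.

Lemma limn_geometric (a : nat -> R) (M : R) (n : nat) :
  (forall t, `|a t| <= M) ->
  `|limn (series (fun t => gamma ^+ t * a t)) -
    series (fun t => gamma ^+ t * a t) n| <= gamma ^+ n * (M / (1 - gamma)).
Proof.
move=> aM; have cS := series_geometric_cvg aM.
set S := series _ in cS *.
have cS' : (fun m => `|S m - S n|) @ \oo --> `|limn S - S n|.
  by apply: cvg_norm; apply: cvgB => //; exact: cvg_cst.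
rewrite -(cvg_lim _ cS')//; apply: limr_le; first by apply/cvg_ex; eexists; exact: cS'.
exists n => // m /= nm; rewrite -(subnKC nm); exact: series_geometric_tail.
Qed.

(** Used for every identity between discounted sums: both sides are compared with a common
    truncation at [n], which takes the place of a limit theorem under the integral. *)
Lemma eq_geometric_bound (x y M : R) :
  (forall n, `|x - y| <= gamma ^+ n * M) -> x = y.
Proof.
move=> xyM; apply/eqP; rewrite -subr_eq0 -normr_eq0 eq_le normr_ge0 andbT.
have gc := geometric_cvg0 M.
rewrite -(cvg_lim _ gc)//; apply: limr_ge; first by apply/cvg_ex; eexists; exact: gc.
by apply: nearW => n; exact: xyM.
Qed.

End GeometricSeries.

(** * Policy evaluation operators *)

Section KernelPullback.
Context {R : realType} {dU dX dY : measure_display} {U : measurableType dU}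
  {X : measurableType dX} {Y : measurableType dY}.
Variables (p : R.-pker X ~> Y) (h : U -> X).

(** The proof [mh] is an argument so that kernel instances can be attached to this constant. *)
Definition kernel_pullback (mh : measurable_fun setT h) (u : U) :
  {measure set Y -> \bar R} := p (h u).

Hypothesis mh : measurable_fun setT h.

Let measurable_kernel_pullback B : measurable B ->
  measurable_fun setT (kernel_pullback mh ^~ B).
Proof.
by move=> mB; apply: (measurableT_comp (measurable_kernel p _ mB)).
Qed.

HB.instance Definition _ := isKernel.Build _ _ _ _ R (kernel_pullback mh)
  measurable_kernel_pullback.

Let kernel_pullback_prob u : kernel_pullback mh u setT = 1%E.
Proof. exact: prob_kernel. Qed.

HB.instance Definition _ := Kernel_isProbability.Build _ _ _ _ R
  (kernel_pullback mh) kernel_pullback_prob.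

Lemma measurable_integral_pullback : measurable_integral (fun u => p (h u)).
Proof.
move=> f [mf f0].
exact: (measurable_fun_integral_finite_kernel f (kernel_pullback mh) f0 mf).
Qed.

End KernelPullback.

Section Operators.
Context {R : realType} {dS dA : measure_display}.
Context {S : measurableType dS} {A : measurableType dA}.
Variables (nu : {sigma_finite_measure set A -> \bar R}).
Variables (p : R.-pker (S * A)%type ~> S) (gamma : R).
Hypothesis g01 : 0 < gamma < 1.
Local Notation X := (S * A)%type.

Definition act (pi : S -> A -> R) (g : X -> R) (s : S) : R :=
  avg nu (pi s) (fun a => g (s, a)).

Definition jump (h : S -> R) (x : X) : R := avg (p x) (fun=> 1) h.

Definition step (pi : S -> A -> R) (g : X -> R) : X -> R := jump (act pi g).

(** Neumann series of the inverse of [1 - gamma * step pi], where [step pi] is the transition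
    operator of the chain of state-action pairs. For [g] the reward it is the action-value
    function. *)
Definition resolvent (pi : S -> A -> R) (g : X -> R) (x : X) : R :=
  limn (series (fun t => gamma ^+ t * iter t (step pi) g x)).

Lemma density_kernel x : density (p x) (fun=> 1).
Proof.
by split => //; rewrite integral_cst// mul1e; exact: prob_kernel.
Qed.

Lemma density_policy (pi : S -> A -> R) s : is_policy nu pi -> density nu (pi s).
Proof.
move=> [pi0 mpi pi1]; split => //.
exact: (measurableT_comp mpi (measurable_pair1 s)).
Qed.

Section Param.
Context {dU : measure_display} {U : measurableType dU}.
Variable pi : U -> S -> A -> R.
Hypothesis polpi : forall u, is_policy nu (pi u).
Hypothesis mpi : measurable_fun setT (fun z : U * X => pi z.1 z.2.1 z.2.2).

(** The parameter will be the sample point, on which the policy depends through the current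
    iterate. *)
Lemma bmeas_act_param (g : U * X -> R) : bmeas g ->
  bmeas (fun z : U * S => act (pi z.1) (fun x => g (z.1, x)) z.2).
Proof.
move=> bg.
have mt : measurable_fun setT (fun z : (U * S) * A => (z.1.1, (z.1.2, z.2)) : U * X).
  apply: measurable_fun_pair; first exact: measurableT_comp.
  by apply: measurable_fun_pair => //; exact: measurableT_comp.
apply: (@bmeas_avg _ _ _ _ _ (fun=> nu) (fun z a => pi z.1 z.2 a) _ _ _
  (fun z => g (z.1.1, (z.1.2, z.2)))).
- exact: measurable_integral_cst.
- exact: (measurableT_comp mpi mt).
- by move=> z; exact: density_policy.
- exact: (bmeas_comp bg mt).
Qed.

Lemma bmeas_jump_param (h : U * S -> R) : bmeas h ->
  bmeas (fun z : U * X => jump (fun s => h (z.1, s)) z.2).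
Proof.
move=> bh.
have mt : measurable_fun setT (fun z : (U * X) * S => (z.1.1, z.2) : U * S).
  by apply: measurable_fun_pair => //; exact: measurableT_comp.
apply: (@bmeas_avg _ _ _ _ _ (fun z => p z.2) (fun _ _ => 1) _ _ _
  (fun z => h (z.1.1, z.2))).
- exact: (measurable_integral_pullback p (@measurable_snd _ _ U X)).
- by [].
- by move=> z; exact: density_kernel.
- exact: (bmeas_comp bh mt).
Qed.

Lemma bmeas_step_param (g : U * X -> R) : bmeas g ->
  bmeas (fun z : U * X => step (pi z.1) (fun x => g (z.1, x)) z.2).
Proof. by move=> bg; exact: (bmeas_jump_param (bmeas_act_param bg)). Qed.

Lemma bmeas_iter_param (g : U * X -> R) t : bmeas g ->
  bmeas (fun z : U * X => iter t (step (pi z.1)) (fun x => g (z.1, x)) z.2).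
Proof.
elim: t g => [|t IH] g bg /=; last exact: (bmeas_step_param (IH _ bg)).
by rewrite (_ : (fun z => _) = g)//; apply/funext => -[].
Qed.

End Param.

Section Fixed.
Variable pi : S -> A -> R.
Hypothesis polpi : is_policy nu pi.
Implicit Types (g : X -> R) (h : S -> R).

Let mpi : measurable_fun setT (fun z : unit * X => pi z.2.1 z.2.2).
Proof. by case: polpi => _ mp _; apply: (measurableT_comp mp). Qed.

Lemma bmeas_act g : bmeas g -> bmeas (act pi g).
Proof.
move=> bg; have bg' : bmeas (fun z : unit * X => g z.2) by exact: bmeas_comp.
exact: (bmeas_pair1 tt (bmeas_act_param (pi := fun=> pi) (fun=> polpi) mpi bg')).
Qed.

Lemma bmeas_jump h : bmeas h -> bmeas (jump h).
Proof.
move=> bh; have bh' : bmeas (fun z : unit * S => h z.2) by exact: bmeas_comp.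
exact: (bmeas_pair1 tt (bmeas_jump_param bh')).
Qed.

Lemma bmeas_step g : bmeas g -> bmeas (step pi g).
Proof. by move=> bg; exact/bmeas_jump/bmeas_act. Qed.

Lemma bmeas_iter g t : bmeas g -> bmeas (iter t (step pi) g).
Proof. by move=> bg; elim: t => //= t IH; exact: bmeas_step. Qed.

Let b1 g s : bmeas g -> bmeas (fun a => g (s, a)).
Proof. exact: bmeas_pair1. Qed.

Lemma act_bound g M s : bmeas g -> (forall x, `|g x| <= M) -> `|act pi g s| <= M.
Proof.
by move=> bg gM; apply: (avg_bound (density_policy s polpi)) => //; exact: b1.
Qed.

Lemma jump_bound h M x : bmeas h -> (forall s, `|h s| <= M) -> `|jump h x| <= M.
Proof. by move=> bh hM; exact: (avg_bound (density_kernel x)). Qed.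

Lemma step_bound g M x : bmeas g -> (forall x, `|g x| <= M) -> `|step pi g x| <= M.
Proof.
move=> bg gM; apply: jump_bound; first exact: bmeas_act.
by move=> s; exact: act_bound.
Qed.

Lemma iter_bound g M t x : bmeas g -> (forall x, `|g x| <= M) ->
  `|iter t (step pi) g x| <= M.
Proof.
move=> bg gM; elim: t x => //= t IH x; apply: step_bound => //; exact: bmeas_iter.
Qed.

Lemma actD g1 g2 : bmeas g1 -> bmeas g2 ->
  act pi (fun x => g1 x + g2 x) = (fun s => act pi g1 s + act pi g2 s).
Proof. by move=> ? ?; apply/funext => s; apply: (avgD (density_policy s polpi)); exact: b1. Qed.

Lemma actZ c g : bmeas g -> act pi (fun x => c * g x) = (fun s => c * act pi g s).
Proof. by move=> ?; apply/funext => s; apply: (avgZ (density_policy s polpi)); exact: b1. Qed.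

Lemma jumpD h1 h2 : bmeas h1 -> bmeas h2 ->
  jump (fun s => h1 s + h2 s) = (fun x => jump h1 x + jump h2 x).
Proof. by move=> ? ?; apply/funext => x; exact: (avgD (density_kernel x)). Qed.

Lemma jumpZ c h : bmeas h -> jump (fun s => c * h s) = (fun x => c * jump h x).
Proof. by move=> ?; apply/funext => s; exact: (avgZ (density_kernel _)). Qed.

Lemma stepD g1 g2 : bmeas g1 -> bmeas g2 ->
  step pi (fun x => g1 x + g2 x) = (fun x => step pi g1 x + step pi g2 x).
Proof. by move=> ? ?; rewrite /step actD// jumpD//; exact: bmeas_act. Qed.

Lemma stepZ c g : bmeas g -> step pi (fun x => c * g x) = (fun x => c * step pi g x).
Proof. by move=> ?; rewrite /step actZ// jumpZ//; exact: bmeas_act. Qed.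

Lemma actB g1 g2 : bmeas g1 -> bmeas g2 ->
  act pi (fun x => g1 x - g2 x) = (fun s => act pi g1 s - act pi g2 s).
Proof. by move=> ? ?; apply/funext => s; apply: (avgB (density_policy s polpi)); exact: b1. Qed.

Lemma stepB g1 g2 : bmeas g1 -> bmeas g2 ->
  step pi (fun x => g1 x - g2 x) = (fun x => step pi g1 x - step pi g2 x).
Proof.
move=> ? ?; rewrite /step actB//; apply/funext => x.
by apply: (avgB (density_kernel x)); exact: bmeas_act.
Qed.

Lemma bmeas_series g n :
  bmeas g -> bmeas (fun x => series (fun t => gamma ^+ t * iter t (step pi) g x) n).
Proof.
by move=> bg; apply: bmeas_sum => t; apply: bmeasZ; exact: bmeas_iter.
Qed.

Lemma step_series g n : bmeas g ->
  (fun x => g x + gamma * step pi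
    (fun y => series (fun t => gamma ^+ t * iter t (step pi) g y) n) x) =
  (fun x => series (fun t => gamma ^+ t * iter t (step pi) g x) n.+1).
Proof.
move=> bg; elim: n => [|n IH].
  apply/funext => x; rewrite !seriesEnat /= big_nat1 expr0 mul1r.
  (* The empty sum is written as a multiple of [g] so that [stepZ] computes its image. *)
  rewrite (_ : (fun y => _) = (fun y => 0 * g y)); last first.
    by apply/funext => y; rewrite seriesEnat/= big_geq// mul0r.
  by rewrite stepZ// mul0r mulr0 addr0.
rewrite (_ : (fun y => series _ n.+1) = (fun y =>
    series (fun t => gamma ^+ t * iter t (step pi) g y) n +
    gamma ^+ n * iter n (step pi) g y)); last first.
  by apply/funext => y; rewrite seriesSr.
rewrite stepD ?stepZ; [|exact: bmeas_iter|exact: bmeas_series|exact/bmeasZ/bmeas_iter].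
apply/funext => x; rewrite mulrDr addrA.
have /(congr1 (fun f => f x)) /= -> := IH.
by rewrite [RHS]seriesSr exprS mulrA.
Qed.

Section Resolvent.
Variables (g : X -> R) (M : R).
Hypotheses (bg : bmeas g) (gM : forall x, `|g x| <= M).

Lemma resolvent_approx n x :
  `|resolvent pi g x - series (fun t => gamma ^+ t * iter t (step pi) g x) n| <=
  gamma ^+ n * (M / (1 - gamma)).
Proof. by apply: limn_geometric => // t; exact: iter_bound. Qed.

Lemma resolvent_bound x : `|resolvent pi g x| <= M / (1 - gamma).
Proof.
by have := resolvent_approx 0 x; rewrite seriesEnat/= big_geq// subr0 mul1r.
Qed.

Lemma bmeas_resolvent : bmeas (resolvent pi g).
Proof.
split; last by exists (M / (1 - gamma)); exact: resolvent_bound.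
apply: (@measurable_fun_cvg _ _ _ _
  (fun n x => series (fun t => gamma ^+ t * iter t (step pi) g x) n)).
  by move=> n; case: (bmeas_series n bg).
by move=> x _; apply: (series_geometric_cvg g01) => t; exact: iter_bound.
Qed.

Lemma resolvent_fix x : resolvent pi g x = g x + gamma * step pi (resolvent pi g) x.
Proof.
have /andP[g0 g1] := g01.
(* Two truncation errors occur, that of order [n.+1] and [gamma] times that of order [n]; each is at
   most [gamma ^+ n.+1 * (M / (1 - gamma))]. *)
apply: (@eq_geometric_bound _ _ g01 _ _ (gamma * (M / (1 - gamma)) *+ 2)) => n.
pose Sn y := series (fun t => gamma ^+ t * iter t (step pi) g y) n.
have bSn : bmeas Sn by exact: bmeas_series.
have -> : resolvent pi g x - (g x + gamma * step pi (resolvent pi g) x) =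
   (resolvent pi g x - series (fun t => gamma ^+ t * iter t (step pi) g x) n.+1) -
   gamma * step pi (fun y => resolvent pi g y - Sn y) x.
  have /(congr1 (fun f => f x)) /= <- := step_series n bg.
  rewrite (stepB bmeas_resolvent bSn) -/Sn.
  move: (resolvent pi g x) (step pi _ x) (step pi _ x) => a b c; ring.
rewrite (le_trans (ler_normB _ _))// mulrnAr mulr2n lerD//.
  by rewrite mulrA -exprSr; exact: resolvent_approx.
rewrite normrM (ger0_norm (ltW g0)) mulrCA ler_wpM2l ?(ltW g0)//.
apply: step_bound; first exact: (bmeasB bmeas_resolvent bSn).
by move=> y; exact: resolvent_approx.
Qed.

End Resolvent.

Lemma step_unroll (y g : X -> R) n : bmeas y -> bmeas g ->
  (forall x, y x = g x + gamma * step pi y x) ->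
  forall x, y x = series (fun t => gamma ^+ t * iter t (step pi) g x) n +
    gamma ^+ n * iter n (step pi) y x.
Proof.
move=> yb bg yE; elim: n => [|n IH] x.
  by rewrite seriesEnat/= big_geq// add0r expr0 mul1r.
have yE' : y = (fun x => series (fun t => gamma ^+ t * iter t (step pi) g x) n +
    gamma ^+ n * iter n (step pi) y x) by apply/funext.
rewrite yE {1}yE' stepD; [|exact: bmeas_series|exact/bmeasZ/bmeas_iter].
have /(congr1 (fun f => f x)) /= <- := step_series n bg.
by rewrite stepZ /=; [rewrite exprS; ring|exact: bmeas_iter].
Qed.

(** Unrolling the equation [n] times leaves a remainder [gamma ^+ n * iter n (step pi) y], which
    vanishes as [y] is bounded. A function is thus recognised as a resolvent by checking one linear
    equation; linearity and the change of policy are obtained this way. *)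
Lemma resolvent_unique (y g : X -> R) : bmeas y -> bmeas g ->
  (forall x, y x = g x + gamma * step pi y x) -> y = resolvent pi g.
Proof.
move=> yb bg yE; apply/funext => x.
have [_ [M yM]] := yb; have [_ [N gN]] := bg; have /andP[g0 g1] := g01.
apply: (@eq_geometric_bound _ _ g01 _ _ (M + N / (1 - gamma))) => n.
rewrite (step_unroll n yb bg yE) mulrDr.
set s := series _ n; set z := gamma ^+ n * iter _ _ _ _.
have -> : s + z - resolvent pi g x = z - (resolvent pi g x - s).
  by rewrite opprB addrCA addrA.
rewrite (le_trans (ler_normB _ _))// lerD//; last exact: resolvent_approx.
by rewrite normrM ger0_norm ?ler_wpM2l ?iter_bound ?exprn_ge0 ?(ltW g0).
Qed.

End Fixed.

Lemma bmeas_resolvent_param {dU : measure_display} {U : measurableType dU}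
    (pi : U -> S -> A -> R) (g : U * X -> R) :
  (forall u, is_policy nu (pi u)) ->
  measurable_fun setT (fun z : U * X => pi z.1 z.2.1 z.2.2) -> bmeas g ->
  bmeas (fun z : U * X => resolvent (pi z.1) (fun x => g (z.1, x)) z.2).
Proof.
move=> polpi mpi bg; have [_ [M gM]] := bg; split; last first.
  exists (M / (1 - gamma)) => z; apply: resolvent_bound => //; exact: bmeas_pair1.
apply: (@measurable_fun_cvg _ _ _ _
  (fun n (z : U * X) => series (fun t => gamma ^+ t *
    iter t (step (pi z.1)) (fun x => g (z.1, x)) z.2) n)).
  move=> n; have [//] : bmeas (fun z : U * X => series (fun t => gamma ^+ t *
    iter t (step (pi z.1)) (fun x => g (z.1, x)) z.2) n).
  by apply: bmeas_sum => t; apply: bmeasZ; exact: bmeas_iter_param.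
move=> z _; apply: (series_geometric_cvg g01) => t; apply: iter_bound => //.
exact: bmeas_pair1.
Qed.

End Operators.

(** * Trajectories *)

Section SubSigma.
Context {dO : measure_display} {Om : measurableType dO}.
Implicit Types G H : set_system Om.

Lemma measurable_fun_mono d (Y : measurableType d) G H (f : Om -> Y) :
  G `<=` H -> @measurable_fun _ _ (g_sigma_algebraType G) Y setT f ->
  @measurable_fun _ _ (g_sigma_algebraType H) Y setT f.
Proof.
move=> GH mf _ B mB; have := mf measurableT B mB.
exact: (sub_sigma_algebra2 GH).
Qed.

Lemma measurable_fun_events d (Y : measurableType d) G (f : Om -> Y) :
  events f `<=` G -> @measurable_fun _ _ (g_sigma_algebraType G) Y setT f.
Proof.
move=> fG _ B mB; apply: sub_sigma_algebra; apply: fG; by exists B.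
Qed.

Lemma events_measurable d (Y : measurableType d) (f : Om -> Y) :
  measurable_fun setT f -> events f `<=` measurable.
Proof. by move=> mf _ [B mB <-]; exact: mf. Qed.

Lemma bmeas_mono {R : realType} G H (u : Om -> R) : G `<=` H ->
  @bmeas R _ (g_sigma_algebraType G) u -> @bmeas R _ (g_sigma_algebraType H) u.
Proof. by move=> GH [mu bu]; split => //; exact: measurable_fun_mono mu. Qed.

End SubSigma.

Section TrajectoryExpectation.
Context {R : realType} {dO dS dA : measure_display} {Om : measurableType dO}
  {S : measurableType dS} {A : measurableType dA}.
Variables (P : probability Om R) (nu : {sigma_finite_measure set A -> \bar R}).
Variables (p : R.-pker (S * A)%type ~> S).
Local Notation X := (S * A)%type.
Variables (G : set_system Om).
Hypothesis GM : G `<=` measurable.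
Local Notation W := (g_sigma_algebraType G).
Variable pi : W -> S -> A -> R.
Hypothesis polpi : forall w, is_policy nu (pi w).
Hypothesis mpi : measurable_fun setT (fun z : W * X => pi z.1 z.2.1 z.2.2).

(** Two levels of information: policy and integrand depend on [G], while the action is drawn given
    the larger [H], which also knows the state [s]. *)
Lemma drawn_action_Ex (H : set_system Om) (s : Om -> S) (a : Om -> A) (g : W * X -> R) :
  G `<=` H -> H `<=` measurable -> events s `<=` H ->
  drawn P H a (fun w => action_law nu (pi w) (s w)) -> bmeas g ->
  Ex P (fun w => g (w, (s w, a w))) =
  Ex P (fun w => act nu (pi w) (fun x => g (w, x)) (s w)).
Proof.
move=> GH HM sH aH bg.
pose W' := g_sigma_algebraType H.
have mid : @measurable_fun _ _ W' W setT id by exact: (measurable_fun_mono GH).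
have ms : @measurable_fun _ _ W' S setT s by exact: measurable_fun_events.
have mt : measurable_fun setT (fun z : W' * A => (z.1, (s z.1, z.2)) : W * X).
  apply: measurable_fun_pair; first exact: (measurableT_comp mid measurable_fst).
  by apply: measurable_fun_pair => //; exact: (measurableT_comp ms measurable_fst).
rewrite (@drawn_Ex _ _ _ Om A P H HM a _ (fun=> nu) (fun w : W' => pi w (s w)) aH
  _ _ _ _ (fun z => g (z.1, (s z.1, z.2)))) //.
- exact: measurable_integral_cst.
- exact: (measurableT_comp mpi mt).
- by move=> w; exact: density_policy.
- exact: (bmeas_comp bg mt).
Qed.

Lemma drawn_state_Ex (H : set_system Om) (s s' : Om -> S) (a : Om -> A) (h : W * S -> R) :
  G `<=` H -> H `<=` measurable -> events s `<=` H -> events a `<=` H ->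
  drawn P H s' (fun w => p (s w, a w)) -> bmeas h ->
  Ex P (fun w => h (w, s' w)) =
  Ex P (fun w => jump p (fun y => h (w, y)) (s w, a w)).
Proof.
move=> GH HM sH aH s'H bh.
pose W' := g_sigma_algebraType H.
have mid : @measurable_fun _ _ W' W setT id by exact: (measurable_fun_mono GH).
have ms : @measurable_fun _ _ W' S setT s by exact: measurable_fun_events.
have ma : @measurable_fun _ _ W' A setT a by exact: measurable_fun_events.
have msa : measurable_fun setT (fun w : W' => (s w, a w)).
  exact: measurable_fun_pair.
have mt : measurable_fun setT (fun z : W' * S => (z.1, z.2) : W * S).
  by apply: measurable_fun_pair => //; exact: (measurableT_comp mid measurable_fst).
rewrite (@drawn_Ex _ _ _ Om S P H HM s' _ (fun w : W' => p (s w, a w)) (fun _ _ => 1) s'H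
  _ _ _ _ (fun z => h (z.1, z.2))) //.
- exact: measurable_integral_pullback.
- by move=> w; exact: density_kernel.
- by move=> w B mB; rewrite integral_cst// mul1e.
- exact: (bmeas_comp bh mt).
Qed.

Variables (s : nat -> Om -> S) (a : nat -> Om -> A).
Hypothesis cont : continues P nu p G pi s a.
Hypotheses (ms0 : measurable_fun setT (s 0)) (ma0 : measurable_fun setT (a 0)).

Lemma measurable_trajectory t : measurable_fun setT (s t) /\ measurable_fun setT (a t).
Proof.
by case: t => // t; case: cont => /(_ t)[+ _] /(_ t)[].
Qed.

Lemma history_measurable m n : history G s a m n `<=` measurable.
Proof.
move=> B [[/GM//|]|] [i _]; apply: events_measurable;
  by case: (measurable_trajectory i).
Qed.

Lemma history_base m n : G `<=` history G s a m n.
Proof. by move=> B GB; left; left. Qed.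

Lemma history_state m n i : (i < m)%N -> events (s i) `<=` history G s a m n.
Proof. by move=> im B sB; left; right; exists i. Qed.

Lemma history_action m n i : (i < n)%N -> events (a i) `<=` history G s a m n.
Proof. by move=> im B sB; right; exists i. Qed.

Lemma continues_step_Ex (g : W * X -> R) t : bmeas g ->
  Ex P (fun w => g (w, (s t.+1 w, a t.+1 w))) =
  Ex P (fun w => step nu p (pi w) (fun x => g (w, x)) (s t w, a t w)).
Proof.
move=> bg; case: cont => cs ca.
rewrite (drawn_action_Ex _ _ _ (ca t) bg); last 3 first.
- exact: history_base.
- exact: history_measurable.
- exact: history_state.
have ba := bmeas_act_param polpi mpi bg.
rewrite (@drawn_state_Ex _ (s t) (s t.+1) (a t)
  (fun z => act nu (pi z.1) (fun x => g (z.1, x)) z.2) _ _ _ _ (cs t))//.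
- exact: history_base.
- exact: history_measurable.
- exact: history_state.
- exact: history_action.
Qed.

(** The recursion runs backwards in time: integrating out the last pair replaces [g] by its image
    under [step], so the induction must be over all [g]. *)
Lemma continues_Ex (g : W * X -> R) t : bmeas g ->
  Ex P (fun w => g (w, (s t w, a t w))) =
  Ex P (fun w => iter t (step nu p (pi w)) (fun x => g (w, x)) (s 0 w, a 0 w)).
Proof.
elim: t g => [//|t IH] g bg; rewrite continues_step_Ex//.
rewrite (IH (fun z => step nu p (pi z.1) (fun x => g (z.1, x)) z.2)).
  by congr (Ex P _); apply/funext => w; rewrite iterSr.
exact: bmeas_step_param.
Qed.

End TrajectoryExpectation.

Section FromState.
Context {R : realType} {dO dS dA : measure_display} {Om : measurableType dO}
  {S : measurableType dS} {A : measurableType dA}.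
Variables (P : probability Om R) (nu : {sigma_finite_measure set A -> \bar R}).
Variables (p : R.-pker (S * A)%type ~> S).
Local Notation X := (S * A)%type.
Variables (G : set_system Om).
Hypothesis GM : G `<=` measurable.
Local Notation W := (g_sigma_algebraType G).
Variable pi : W -> S -> A -> R.
Hypothesis polpi : forall w, is_policy nu (pi w).
Hypothesis mpi : measurable_fun setT (fun z : W * X => pi z.1 z.2.1 z.2.2).

Lemma trajectory_from_state_Ex (s0 : S) (s : nat -> Om -> S) (a : nat -> Om -> A)
    (g : W * X -> R) t :
  trajectory_from_state P nu p G pi s0 s a -> bmeas g ->
  Ex P (fun w => g (w, (s t w, a t w))) =
  Ex P (fun w => act nu (pi w) (iter t (step nu p (pi w)) (fun x => g (w, x))) s0).
Proof.
move=> [s0E a0 cont] bg.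
have ms0 : measurable_fun setT (s 0%N) by rewrite (_ : s 0%N = fun=> s0)//; exact/funext.
have ma0 : measurable_fun setT (a 0%N) by case: a0.
rewrite (continues_Ex GM polpi mpi cont ms0 ma0)//.
have bi := bmeas_iter_param p polpi mpi t bg.
rewrite (@drawn_action_Ex _ _ _ _ _ _ _ P nu G pi polpi mpi (history G s a 1 0)
  (s 0%N) (a 0%N) (fun z => iter t (step nu p (pi z.1)) (fun x => g (z.1, x)) z.2) _ _ _ a0 bi).
- by congr (Ex P _); apply/funext => w; rewrite s0E.
- exact: history_base.
- exact: (history_measurable GM cont).
- exact: history_state.
Qed.

End FromState.

Lemma measurable_fun_select {dZ dY : measure_display} {Z : measurableType dZ}
    {Y : measurableType dY} (N : Z -> nat) (f : nat -> Z -> Y) :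
  measurable_fun setT N -> (forall n, measurable_fun setT (f n)) ->
  measurable_fun setT (fun z => f (N z) z).
Proof.
move=> mN mf _ B mB; rewrite setTI.
have -> : (fun z => f (N z) z) @^-1` B = \bigcup_n (N @^-1` [set n] `&` f n @^-1` B).
  apply/seteqP; split=> [z Bz|z [n _ [/= <-]]//].
  by exists (N z).
apply: bigcup_measurable => n _; apply: measurableI.
  by rewrite -[_ @^-1` _]setTI; exact: mN.
by rewrite -[_ @^-1` _]setTI; exact: mf.
Qed.

Section ResolventAction.
Context {R : realType} {dS dA : measure_display}.
Context {S : measurableType dS} {A : measurableType dA}.
Variables (nu : {sigma_finite_measure set A -> \bar R}).
Variables (p : R.-pker (S * A)%type ~> S) (gamma : R).
Hypothesis g01 : 0 < gamma < 1.
Local Notation X := (S * A)%type.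
Variable pi : S -> A -> R.
Hypothesis polpi : is_policy nu pi.

Lemma iterZ c (g : X -> R) t : bmeas g ->
  iter t (step nu p pi) (fun x => c * g x) = (fun x => c * iter t (step nu p pi) g x).
Proof.
by move=> bg; elim: t => //= t ->; rewrite stepZ//; exact: bmeas_iter.
Qed.

Lemma act_series (g : X -> R) n s : bmeas g ->
  act nu pi (fun x => series (fun t => gamma ^+ t * iter t (step nu p pi) g x) n) s =
  series (fun t => gamma ^+ t * act nu pi (iter t (step nu p pi) g) s) n.
Proof.
move=> bg; rewrite /act.
rewrite [LHS](avg_sum (density_policy s polpi) (index_iota 0 n)
  (g := fun t a => gamma ^+ t * iter t (step nu p pi) g (s, a))).
  apply: eq_bigr => t _; rewrite (avgZ (density_policy s polpi))//.
  by apply: bmeas_pair1; exact: bmeas_iter.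
by move=> t; apply: bmeasZ; apply: bmeas_pair1; exact: bmeas_iter.
Qed.

Lemma act_resolvent_approx (g : X -> R) (M : R) n s : bmeas g -> (forall x, `|g x| <= M) ->
  `|act nu pi (resolvent nu p gamma pi g) s -
    series (fun t => gamma ^+ t * act nu pi (iter t (step nu p pi) g) s) n| <=
  gamma ^+ n * (M / (1 - gamma)).
Proof.
move=> bg gM; rewrite -act_series//.
pose dlt x := resolvent nu p gamma pi g x +
  -1 * series (fun t => gamma ^+ t * iter t (step nu p pi) g x) n.
have bS := bmeas_series p gamma polpi n bg.
have bR := bmeas_resolvent p g01 polpi bg gM.
have -> : act nu pi (resolvent nu p gamma pi g) s - act nu pi
    (fun x => series (fun t => gamma ^+ t * iter t (step nu p pi) g x) n) s =
    act nu pi dlt s.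
  by rewrite /dlt actD ?actZ//; [rewrite mulN1r|exact: bmeasZ].
apply: act_bound => //; first by apply: bmeasD => //; exact: bmeasZ.
by move=> x; rewrite /dlt mulN1r; exact: resolvent_approx.
Qed.

End ResolventAction.

Lemma Ex_series {R : realType} {dO : measure_display} {Om : measurableType dO}
    (P : probability Om R) (c : R) (f : nat -> Om -> R) n :
  (forall t, bmeas (f t)) ->
  Ex P (fun w => series (fun t => c ^+ t * f t w) n) =
  series (fun t => c ^+ t * Ex P (f t)) n.
Proof.
move=> bf; rewrite /Ex.
rewrite [LHS](avg_sum (density_probability P) (index_iota 0 n)
  (g := fun t w => c ^+ t * f t w)); last by move=> t; exact: bmeasZ.
by apply: eq_bigr => t _; rewrite (avgZ (density_probability P)).
Qed.

Lemma Ex_dist {R : realType} {dO : measure_display} {Om : measurableType dO}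
    (P : probability Om R) (f g : Om -> R) (M : R) :
  bmeas f -> bmeas g -> (forall w, `|f w - g w| <= M) -> `|Ex P f - Ex P g| <= M.
Proof.
move=> bf bg fgM; rewrite /Ex -(avgB (density_probability P))//.
by apply: (avg_bound (density_probability P)) => //; exact: bmeasB.
Qed.

Section Value.
Context {R : realType} {dS dA : measure_display}.
Context {S : measurableType dS} {A : measurableType dA}.
Variables (nu : {sigma_finite_measure set A -> \bar R}).
Variables (p : R.-pker (S * A)%type ~> S) (gamma : R).
Hypothesis g01 : 0 < gamma < 1.
Local Notation X := (S * A)%type.
Variables (r : X -> R) (U : R).
Hypotheses (mr : measurable_fun setT r) (rU : forall x, `|r x| <= U).

Lemma bmeas_reward : bmeas r.
Proof. by split=> //; exists U. Qed.

(** [is_value] refers to an unspecified probability space; this formula shows that the value does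
    not depend on it. Both sides lie within [gamma ^+ n * (U / (1 - gamma))] of the same partial sum
    [m]. Nothing is known beforehand, so the base sigma-algebra is generated by [set0]. *)
Lemma value_resolvent (pi : S -> A -> R) (s0 : S) (v : R) : is_policy nu pi ->
  is_value nu p r gamma pi s0 v -> v = act nu pi (resolvent nu p gamma pi r) s0.
Proof.
move=> polpi [dO [Om [P [s [a [traj vE]]]]]].
have br := bmeas_reward.
have GM : @set0 (set Om) `<=` measurable by [].
pose W := g_sigma_algebraType (@set0 (set Om)).
have mpi : measurable_fun setT (fun z : W * X => pi z.2.1 z.2.2).
  by case: polpi => _ mp _; apply: (measurableT_comp mp).
have bgt : bmeas (fun z : W * X => r z.2) by exact: bmeas_comp.
have [ms ma] : (forall t, measurable_fun setT (s t)) /\ (forall t, measurable_fun setT (a t)).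
  case: traj => s0E a0 cont.
  have ms0 : measurable_fun setT (s 0%N) by rewrite (_ : s 0%N = fun=> s0)//; exact/funext.
  have ma0 : measurable_fun setT (a 0%N) by case: a0.
  by split=> t; case: (measurable_trajectory cont ms0 ma0 t).
have brt t : bmeas (fun w => r (s t w, a t w)).
  by apply: (bmeas_comp br); exact: measurable_fun_pair.
have Et t : Ex P (fun w => r (s t w, a t w)) = act nu pi (iter t (step nu p pi) r) s0.
  rewrite (trajectory_from_state_Ex GM (pi := fun=> pi) (fun=> polpi) mpi t traj bgt).
  by rewrite -[RHS](avg_cst (density_probability P)).
pose Z w := limn (series (fun t => gamma ^+ t * r (s t w, a t w))).
have Zn n w : `|Z w - series (fun t => gamma ^+ t * r (s t w, a t w)) n| <=
    gamma ^+ n * (U / (1 - gamma)) by exact: limn_geometric.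
have bSn n : bmeas (fun w => series (fun t => gamma ^+ t * r (s t w, a t w)) n).
  by apply: bmeas_sum => t; exact: bmeasZ.
have bZ : bmeas Z.
  split; last first.
    exists (U / (1 - gamma)) => w; have := Zn 0%N w.
    by rewrite seriesEnat/= big_geq// subr0 mul1r.
  apply: (@measurable_fun_cvg _ _ _ _
    (fun n w => series (fun t => gamma ^+ t * r (s t w, a t w)) n)).
    by move=> n; case: (bSn n).
  by move=> w _; exact: (series_geometric_cvg g01).
have -> : v = Ex P Z.
  apply: EFin_inj; rewrite vE unlock /Ex /avg /Rintegral.
  rewrite fineK; last exact/integrable_fin_num/(avg_integrable (density_probability P)).
  by apply: eq_integral => w _; rewrite mul1r.
apply: (@eq_geometric_bound _ _ g01 _ _ (U / (1 - gamma) *+ 2)) => n.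
pose m := series (fun t => gamma ^+ t * act nu pi (iter t (step nu p pi) r) s0) n.
have -> : Ex P Z - act nu pi (resolvent nu p gamma pi r) s0 =
  (Ex P Z - m) - (act nu pi (resolvent nu p gamma pi r) s0 - m) by ring.
rewrite (le_trans (ler_normB _ _))// mulr2n mulrDr lerD//.
  have <- : Ex P (fun w => series (fun t => gamma ^+ t * r (s t w, a t w)) n) = m.
    by rewrite Ex_series// /m; congr (series _ n); apply/funext => t; rewrite Et.
  by apply: Ex_dist.
exact: act_resolvent_approx.
Qed.

End Value.

(** * One iteration of the algorithm *)

Lemma sum_indicator {R : realType} (N n : nat) (f : nat -> R) :
  \sum_(0 <= t < n) (N == t)%:R * f t = (N < n)%N%:R * f N.
Proof.
elim: n => [|n IH]; first by rewrite big_geq// mul0r.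
rewrite big_nat_recr//= IH ltnS [(N <= n)%N]leq_eqVlt.
by case: eqVneq => [->|]; rewrite ?ltnn ?mul0r ?add0r ?addr0.
Qed.

Section RpgDraws.
Context {R : realType} {dO dS dA : measure_display} {Om : measurableType dO}
  {S : measurableType dS} {A : measurableType dA}.
Variables (P : probability Om R) (nu : {sigma_finite_measure set A -> \bar R}).
Variables (p : R.-pker (S * A)%type ~> S) (gamma : R).
Hypothesis g01 : 0 < gamma < 1.
Local Notation X := (S * A)%type.
Variables (F : set_system Om).
Hypothesis FM : F `<=` measurable.
Local Notation W := (g_sigma_algebraType F).
Variable pi : W -> S -> A -> R.
Hypothesis polpi : forall w, is_policy nu (pi w).
Hypothesis mpi : measurable_fun setT (fun z : W * X => pi z.1 z.2.1 z.2.2).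

Lemma measurable_fun_mono_pair (H : set_system Om) d d' (Z : measurableType d)
    (Y : measurableType d') (f : W * Z -> Y) : F `<=` H -> measurable_fun setT f ->
  @measurable_fun _ _ (g_sigma_algebraType H * Z)%type Y setT f.
Proof.
move=> FH mf; pose W' := g_sigma_algebraType H.
have mid : @measurable_fun _ _ W' W setT id by exact: (measurable_fun_mono FH).
have mt : measurable_fun setT (fun z : W' * Z => (z.1, z.2) : W * Z).
  by apply: measurable_fun_pair => //; exact: (measurableT_comp mid measurable_fst).
rewrite (_ : f = f \o (fun z : W' * Z => (z.1, z.2) : W * Z)); last first.
  by apply/funext => -[].
exact: (measurableT_comp mf mt).
Qed.

Lemma bmeas_mono_pair (H : set_system Om) d (Z : measurableType d) (f : W * Z -> R) :
  F `<=` H -> bmeas f -> @bmeas R _ (g_sigma_algebraType H * Z)%type f.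
Proof. by move=> FH [mf bf]; split => //; exact: measurable_fun_mono_pair. Qed.

Section FirstPair.
Variables (T : Om -> nat) (s : nat -> Om -> S) (a : nat -> Om -> A) (s0 : S).
Hypothesis T_geom : drawn_geom P F T gamma.
Hypothesis traj : trajectory_from_state P nu p (F `|` events T) pi s0 s a.

Let mT : measurable_fun setT T. Proof. by case: T_geom. Qed.

Let FT : F `<=` F `|` events T. Proof. by move=> B; left. Qed.

Lemma first_horizon_measurable : F `|` events T `<=` measurable.
Proof. by move=> B [/FM//|]; exact: events_measurable. Qed.

Lemma measurable_from_state t : measurable_fun setT (s t) /\ measurable_fun setT (a t).
Proof.
case: traj => s0E a0 cont; apply: measurable_trajectory cont _ _ t.
  by rewrite (_ : s 0%N = fun=> s0)//; exact/funext.
by case: a0.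
Qed.

(** The horizon is drawn before the trajectory, so its indicator is a constant for the trajectory
    operators and factors out of them. What multiplies it is then known from [F], of which the
    horizon is independent. *)
Lemma first_pair_term_Ex (v : W * X -> R) t : bmeas v ->
  Ex P (fun w => (T w == t)%:R * v (w, (s t w, a t w))) =
  (1 - gamma) * gamma ^+ t *
  Ex P (fun w => act nu (pi w) (iter t (step nu p (pi w)) (fun x => v (w, x))) s0).
Proof.
move=> bv; have /andP[g0 g1] := g01.
pose W1 := g_sigma_algebraType (F `|` events T).
have mT1 : @measurable_fun _ _ W1 nat setT T.
  by apply: measurable_fun_events => B; right.
have bT1 : bmeas (fun z : W1 * X => (T z.1 == t)%:R : R).
  by apply: (bmeas_nat_pred (pred1 t)); exact: (measurableT_comp mT1 measurable_fst).
have bv1 : @bmeas R _ (W1 * X)%type v by exact: bmeas_mono_pair.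
have mpi1 : @measurable_fun _ _ (W1 * X)%type R setT (fun z => pi z.1 z.2.1 z.2.2).
  exact: (measurable_fun_mono_pair FT mpi).
have := @trajectory_from_state_Ex _ _ _ _ _ _ _ P nu p _ first_horizon_measurable
  pi polpi mpi1 s0 s a _ t traj (bmeasM bT1 bv1).
move=> ->.
have bvw w : bmeas (fun x => v (w, x)) by exact: bmeas_pair1.
have -> : (fun w => act nu (pi w) (iter t (step nu p (pi w))
     (fun x => (T (w, x).1 == t)%:R * v (w, x))) s0) =
   (fun w => (T w == t)%:R * act nu (pi w) (iter t (step nu p (pi w)) (fun x => v (w, x))) s0).
  by apply/funext => w /=; rewrite iterZ// actZ//; exact: bmeas_iter.
have q01 : 0 <= gamma <= 1 by rewrite (ltW g0) (ltW g1).
rewrite (drawn_geom_Ex FM q01 T_geom)//.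
have bi := bmeas_iter_param p polpi mpi t bv.
exact: (bmeas_comp (bmeas_act_param polpi mpi bi) (measurable_pair2 s0)).
Qed.

Lemma first_pair_Ex (v : W * X -> R) : bmeas v ->
  Ex P (fun w => v (w, (s (T w) w, a (T w) w))) = (1 - gamma) *
  Ex P (fun w => act nu (pi w) (resolvent nu p gamma (pi w) (fun x => v (w, x))) s0).
Proof.
move=> bv; have /andP[g0 g1] := g01; have g1' : 0 < 1 - gamma by rewrite subr_gt0.
have [_ [M vM]] := bv.
have M0 : 0 <= M by rewrite (le_trans _ (vM point)).
have bvw w : bmeas (fun x => v (w, x)) by exact: bmeas_pair1.
have mid : @measurable_fun _ _ Om W setT id by exact: (measurable_to_sub FM).
have bvs t : bmeas (fun w => v (w, (s t w, a t w))).
  apply: (bmeas_comp bv); have [ms ma] := measurable_from_state t.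
  by apply: measurable_fun_pair => //; exact: measurable_fun_pair.
have bvT : bmeas (fun w => v (w, (s (T w) w, a (T w) w))).
  apply: (bmeas_comp bv); apply: measurable_fun_pair => //; apply: measurable_fun_pair.
    by apply: measurable_fun_select => // n; case: (measurable_from_state n).
  by apply: measurable_fun_select => // n; case: (measurable_from_state n).
have bE t : bmeas (fun w => (T w == t)%:R * v (w, (s t w, a t w))).
  by apply: bmeasM => //; exact: (bmeas_nat_pred (pred1 t)).
have bact t : @bmeas R _ Om
    (fun w => act nu (pi w) (iter t (step nu p (pi w)) (fun x => v (w, x))) s0).
  apply: (bmeas_sub FM); have bi := bmeas_iter_param p polpi mpi t bv.
  exact: (bmeas_comp (bmeas_act_param polpi mpi bi) (measurable_pair2 s0)).
have bres : @bmeas R _ Om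
    (fun w => act nu (pi w) (resolvent nu p gamma (pi w) (fun x => v (w, x))) s0).
  apply: (bmeas_sub FM); have bi := bmeas_resolvent_param p g01 polpi mpi bv.
  exact: (bmeas_comp (bmeas_act_param polpi mpi bi) (measurable_pair2 s0)).
apply: (@eq_geometric_bound _ _ g01 _ _ (M *+ 2)) => n.
(* The decomposition over the values of [T], cut at [n]. The weight [1 ^+ t] gives it the shape
   expected by [Ex_series]. *)
pose m := Ex P (fun w => series (fun t => 1 ^+ t * ((T w == t)%:R * v (w, (s t w, a t w)))) n).
have mE : m = (1 - gamma) * Ex P (fun w => series (fun t => gamma ^+ t *
    act nu (pi w) (iter t (step nu p (pi w)) (fun x => v (w, x))) s0) n).
  rewrite /m Ex_series// Ex_series// !seriesEnat /= big_distrr /=.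
  by apply: eq_bigr => t _; rewrite expr1n mul1r first_pair_term_Ex// mulrA.
set lhs := Ex P _; set rhs := Ex P _.
have -> : lhs - (1 - gamma) * rhs = (lhs - m) - ((1 - gamma) * rhs - m) by ring.
rewrite (le_trans (ler_normB _ _))// mulr2n mulrDr lerD//.
  have bn : bmeas (fun w => (n <= T w)%N%:R * M).
    by apply: bmeasM; [exact: (bmeas_nat_pred (leq n))|exact: bmeas_cst].
  have bm : bmeas (fun w => series (fun t => 1 ^+ t * ((T w == t)%:R * v (w, (s t w, a t w)))) n).
    by apply: bmeas_sum => t; exact: bmeasZ.
  (* The cut sum is exact where [T w < n]; elsewhere the error is at most [M], on an event of
     probability [gamma ^+ n]. *)
  have <- : Ex P (fun w => (n <= T w)%N%:R * M) = gamma ^+ n * M.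
    have q01 : 0 <= gamma <= 1 by rewrite (ltW g0) (ltW g1).
    rewrite (drawn_geom_tail_Ex FM q01 T_geom n (bmeas_cst M)).
    by rewrite /Ex (avg_cst (density_probability P)).
  rewrite /lhs /m /Ex -(avgB (density_probability P) bvT bm).
  rewrite ler_norml; apply/andP.
  have key w : `|v (w, (s (T w) w, a (T w) w)) -
     series (fun t => 1 ^+ t * ((T w == t)%:R * v (w, (s t w, a t w)))) n| <= (n <= T w)%N%:R * M.
    rewrite seriesEnat /=; under eq_bigr do rewrite expr1n mul1r.
    rewrite (sum_indicator (T w) n (fun t => v (w, (s t w, a t w)))) ltnNge.
    by case: leqP => _ /=; rewrite ?mul0r ?mul1r ?subr0 ?subrr ?normr0.
  rewrite -mulN1r -(avgZ (density_probability P))//.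
  split; apply: (avg_le (density_probability P)) => //.
  + exact: bmeasZ.
  + exact: bmeasB.
  + by move=> w; rewrite mulN1r; have := key w; rewrite ler_norml => /andP[].
  + exact: bmeasB.
  + by move=> w; have := key w; rewrite ler_norml => /andP[].
have -> : gamma ^+ n * M = (1 - gamma) * (gamma ^+ n * (M / (1 - gamma))).
  by field; lra.
rewrite mE -mulrBr normrM (ger0_norm (ltW g1')) ler_wpM2l// ?(ltW g1')//.
apply: Ex_dist => //; first by apply: bmeas_sum => t; exact: bmeasZ.
by move=> w; apply: act_resolvent_approx.
Qed.

End FirstPair.

End RpgDraws.

Lemma powR_half_expr {R : realType} (gamma : R) (t : nat) : 0 < gamma ->
  gamma `^ (t%:R / 2) = (gamma `^ (1 / 2)) ^+ t.
Proof. by move=> g0; rewrite -powR_mulrn ?powR_ge0// -powRrM mulrC mul1r. Qed.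

(** * Unbiasedness of the random-horizon estimator *)

Section Estimator.
Context {R : realType} {dO dS dA : measure_display} {Om : measurableType dO}
  {S : measurableType dS} {A : measurableType dA}.
Variables (P : probability Om R) (nu : {sigma_finite_measure set A -> \bar R}).
Variables (p : R.-pker (S * A)%type ~> S) (gamma : R).
Hypothesis g01 : 0 < gamma < 1.
Local Notation X := (S * A)%type.
Local Notation q := (gamma `^ (1 / 2)).
Variables (F : set_system Om).
Hypothesis FM : F `<=` measurable.
Local Notation W := (g_sigma_algebraType F).
Variable pi : W -> S -> A -> R.
Hypothesis polpi : forall w, is_policy nu (pi w).
Hypothesis mpi : measurable_fun setT (fun z : W * X => pi z.1 z.2.1 z.2.2).
Variables (N : Om -> nat) (sT : Om -> S) (aT : Om -> A) (s : nat -> Om -> S) (a : nat -> Om -> A).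
Hypotheses (msT : @measurable_fun _ _ W S setT sT) (maT : @measurable_fun _ _ W A setT aT).
Hypothesis N_geom : drawn_geom P F N q.
Hypothesis traj : trajectory_from_pair P nu p (F `|` events N) pi sT aT s a.
Variables (r : X -> R) (U : R).
Hypotheses (mr : measurable_fun setT r) (rU : forall x, `|r x| <= U).

Lemma half_discount01 : 0 < q < 1.
Proof.
have /andP[g0 g1] := g01; rewrite powR_gt0//=.
have : q < 1 `^ (1 / 2) by apply: gt0_ltr_powR; rewrite ?nnegrE// ltW.
by rewrite powR1.
Qed.

Lemma half_discount_sqr : q * q = gamma.
Proof.
have /andP[g0 g1] := g01; rewrite -powRD; last by rewrite (gt_eqF g0) implybT.
by rewrite (_ : 1 / 2 + 1 / 2 = 1 :> R) ?powRr1 ?(ltW g0)//; field.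
Qed.

Let mN : measurable_fun setT N. Proof. by case: N_geom. Qed.

Let FN : F `<=` F `|` events N. Proof. by move=> B; left. Qed.

Lemma second_horizon_measurable : F `|` events N `<=` measurable.
Proof. by move=> B [/FM//|]; exact: events_measurable. Qed.

Lemma measurable_from_pair t : measurable_fun setT (s t) /\ measurable_fun setT (a t).
Proof.
case: traj => s0E a0E cont; apply: measurable_trajectory cont _ _ t.
  by rewrite (_ : s 0%N = sT); [exact: (measurable_fun_sub FM)|exact/funext].
by rewrite (_ : a 0%N = aT); [exact: (measurable_fun_sub FM)|exact/funext].
Qed.

Let br : bmeas r. Proof. by split=> //; exists U. Qed.

Let bT (u : Om -> R) t : @bmeas R _ W u ->
  @bmeas R _ W (fun w => u w * iter t (step nu p (pi w)) r (sT w, aT w)).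
Proof.
move=> bu; have brW : bmeas (fun z : W * X => r z.2) by exact: bmeas_comp.
have bi := bmeas_iter_param p polpi mpi t brW.
apply: bmeasM => //; apply: (bmeas_comp bi (h := fun w : W => (w, (sT w, aT w)))).
by apply: measurable_fun_pair => //; exact: measurable_fun_pair.
Qed.

Lemma estimator_term_Ex (u : Om -> R) t : @bmeas R _ W u ->
  Ex P (fun w => u w * ((t <= N w)%N%:R * r (s t w, a t w))) =
  q ^+ t * Ex P (fun w => u w * iter t (step nu p (pi w)) r (sT w, aT w)).
Proof.
move=> bu; have /andP[q0 q1] := half_discount01.
pose W1 := g_sigma_algebraType (F `|` events N).
have mN1 : @measurable_fun _ _ W1 nat setT N.
  by apply: measurable_fun_events => B; right.
have bN1 : @bmeas R _ W1 (fun w => (t <= N w)%N%:R) by exact: (bmeas_nat_pred (leq t)).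
have bu1 : @bmeas R _ W1 u by exact: bmeas_mono bu.
have buN : bmeas (fun z : W1 * X => (u z.1 * (t <= N z.1)%N%:R) * r z.2).
  apply: bmeasM; last exact: bmeas_comp.
  exact: (bmeas_comp (bmeasM bu1 bN1) measurable_fst).
have mpi1 : @measurable_fun _ _ (W1 * X)%type R setT (fun z => pi z.1 z.2.1 z.2.2).
  exact: (measurable_fun_mono_pair FN mpi).
have [s0E a0E cont] := traj.
have ms0 : measurable_fun setT (s 0%N) by case: (measurable_from_pair 0).
have ma0 : measurable_fun setT (a 0%N) by case: (measurable_from_pair 0).
have := @continues_Ex _ _ _ _ _ _ _ P nu p _ second_horizon_measurable
  pi polpi mpi1 s a cont ms0 ma0 _ t buN.
rewrite /= => H.
have -> : (fun w => u w * ((t <= N w)%N%:R * r (s t w, a t w))) =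
    (fun w => u w * (t <= N w)%N%:R * r (s t w, a t w)).
  by apply/funext => w; rewrite mulrA.
have q01 : 0 <= q <= 1 by rewrite (ltW q0) (ltW q1).
rewrite H -(drawn_geom_tail_Ex FM q01 N_geom t (bT t bu)); congr (Ex P _).
by apply/funext => w; rewrite iterZ// s0E a0E mulrAC mulrC mulrA.
Qed.

Definition estimator (w : Om) : R :=
  \sum_(0 <= t < (N w).+1) gamma `^ (t%:R / 2) * r (s t w, a t w).

(** The random number of terms is traded for the factor [(t <= N w)%:R] in a series over all [t].
    Since [t = N w] is included, the estimator is its partial sum of length [(N w).+1], and all
    later terms vanish. *)
Lemma estimator_approx n w :
  `|estimator w - series (fun t => q ^+ t * ((t <= N w)%N%:R * r (s t w, a t w))) n| <=
  q ^+ n * (U / (1 - q)).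
Proof.
have /andP[g0 g1] := g01; have /andP[q0 q1] := half_discount01.
have U0 : 0 <= U by rewrite (le_trans _ (rU point)).
pose b t := (t <= N w)%N%:R * r (s t w, a t w).
have bU t : `|b t| <= U.
  by rewrite /b; case: leqP => _; rewrite ?mul0r ?mul1r ?normr0.
have eE : estimator w = series (fun t => q ^+ t * b t) (N w).+1.
  rewrite seriesEnat /= /estimator; apply: eq_big_nat => t /andP[_ tN].
  move: tN; rewrite ltnS powR_half_expr// /b => -> /=; by rewrite [X in _ = _ * X]mul1r.
rewrite eE -/(b _); have [nN|Nn] := leqP n (N w).+1.
  by rewrite -(subnKC nN); exact: (series_geometric_tail half_discount01 _ _ bU).
have -> : series (fun t => q ^+ t * b t) n = series (fun t => q ^+ t * b t) (N w).+1.
  rewrite !seriesEnat /= (big_cat_nat (n := (N w).+1))//=; last exact: ltnW.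
  rewrite [X in _ + X]big1_seq ?addr0// => t /andP[_].
  by rewrite mem_index_iota => /andP[Nt _]; rewrite /b leqNgt Nt mul0r mulr0.
by rewrite subrr normr0 mulr_ge0 ?divr_ge0 ?exprn_ge0 ?(ltW q0)// subr_ge0 ltW.
Qed.

Lemma bmeas_estimator_series n :
  bmeas (fun w => series (fun t => q ^+ t * ((t <= N w)%N%:R * r (s t w, a t w))) n).
Proof.
apply: bmeas_sum => t; apply: bmeasZ; apply: bmeasM.
  exact: (bmeas_nat_pred (leq t)).
apply: (bmeas_comp br); have [? ?] := measurable_from_pair t.
exact: measurable_fun_pair.
Qed.

Lemma estimator_bound w : `|estimator w| <= U / (1 - q).
Proof.
have := estimator_approx 0 w; rewrite seriesEnat/= big_geq// subr0.
by rewrite [X in _ <= X]mul1r.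
Qed.

Lemma bmeas_estimator : bmeas estimator.
Proof.
have /andP[q0 q1] := half_discount01.
split; last by exists (U / (1 - q)); exact: estimator_bound.
apply: (@measurable_fun_cvg _ _ _ _ (fun n w =>
  series (fun t => q ^+ t * ((t <= N w)%N%:R * r (s t w, a t w))) n)).
  by move=> n; case: (bmeas_estimator_series n).
move=> w _; apply/cvgrPdist_le => e e0.
have := geometric_cvg0 half_discount01 (U / (1 - q)).
move=> /cvgrPdist_le /(_ _ e0); apply: filterS => n.
rewrite sub0r normrN => /(le_trans (ler_norm _)); apply: le_trans.
exact: estimator_approx.
Qed.

(* Each term carries [q ^+ t] from the discount and [q ^+ t] from the event [t <= N],
   hence [q ^+ t * q ^+ t = gamma ^+ t]. *)
Lemma estimator_Ex (u : Om -> R) : @bmeas R _ W u ->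
  Ex P (fun w => u w * estimator w) =
  Ex P (fun w => u w * resolvent nu p gamma (pi w) r (sT w, aT w)).
Proof.
move=> bu; have [_ [K uK]] := bu; have bu' := bmeas_sub FM bu.
have /andP[g0 g1] := g01; have /andP[q0 q1] := half_discount01.
have K0 : 0 <= K by rewrite (le_trans _ (uK point)).
have U0 : 0 <= U by rewrite (le_trans _ (rU point)).
(* The resolvent is truncated at rate [gamma ^+ n], the estimator only at rate [q ^+ n]; this
   inequality puts both errors under the slower rate. *)
have gq : gamma <= q by rewrite -[X in X <= _]half_discount_sqr ler_piMr// ltW.
have bres : @bmeas R _ Om (fun w => u w * resolvent nu p gamma (pi w) r (sT w, aT w)).
  apply: bmeasM => //; apply: (bmeas_sub FM).
  have brW : bmeas (fun z : W * X => r z.2) by exact: bmeas_comp.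
  have bi := bmeas_resolvent_param p g01 polpi mpi brW.
  apply: (bmeas_comp bi (h := fun w : W => (w, (sT w, aT w)))).
  by apply: measurable_fun_pair => //; exact: measurable_fun_pair.
have bt t : bmeas (fun w => u w * ((t <= N w)%N%:R * r (s t w, a t w))).
  apply: bmeasM => //; apply: bmeasM; first exact: (bmeas_nat_pred (leq t)).
  apply: (bmeas_comp br); have [? ?] := measurable_from_pair t.
  exact: measurable_fun_pair.
apply: (@eq_geometric_bound _ _ half_discount01 _ _
  (K * (U / (1 - q)) + K * (U / (1 - gamma)))) => n.
pose mn := series (fun t => gamma ^+ t *
  Ex P (fun w => u w * iter t (step nu p (pi w)) r (sT w, aT w))) n.
have mn1 : mn = Ex P (fun w => u w *
    series (fun t => q ^+ t * ((t <= N w)%N%:R * r (s t w, a t w))) n).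
  rewrite /mn.
  transitivity (series (fun t => q ^+ t *
      Ex P (fun w => u w * ((t <= N w)%N%:R * r (s t w, a t w)))) n).
    congr (series _ n); apply/funext => t; rewrite estimator_term_Ex// mulrA.
    by rewrite -exprMn half_discount_sqr.
  rewrite -Ex_series//; congr (Ex P _); apply/funext => w.
  rewrite !seriesEnat /= big_distrr /=; apply: eq_bigr => t _.
  by rewrite mulrCA.
have mn2 : mn = Ex P (fun w => u w *
    series (fun t => gamma ^+ t * iter t (step nu p (pi w)) r (sT w, aT w)) n).
  rewrite /mn -Ex_series; last by move=> t; exact: (bmeas_sub FM (bT t bu)).
  congr (Ex P _); apply/funext => w.
  rewrite !seriesEnat /= big_distrr /=; apply: eq_bigr => t _.
  by rewrite mulrCA.
set lhs := Ex P _; set rhs := Ex P _.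
have -> : lhs - rhs = (lhs - mn) - (rhs - mn) by ring.
rewrite (le_trans (ler_normB _ _))// mulrDr lerD//.
  rewrite mn1; apply: Ex_dist.
  - by apply: bmeasM => //; exact: bmeas_estimator.
  - by apply: bmeasM => //; exact: bmeas_estimator_series.
  - by move=> w; rewrite -mulrBr normrM mulrCA ler_pM//; exact: estimator_approx.
have : `|rhs - mn| <= K * (gamma ^+ n * (U / (1 - gamma))).
  rewrite mn2; apply: Ex_dist => //.
  - apply: bmeasM => //; apply: (bmeas_sub FM).
    have b1 : @bmeas R _ W (fun=> 1) by exact: bmeas_cst.
    apply: bmeas_sum => t; apply: bmeasZ.
    by have := bT t b1; under eq_fun do rewrite mul1r.
  - by move=> w; rewrite -mulrBr normrM ler_pM//; exact: resolvent_approx.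
move=> /le_trans; apply; rewrite mulrCA ler_wpM2r//.
  by rewrite mulr_ge0// divr_ge0// subr_ge0 ltW.
by apply: lerXn2r; rewrite ?nnegrE ?(ltW g0) ?(ltW q0).
Qed.

End Estimator.

(** * Real analysis *)

Section SeriesAux.
Context {R : realType}.

(* Once below [e], [g] can only grow during steps where [g k >= e]; there its increment
   [C * alpha k] is at most [C / e ^+ 2 * (alpha k * g k ^+ 2)], and these sum to little. *)
Lemma slowly_varying_cvg0 (alpha g : nat -> R) (C : R) :
  (forall k, 0 < alpha k) -> (forall k, 0 <= g k) -> 0 <= C ->
  (forall k, g k.+1 <= g k + C * alpha k) ->
  series alpha @ \oo --> +oo -> alpha @ \oo --> 0 ->
  cvgn (series (fun k => alpha k * g k ^+ 2)) ->
  g @ \oo --> 0.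
Proof.
move=> a0 g0 C0 gC sa aq cS; set S := series _ in cS.
have ndS : nondecreasing_seq S.
  by apply: nondecreasing_series => k _ _; rewrite mulr_ge0 ?exprn_ge0// ltW.
have SE m : S m.+1 = S m + alpha m * g m ^+ 2 by rewrite /S seriesSr.
(* Three shares of [e]: one for starting below [e], one for the step that crosses [e], one for all
   the growth above [e]. *)
apply/cvgrPdist_le => e0 e0_gt0; pose e := e0 / 3.
have e_gt0 : 0 < e by rewrite divr_gt0.
have C1 : 0 < C + 1 by rewrite ltr_wpDl.
(* [C + 1] instead of [C], as [C] may be [0]. The power [e ^+ 3] compensates the factor [C / e ^+ 2]
   in the growth above [e]. *)
have eta1 : 0 < e / (C + 1) by rewrite divr_gt0.
have eta2 : 0 < e ^+ 3 / (C + 1) by rewrite divr_gt0// exprn_gt0.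
have /cvgrPdist_lt /(_ _ eta1) [N1 _ HN1] := aq.
have /cvgrPdist_lt /(_ _ eta2) [N2 _ HN2] := cS.
pose N := maxn N1 N2.
have aN k : (N <= k)%N -> C * alpha k <= e.
  rewrite geq_max => /andP[N1k _]; have := HN1 _ N1k; rewrite /= sub0r normrN gtr0_norm//.
  move=> /ltW H; rewrite (le_trans (ler_wpM2l C0 H))// mulrCA ler_piMr ?(ltW e_gt0)//.
  by rewrite ler_pdivrMr// mul1r lerDl.
have SN k m : (N <= m)%N -> (m <= k)%N -> C / e ^+ 2 * (S k - S m) <= e.
  move=> Nm mk; have H : S k - S m <= e ^+ 3 / (C + 1).
    have Sk : S k <= limn S by exact: nondecreasing_cvgn_le.
    have : `|limn S - S m| < e ^+ 3 / (C + 1).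
      by apply: HN2 => /=; rewrite (leq_trans _ Nm)// leq_maxr.
    by rewrite ltr_norml => /andP[_ /ltW]; apply: le_trans; rewrite lerD2r.
  have Ce : 0 <= C / e ^+ 2 by rewrite divr_ge0// exprn_ge0// ltW.
  rewrite (le_trans (ler_wpM2l Ce H))//.
  have -> : C / e ^+ 2 * (e ^+ 3 / (C + 1)) = e * (C / (C + 1)).
    by field; rewrite ?lt0r_neq0.
  by rewrite ler_piMr ?(ltW e_gt0)// ler_pdivrMr// mul1r lerDl.
(* If [g] stayed above [e], the convergent series would dominate [e ^+ 2] times the divergent series
   of the [alpha k]. *)
have [m Nm gm] : exists2 m, (N <= m)%N & g m < e.
  apply: contrapT => H.
  have ge m : (N <= m)%N -> e <= g m.
    by move=> Nm; rewrite leNgt; apply/negP => gm; apply: H; exists m.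
  have lower k : e ^+ 2 * (series alpha (N + k)%N - series alpha N) <= S (N + k)%N - S N.
    elim: k => [|k IH]; first by rewrite addn0 !subrr mulr0.
    rewrite addnS SE seriesSr addrAC mulrDr [leRHS]addrAC lerD//.
    rewrite mulrC ler_wpM2l ?(ltW (a0 _))//.
    by rewrite ler_pXn2r ?nnegrE ?(ltW e_gt0)// ge// leq_addr.
  have /cvgryPge /(_ (series alpha N + ((limn S - S N + 1) / e ^+ 2))) [K _ HK] := sa.
  have := HK (N + K)%N (leq_addl _ _); rewrite /= -lerBrDl => HK'.
  have e2 : 0 < e ^+ 2 by rewrite exprn_gt0.
  have := lower K; rewrite -(ler_pM2l e2) in HK'; move=> /(le_trans HK').
  rewrite mulrCA mulfV ?lt0r_neq0// mulr1.
  have : S (N + K)%N <= limn S by exact: nondecreasing_cvgn_le.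
  by move=> ? ?; lra.
(* If [g] is below [e], the next value is at most [e + e] whatever happened before; if not, the
   increment is absorbed by the increment of [S]. *)
have bnd k : g (m + k)%N <= e + e + C / e ^+ 2 * (S (m + k)%N - S m).
  elim: k => [|k IH]; first by rewrite addn0 subrr mulr0 addr0 (le_trans (ltW gm))// lerDl ltW.
  rewrite addnS SE (le_trans (gC _))//.
  have mk : (N <= m + k)%N by rewrite (leq_trans Nm)// leq_addr.
  have Ce : 0 <= C / e ^+ 2 by rewrite divr_ge0// exprn_ge0// ltW.
  have [ge|ge] := leP e (g (m + k)%N).
    rewrite [X in _ <= _ + _ * X]addrAC mulrDr addrA lerD//.
    have -> : C * alpha (m + k)%N = C / e ^+ 2 * (alpha (m + k)%N * e ^+ 2).
      by field; rewrite ?lt0r_neq0.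
    rewrite ler_wpM2l// ler_wpM2l ?(ltW (a0 _))//.
    by rewrite ler_pXn2r ?nnegrE ?(ltW e_gt0).
  rewrite -[leLHS]addr0; apply: lerD; first by apply: lerD; [exact: ltW|exact: aN].
  rewrite mulr_ge0// [X in _ <= X]addrAC addr_ge0//; last first.
    by rewrite mulr_ge0 ?exprn_ge0 ?(ltW (a0 _)).
  by rewrite subr_ge0 ndS// leq_addr.
exists m => // k /= mk; rewrite sub0r normrN ger0_norm// -(subnKC mk).
rewrite (le_trans (bnd _))//.
have := SN (m + (k - m))%N m Nm (leq_addr _ _).
by rewrite /e => H; lra.
Qed.

End SeriesAux.

(** * Elementary bounds for the exponential *)

Section ExpBounds.
Context {R : realType}.
Implicit Types x : R.

(** This bound and the next rest on [1 + x <= expR x] alone, used at [x] and, after multiplication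
    by [expR x], at [- x]. *)
Lemma expR_sub1_bound x : `|expR x - 1| <= `|x| * expR `|x|.
Proof.
have [x0|x0] := leP 0 x.
  rewrite ger0_norm ?subr_ge0 -?expR0 ?ler_expR// ger0_norm//.
  have := expR_ge1Dx (- x); rewrite expRN => h.
  have e0 := expR_gt0 x.
  have := ler_wpM2r (ltW e0) h; rewrite mulVf ?lt0r_neq0// expR0 => h'; lra.
have e1 : 1 <= expR `|x| by rewrite -expR0 ler_expR.
rewrite ler0_norm ?subr_le0 -?expR0 ?ler_expR ?(ltW x0)// expR0.
rewrite (@le_trans _ _ `|x|)//; last by rewrite ler_peMr.
rewrite ltr0_norm//; have := expR_ge1Dx x; lra.
Qed.

Lemma expR_sub1x_bound x : `|expR x - 1 - x| <= x ^+ 2 * expR `|x|.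
Proof.
rewrite ger0_norm; last by have := expR_ge1Dx x; lra.
rewrite (@le_trans _ _ (x * (expR x - 1)))//.
  have := expR_ge1Dx (- x); rewrite expRN => h.
  have e0 := expR_gt0 x.
  have := ler_wpM2r (ltW e0) h; rewrite mulVf ?lt0r_neq0// => h'; lra.
have -> : x ^+ 2 = `|x| * `|x| by rewrite -normrM -expr2 ger0_norm// sqr_ge0.
rewrite (le_trans (ler_norm _))// normrM -mulrA.
by rewrite ler_wpM2l// expR_sub1_bound.
Qed.

End ExpBounds.

(** * First- and second-order expansions on row vectors *)

Section RowVectors.
Context {R : realType} {d : nat}.
Implicit Types (u v h : 'rV[R]_d).

Definition dot u v : R := \sum_(i < d) u 0 i * v 0 i.

Lemma coord_le_norm v i : `|v 0 i| <= `|v|.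
Proof.
rewrite [leRHS]/Num.norm /= mx_normrE.
exact: (le_bigmax _ (fun ij : 'I_1 * 'I_d => `|v ij.1 ij.2|) (0, i)).
Qed.

Lemma norm_le_coord v (M : R) : 0 <= M -> (forall i, `|v 0 i| <= M) -> `|v| <= M.
Proof.
move=> M0 vM; rewrite [leLHS]/Num.norm /= mx_normrE.
by apply: bigmax_le => // -[i j] _ /=; rewrite ord1.
Qed.

Lemma coord_le_norm2 v i : `|v 0 i| <= norm2 v.
Proof.
rewrite -sqrtr_sqr /norm2 ler_wsqrtr// (bigD1 i)//= lerDl.
by apply: sumr_ge0 => j _; exact: sqr_ge0.
Qed.

Lemma norm2_le v : norm2 v <= d%:R * `|v|.
Proof.
rewrite -[leRHS]ger0_norm ?mulr_ge0// -sqrtr_sqr ler_wsqrtr//.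
apply: (@le_trans _ _ (\sum_(i < d) `|v| ^+ 2)).
  apply: ler_sum => i _; rewrite -(real_normK (num_real (v 0 i))).
  by rewrite lerXn2r ?nnegrE// coord_le_norm.
rewrite sumr_const card_ord -[X in X <= _]mulr_natl exprMn ler_wpM2r ?sqr_ge0//.
by rewrite -natrX ler_nat; case: d => // n; rewrite -mulnn leq_pmulr.
Qed.

Lemma dot_le u v (M : R) : 0 <= M -> (forall i, `|u 0 i| <= M) ->
  `|dot u v| <= d%:R * M * `|v|.
Proof.
move=> M0 uM; rewrite (le_trans (ler_norm_sum _ _ _))//.
apply: (@le_trans _ _ (\sum_(i < d) M * `|v|)).
  by apply: ler_sum => i _; rewrite normrM ler_pM// coord_le_norm.
by rewrite sumr_const card_ord -[X in X <= _]mulr_natl mulrA.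
Qed.

Lemma dotDr u v h : dot u (v + h) = dot u v + dot u h.
Proof. by rewrite /dot -big_split /=; apply: eq_bigr => i _; rewrite mxE mulrDr. Qed.

Lemma dotBl u v h : dot (u - v) h = dot u h - dot v h.
Proof.
rewrite /dot -sumrB; apply: eq_bigr => i _.
by rewrite mxE mulrDl mxE mulNr.
Qed.

Lemma dotZr c u v : dot u (c *: v) = c * dot u v.
Proof. by rewrite /dot big_distrr /=; apply: eq_bigr => i _; rewrite mxE mulrCA. Qed.

Lemma dot_delta u i : dot u (delta_mx 0 i) = u 0 i.
Proof.
rewrite /dot (bigD1 i)//= big1 ?addr0; first by rewrite mxE !eqxx mulr1.
by move=> j ji; rewrite mxE eqxx (negbTE ji) mulr0.
Qed.

Lemma dot_is_linear u : linear (dot u).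
Proof. by move=> c v w; rewrite dotDr dotZr. Qed.

HB.instance Definition _ u := GRing.isLinear.Build R 'rV[R]_d R _ (dot u) (dot_is_linear u).

Lemma dot_continuous u : continuous (dot u).
Proof.
apply: continuous_big => [|i _ v]; first exact: add_continuous.
by apply: (@cvgMl_tmp _ _ _ (nbhs_filter v)); exact: coord_continuous.
Qed.

Lemma derive_dot (f : 'rV[R]_d -> R) x h : differentiable f x ->
  'D_h f x = dot (grad f x) h.
Proof.
move=> df; rewrite deriveE// [in LHS](row_sum_delta h) linear_sum /dot.
by apply: eq_bigr => i _; rewrite linearZ /= mxE deriveE// mulrC.
Qed.

Lemma rV_mean_value (f : 'rV[R]_d -> R) x h : (forall y, differentiable f y) ->
  exists2 c : R, 0 <= c <= 1 & f (x + h) - f x = dot (grad f (x + c *: h)) h.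
Proof.
move=> df; pose phi (t : R) := f (x + t *: h).
(* The difference quotients of [phi] at [t] are those of [f] at [x + t *: h] in direction [h], so
   derivability and derivative carry over to the one-variable mean value theorem. *)
have quot t : (fun s : R => s^-1 *: ((phi \o shift t) (s *: (1 : R)) - phi t)) =
    (fun s : R => s^-1 *: ((f \o shift (x + t *: h)) (s *: h) - f (x + t *: h))).
  apply/funext => s; congr (_ *: (_ - _)); rewrite /phi /=; congr f.
  by rewrite scalerDl scaler1 addrCA.
have dphi (t : R) : is_derive t 1 phi (dot (grad f (x + t *: h)) h).
  split.
    by rewrite /derivable quot; exact: diff_derivable.
  by rewrite /derive quot -derive_dot.
have cphi : {within `[0, 1], continuous phi}.
  apply: derivable_within_continuous => t _; exact: ex_derive.
have [c] := MVT ltr01 (fun t _ => dphi t) cphi.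
rewrite in_itv /= => /andP[c0 c1]; rewrite subr0 mulr1 /phi scale1r scale0r addr0.
by move=> E; exists c => //; rewrite !ltW.
Qed.

Lemma first_order_bound (f : 'rV[R]_d -> R) (B : R) x h : 0 <= B ->
  (forall y, differentiable f y) -> (forall y i, `|grad f y 0 i| <= B) ->
  `|f (x + h) - f x| <= d%:R * B * `|h|.
Proof.
move=> B0 df fB; have [c _ ->] := rV_mean_value x h df; exact: dot_le.
Qed.

Lemma second_order_bound (f : 'rV[R]_d -> R) (K : R) x h : 0 <= K ->
  (forall y, differentiable f y) ->
  (forall y z i, `|grad f y 0 i - grad f z 0 i| <= K * `|y - z|) ->
  `|f (x + h) - f x - dot (grad f x) h| <= d%:R * K * `|h| ^+ 2.
Proof.
move=> K0 df fK; have [c /andP[c0 c1] ->] := rV_mean_value x h df.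
rewrite -dotBl expr2 mulrA -[_ * K * _]mulrA; apply: dot_le; first by rewrite mulr_ge0.
move=> i; have := fK (x + c *: h) x i; rewrite addrAC subrr add0r !mxE => /le_trans; apply.
by rewrite ler_wpM2l// normrZ ger0_norm// ler_piMl.
Qed.

(** The only property of [J] on which the convergence argument rests, apart from boundedness. No
    derivative appears in it; differentiability, the identification of the gradient and its
    Lipschitz continuity are consequences. *)
Definition second_order (J : 'rV[R]_d -> R) (G : 'rV[R]_d -> 'rV[R]_d) (C : R) :=
  forall x h, `|J (x + h) - J x - dot (G x) h| <= C * `|h| ^+ 2.

(* Expand [J (x + h + u)] from [x] and from [x + h], with [u := `|h| *: delta_mx 0 i]. *)
Lemma second_order_lipschitz J G C x h i : 0 <= C -> second_order J G C ->
  `|G (x + h) 0 i - G x 0 i| <= 6 * C * `|h|.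
Proof.
move=> C0 JG; have [->|h0] := eqVneq h 0; first by rewrite addr0 subrr normr0 normr0 mulr0.
pose t := `|h|; have t0 : 0 < t by rewrite normr_gt0.
pose u : 'rV[R]_d := t *: delta_mx 0 i.
have ut : `|u| <= t.
  rewrite normrZ (ger0_norm (ltW t0)) ler_piMr ?(ltW t0)//.
  apply: norm_le_coord => // j; rewrite mxE.
  by case: (_ && _); rewrite ?normr1 ?normr0.
have H1 := JG x h; have H2 := JG (x + h) u; have H3 := JG x (h + u).
have hu : `|h + u| ^+ 2 <= (t + t) ^+ 2.
  by apply: lerXn2r; rewrite ?nnegrE ?addr_ge0 ?(ltW t0)// (le_trans (ler_normD _ _))// lerD.
have u2 : `|u| ^+ 2 <= t ^+ 2 by apply: lerXn2r; rewrite ?nnegrE// ltW.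
have H2' := le_trans H2 (ler_wpM2l C0 u2).
have H3' := le_trans H3 (ler_wpM2l C0 hu).
rewrite addrA dotDr in H3'; rewrite -/t in H1.
have du y : dot y u = t * y 0 i by rewrite dotZr dot_delta.
rewrite !du in H2' H3'.
have : t * `|G (x + h) 0 i - G x 0 i| <= t * (6 * C * t).
  rewrite -{1}(gtr0_norm t0) -normrM mulrBr.
  (* The [6] is [1 + 1 + 4]: the remainders for displacements of norm at most [t], [t] and
     [2 * t]. *)
  have -> : t * (6 * C * t) = C * t ^+ 2 + C * t ^+ 2 + C * (t + t) ^+ 2 by ring.
  move: H1 H2' H3'; rewrite !ler_norml => /andP[? ?] /andP[? ?] /andP[? ?].
  by apply/andP; split; lra.
by rewrite ler_pM2l.
Qed.

Lemma second_order_grad J G C x : 0 <= C -> second_order J G C ->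
  differentiable J x /\ grad J x = G x.
Proof.
move=> C0 JG.
have E : J \o shift x = cst (J x) + dot (G x) +o_ 0 id.
  apply/eqaddoP => e e0; near=> h.
  have -> : (J \o shift x - (cst (J x) + dot (G x))) h =
      J (x + h) - J x - dot (G x) h.
    by rewrite [x + h]addrC -[LHS]/(J (h + x) - (J x + dot (G x) h)) opprD addrA.
  rewrite (le_trans (JG x h))//.
  rewrite expr2 mulrA ler_wpM2r//.
  near: h; have Ce : 0 < e / (C + 1) by rewrite divr_gt0// ltr_wpDl.
  have : \forall h \near (0 : 'rV[R]_d), `|h| < e / (C + 1).
    exact: nbhs0_lt.
  apply: filterS => h hC; rewrite (@le_trans _ _ ((C + 1) * `|h|))//.
    by rewrite ler_wpM2r// lerDl.
  by rewrite -ler_pdivlMl ?ltr_wpDl// mulrC ltW.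
have dE := @diff_unique _ _ _ J (dot (G x)) x (@dot_continuous _) E.
have df : differentiable J x.
  by apply/diff_locallyP; rewrite dE; split => //; exact: dot_continuous.
split => //; apply/rowP => i; rewrite mxE deriveE// dE; exact: dot_delta.
Unshelve. all: by end_near. Qed.

End RowVectors.

(** * Measurability of the score *)

Section Caratheodory.
Context {R : realType} {d : nat} {dZ : measure_display} {Z : measurableType dZ}.

Definition rV_floor (n : nat) (v : 'rV[R]_d) : 'rV[int]_d :=
  \row_i Num.floor (n.+1%:R * v 0 i).

Definition rV_unfloor (n : nat) (v : 'rV[int]_d) : 'rV[R]_d :=
  \row_i ((v 0 i)%:~R / n.+1%:R).

Lemma rV_floor_cvg (v : 'rV[R]_d) : rV_unfloor n (rV_floor n v) @[n --> \oo] --> v.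
Proof.
apply/cvgrPdist_le => e e0.
have := @cvg_harmonic R => /cvgrPdist_le /(_ _ e0); apply: filterS => n.
rewrite sub0r normrN /harmonic /= ger0_norm ?invr_ge0// => ne.
apply: norm_le_coord; first exact: ltW.
move=> i; rewrite !mxE (le_trans _ ne)//.
have n0 : (0 : R) < n.+1%:R by [].
have -> : v 0 i - (Num.floor (n.+1%:R * v 0 i))%:~R / n.+1%:R =
    (n.+1%:R * v 0 i - (Num.floor (n.+1%:R * v 0 i))%:~R) / n.+1%:R.
  by rewrite mulrBl [_ * v 0 i]mulrC mulfK// lt0r_neq0.
have /andP[h1 h2] := floor_itv (n.+1%:R * v 0 i).
rewrite normrM ger0_norm ?subr_ge0// ger0_norm ?invr_ge0//.
rewrite ler_piMl ?invr_ge0// lerBlDr.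
by rewrite -[X in X + _]/(1%:~R) -intrD addrC ltW.
Qed.

(* [F (th z) z] is the limit of the same expression with [th z] rounded to a grid, where
   it is a countable gluing of measurable functions. *)
Lemma measurable_fun_caratheodory (F : 'rV[R]_d -> Z -> R) (th : Z -> 'rV[R]_d) :
  (forall z, continuous (F ^~ z)) -> (forall v, measurable_fun setT (F v)) ->
  (forall i, measurable_fun setT (fun z => th z 0 i)) ->
  measurable_fun setT (fun z => F (th z) z).
Proof.
move=> cF mF mth.
apply: (@measurable_fun_cvg _ _ _ _
  (fun n z => F (rV_unfloor n (rV_floor n (th z))) z)); last first.
  move=> z _; apply: 
    (cvg_comp (fun n => rV_unfloor n (rV_floor n (th z))) (F ^~ z) _ (cF z (th z))).
  exact: rV_floor_cvg.
move=> n _ B mB; rewrite setTI.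
pose A (v : 'rV[int]_d) := [set z | rV_floor n (th z) = v] `&` F (rV_unfloor n v) @^-1` B.
(* Integer vectors are countable; the union runs over their codes, and a code that decodes to
   nothing contributes [set0]. *)
have -> : (fun z => F (rV_unfloor n (rV_floor n (th z))) z) @^-1` B =
    \bigcup_k (if (choice.unpickle k : option 'rV[int]_d) is Some v then A v else set0).
  apply/seteqP; split=> [z Bz|z [k _]].
    by exists (choice.pickle (rV_floor n (th z))) => //; rewrite choice.pickleK.
  by case: (choice.unpickle k) => // v [/= <-].
apply: bigcupT_measurable => k; case: (choice.unpickle k) => // v.
apply: measurableI; last by rewrite -[_ @^-1` _]setTI; exact: mF.
have -> : [set z | rV_floor n (th z) = v] = \bigcap_(i in [set: 'I_d])
    ((fun z => n.+1%:R * th z 0 i) @^-1` `[(v 0 i)%:~R, (v 0 i + 1)%:~R[).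
  apply/seteqP; split=> [z /= zv i _|z H] /=.
    by rewrite in_itv /= -zv mxE floor_itv.
  apply/rowP => i; rewrite mxE; apply: floor_def.
  by have := H i I; rewrite /= in_itv.
apply: fin_bigcap_measurable => [|i _]; first exact: finite_finset.
rewrite -[_ @^-1` _]setTI; apply: measurable_funM => //.
Qed.

End Caratheodory.

(** Presents a partial derivative as the limit of a sequence of difference quotients, from which the
    score inherits measurability in the state-action pair. *)
Lemma derivable_seq_cvg {R : realType} {d : nat} (f : 'rV[R]_d -> R) (x v : 'rV[R]_d) :
  derivable f x v ->
  n.+1%:R * (f (n.+1%:R^-1 *: v + x) - f x) @[n --> \oo] --> 'D_v f x.
Proof.
move=> df; have h0 : (n.+1%:R^-1 : R) @[n --> \oo] --> 0^'.
  move=> A [e /= e0 eA]; have /cvgrPdist_lt /(_ _ e0) := @cvg_harmonic R.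
  apply: filterS => n ne; apply: eA; first exact: ne.
  by rewrite /= invr_eq0 pnatr_eq0.
have := cvg_comp _ _ h0 df; apply: cvg_trans; apply: near_eq_cvg; apply: nearW => n /=.
by rewrite invrK.
Qed.

Section Score.
Context {R : realType} {dS dA : measure_display}.
Context {S : measurableType dS} {A : measurableType dA} {d : nat}.
Variables (nu : {sigma_finite_measure set A -> \bar R}).
Variable pol : 'rV[R]_d -> S -> A -> R.
Variables (L_Theta B_Theta : R).
Hypothesis hpol : forall th, is_policy nu (pol th).
Hypothesis hpos : forall th s a, 0 < pol th s a.
Hypothesis hdiff : forall th s a, differentiable (fun th' => pol th' s a) th.
Hypothesis hL : forall s a th1 th2,
  norm2 (score pol s a th1 - score pol s a th2) <= L_Theta * norm2 (th1 - th2).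
Hypothesis hB : forall s a th, norm2 (score pol s a th) <= B_Theta.
Local Notation X := (S * A)%type.

Definition log_pol (x : X) (th : 'rV[R]_d) : R := ln (pol th x.1 x.2).

Lemma log_pol_differentiable x th : differentiable (log_pol x) th.
Proof.
rewrite /log_pol; apply: (@differentiable_comp _ _ _ _ (fun th' => pol th' x.1 x.2) (@ln R)).
  exact: hdiff.
by apply/derivable1_diffP; apply: ex_derive; apply: is_derive1_ln; exact: hpos.
Qed.

(** From here on the sup norm replaces the Euclidean one, and absolute values make the constants
    visibly nonnegative. *)
Lemma score_bound x th i : `|score pol x.1 x.2 th 0 i| <= `|B_Theta|.
Proof.
by rewrite (le_trans (coord_le_norm2 _ _))// (le_trans (hB _ _ _))// ler_norm.
Qed.

Lemma score_lipschitz x th1 th2 i :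
  `|score pol x.1 x.2 th1 0 i - score pol x.1 x.2 th2 0 i| <=
  `|L_Theta| * d%:R * `|th1 - th2|.
Proof.
have := coord_le_norm2 (score pol x.1 x.2 th1 - score pol x.1 x.2 th2) i.
rewrite mxE [X in `|_ + X|]mxE => /le_trans; apply; rewrite (le_trans (hL _ _ _ _))//.
rewrite (@le_trans _ _ (`|L_Theta| * norm2 (th1 - th2)))//.
  by rewrite ler_wpM2r ?ler_norm// sqrtr_ge0.
by rewrite -mulrA ler_wpM2l// norm2_le.
Qed.

Lemma score_continuous x i : continuous (fun th => score pol x.1 x.2 th 0 i).
Proof.
move=> th; have FF := nbhs_filter th; apply/cvgrPdist_le => e e0.
have K0 : 0 < `|L_Theta| * d%:R + 1 by rewrite ltr_wpDl// mulr_ge0.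
have eK : 0 < e / (`|L_Theta| * d%:R + 1) by rewrite divr_gt0.
have : \forall y \near th, `|th - y| < e / (`|L_Theta| * d%:R + 1).
  by apply/nbhs_normP; exists (e / (`|L_Theta| * d%:R + 1)) => //=.
apply: filterS => y ye; rewrite (le_trans (score_lipschitz x th y i))//.
rewrite (@le_trans _ _ ((`|L_Theta| * d%:R + 1) * `|th - y|))//.
  by rewrite ler_wpM2r// lerDl.
by rewrite -ler_pdivlMl// mulrC ltW.
Qed.

Lemma measurable_pol th : measurable_fun setT (fun x : X => pol th x.1 x.2).
Proof. by case: (hpol th). Qed.

Lemma measurable_log_pol th : measurable_fun setT (fun x : X => log_pol x th).
Proof. by apply: measurableT_comp; [exact: measurable_ln|exact: measurable_pol]. Qed.

Lemma measurable_score th i : measurable_fun setT (fun x : X => score pol x.1 x.2 th 0 i).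
Proof.
apply: (@measurable_fun_cvg _ _ _ _ (fun n x => n.+1%:R *
  (log_pol x (n.+1%:R^-1 *: delta_mx 0 i + th) - log_pol x th))).
  move=> n; apply: measurable_funM => //.
  by apply: measurable_funB; exact: measurable_log_pol.
move=> x _; rewrite mxE; apply: (derivable_seq_cvg (f := log_pol x)).
exact/diff_derivable/log_pol_differentiable.
Qed.

Section Param.
Context {dU : measure_display} {U : measurableType dU}.
Variable th : U -> 'rV[R]_d.
Hypothesis mth : forall i, measurable_fun setT (fun u => th u 0 i).

Lemma measurable_pol_param :
  measurable_fun setT (fun z : U * X => pol (th z.1) z.2.1 z.2.2).
Proof.
apply: (@measurable_fun_caratheodory _ _ _ _ (fun v (z : U * X) => pol v z.2.1 z.2.2)
  (fun z => th z.1)).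
- by move=> z v; apply: differentiable_continuous; exact: hdiff.
- by move=> v; apply: (measurableT_comp (measurable_pol v)).
- by move=> i; apply: (measurableT_comp (mth i)).
Qed.

Lemma bmeas_score_param i :
  bmeas (fun z : U * X => score pol z.2.1 z.2.2 (th z.1) 0 i).
Proof.
split; last by exists `|B_Theta| => z; exact: score_bound.
apply: (@measurable_fun_caratheodory _ _ _ _
  (fun v (z : U * X) => score pol z.2.1 z.2.2 v 0 i) (fun z => th z.1)).
- by move=> z; exact: score_continuous.
- by move=> v; apply: (measurableT_comp (measurable_score v i)).
- by move=> j; apply: (measurableT_comp (mth j)).
Qed.

End Param.

Lemma bmeas_score th i : bmeas (fun x : X => score pol x.1 x.2 th 0 i).
Proof. by split; [exact: measurable_score|exists `|B_Theta| => x; exact: score_bound]. Qed.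

End Score.

(** * Smoothness of the value *)

Section PerformanceDifference.
Context {R : realType} {dS dA : measure_display}.
Context {S : measurableType dS} {A : measurableType dA}.
Variables (nu : {sigma_finite_measure set A -> \bar R}).
Variables (p : R.-pker (S * A)%type ~> S) (gamma : R).
Hypothesis g01 : 0 < gamma < 1.
Local Notation X := (S * A)%type.

Section Occupancy.
Variable pi : S -> A -> R.
Hypothesis polpi : is_policy nu pi.
Variable s0 : S.
Implicit Types g : X -> R.

Let bres g : bmeas g -> bmeas (resolvent nu p gamma pi g).
Proof. by move=> bg; have [_ [M gM]] := bg; exact: bmeas_resolvent gM. Qed.

Lemma resolventD g1 g2 : bmeas g1 -> bmeas g2 ->
  resolvent nu p gamma pi (fun x => g1 x + g2 x) =
  (fun x => resolvent nu p gamma pi g1 x + resolvent nu p gamma pi g2 x).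
Proof.
move=> b1 b2; apply/esym/resolvent_unique => //.
- by apply: bmeasD; exact: bres.
- exact: bmeasD.
- have [_ [M1 gM1]] := b1; have [_ [M2 gM2]] := b2 => x.
  rewrite stepD//; try exact: bres.
  rewrite {1}(resolvent_fix p g01 polpi b1 gM1) {1}(resolvent_fix p g01 polpi b2 gM2).
  by rewrite mulrDr addrACA.
Qed.

Lemma resolventZ c g : bmeas g ->
  resolvent nu p gamma pi (fun x => c * g x) =
  (fun x => c * resolvent nu p gamma pi g x).
Proof.
move=> b; apply/esym/resolvent_unique => //.
- by apply: bmeasZ; exact: bres.
- exact: bmeasZ.
- have [_ [M gM]] := b => x; rewrite stepZ//; last exact: bres.
  by rewrite {1}(resolvent_fix p g01 polpi b gM) mulrDr mulrCA.
Qed.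

(* [\sum_t gamma ^+ t * E (g (s_t, a_t))] along the trajectory from [s0] under [pi]. *)
Definition occupancy g : R := act nu pi (resolvent nu p gamma pi g) s0.

Lemma occupancyD g1 g2 : bmeas g1 -> bmeas g2 ->
  occupancy (fun x => g1 x + g2 x) = occupancy g1 + occupancy g2.
Proof.
move=> b1 b2; rewrite /occupancy resolventD// actD//; exact: bres.
Qed.

Lemma occupancyZ c g : bmeas g -> occupancy (fun x => c * g x) = c * occupancy g.
Proof. by move=> b; rewrite /occupancy resolventZ// actZ//; exact: bres. Qed.

Lemma occupancy_sum (I : Type) (s : seq I) (g : I -> X -> R) : (forall i, bmeas (g i)) ->
  occupancy (fun x => \sum_(i <- s) g i x) = \sum_(i <- s) occupancy (g i).
Proof.
move=> bg; elim: s => [|i s IH].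
  under eq_fun do rewrite big_nil; rewrite big_nil.
  have -> : (fun _ : X => 0) = (fun x => 0 * (fun=> 0) x) :> (X -> R).
    by apply/funext => x; rewrite mul0r.
  by rewrite occupancyZ ?mul0r//; exact: bmeas_cst.
under eq_fun do rewrite big_cons; rewrite big_cons occupancyD ?IH//.
exact: bmeas_sum.
Qed.

Lemma occupancy_bound g M : bmeas g -> (forall x, `|g x| <= M) ->
  `|occupancy g| <= M / (1 - gamma).
Proof.
move=> b gM; apply: act_bound => //; first exact: bres.
by move=> x; exact: resolvent_bound.
Qed.

End Occupancy.

Section ChangeOfPolicy.
Variables (pi pi' : S -> A -> R) (rho : X -> R).
Hypotheses (polpi : is_policy nu pi) (polpi' : is_policy nu pi').
Hypotheses (brho : bmeas rho) (rhoE : forall s a, pi' s a = pi s a * rho (s, a)).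
Variables (r : X -> R) (M : R).
Hypotheses (br : bmeas r) (rM : forall x, `|r x| <= M).
Local Notation Q := (resolvent nu p gamma pi r).
Local Notation Q' := (resolvent nu p gamma pi' r).

Let bQ : bmeas Q. Proof. exact: bmeas_resolvent rM. Qed.
Let bQ' : bmeas Q'. Proof. exact: bmeas_resolvent rM. Qed.
Let bu : bmeas (fun x => (rho x - 1) * Q' x).
Proof. by apply: bmeasM => //; apply: bmeasB => //; exact: bmeas_cst. Qed.

Lemma act_change g : act nu pi' g = act nu pi (fun x => rho x * g x).
Proof.
apply/funext => s; rewrite /act /avg; congr Rintegral; apply/funext => a.
by rewrite rhoE mulrA.
Qed.

(* The left-hand side solves the fixed-point equation of the right-hand side. *)
Lemma resolvent_change :
  (fun x => rho x * Q' x - Q x) = resolvent nu p gamma pi (fun x => (rho x - 1) * Q' x).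
Proof.
apply: resolvent_unique => //; first by apply: bmeasB => //; exact: bmeasM.
have brQ : bmeas (fun x => rho x * Q' x) by exact: bmeasM.
move=> x; rewrite (stepB p polpi brQ bQ).
(* The next action drawn under [pi] and weighted by [rho] is an action drawn under [pi']. *)
have -> : step nu p pi (fun x => rho x * Q' x) x = step nu p pi' Q' x.
  by rewrite /step act_change.
have H := resolvent_fix p g01 polpi br rM x.
have H' := resolvent_fix p g01 polpi' br rM x.
rewrite mulrBl mul1r {1}H; move: H'.
set q' := Q' x; set a := step _ _ _ _ _; set b := step _ _ _ _ _.
by move: q' a b (r x) (rho x) => q' a b u v ->; ring.
Qed.

(** Average [resolvent_change] over the first action under [pi]: there the weight [rho] turns [pi]
    into [pi']. *)
Lemma performance_difference s0 :
  act nu pi' Q' s0 - act nu pi Q s0 = occupancy pi s0 (fun x => (rho x - 1) * Q' x).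
Proof.
rewrite /occupancy -resolvent_change act_change.
by rewrite (actB polpi (bmeasM brho bQ') bQ).
Qed.

(** Subtracting [(rho x - 1) * Q' x] from [resolvent_change] leaves [Q' x - Q x]. The resolvent
    contributes the factor [1 / (1 - gamma)], the subtracted term the [1]. *)
Lemma Qvalue_change c x : (forall x, `|rho x - 1| <= c) ->
  `|Q' x - Q x| <= c * (M / (1 - gamma)) * (1 / (1 - gamma) + 1).
Proof.
move=> rc; have uM y : `|(rho y - 1) * Q' y| <= c * (M / (1 - gamma)).
  by rewrite normrM ler_pM//; exact: resolvent_bound.
have -> : Q' x - Q x = resolvent nu p gamma pi (fun x => (rho x - 1) * Q' x) x -
    (rho x - 1) * Q' x.
  rewrite -resolvent_change; move: (Q x) (Q' x) (rho x) => a b c'; ring.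
rewrite (le_trans (ler_normB _ _))// mulrDr mulr1 lerD// mul1r.
exact: resolvent_bound.
Qed.

End ChangeOfPolicy.

End PerformanceDifference.

Section PolicyGradient.
Context {R : realType} {dS dA : measure_display}.
Context {S : measurableType dS} {A : measurableType dA} {d : nat}.
Variables (nu : {sigma_finite_measure set A -> \bar R}).
Variables (p : R.-pker (S * A)%type ~> S) (gamma : R).
Hypothesis g01 : 0 < gamma < 1.
Local Notation X := (S * A)%type.
Variables (r : X -> R) (U : R).
Hypotheses (br : bmeas r) (rU : forall x, `|r x| <= U).
Variable pol : 'rV[R]_d -> S -> A -> R.
Variables (L_Theta B_Theta : R).
Hypothesis hpol : forall th, is_policy nu (pol th).
Hypothesis hpos : forall th s a, 0 < pol th s a.
Hypothesis hdiff : forall th s a, differentiable (fun th' => pol th' s a) th.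
Hypothesis hL : forall s a th1 th2,
  norm2 (score pol s a th1 - score pol s a th2) <= L_Theta * norm2 (th1 - th2).
Hypothesis hB : forall s a th, norm2 (score pol s a th) <= B_Theta.
Variable s0 : S.

Definition Qval (th : 'rV[R]_d) : X -> R := resolvent nu p gamma (pol th) r.

Definition Jval (th : 'rV[R]_d) : R := act nu (pol th) (Qval th) s0.

(** The policy gradient formula, taken as a definition; that it is the gradient of [Jval] will
    follow from the second-order expansion. *)
Definition Jgrad (th : 'rV[R]_d) : 'rV[R]_d :=
  \row_i occupancy nu p gamma (pol th) s0 (fun x => score pol x.1 x.2 th 0 i * Qval th x).

Let B := `|B_Theta|.
Let K := `|L_Theta| * d%:R.
Let M := U / (1 - gamma).
Let dB := d%:R * B.

Let g1 : 0 < 1 - gamma. Proof. by rewrite subr_gt0; case/andP: g01. Qed.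

Let U0 : 0 <= U. Proof. by rewrite (le_trans _ (rU point)). Qed.

Let M0 : 0 <= M. Proof. by rewrite divr_ge0// ltW. Qed.

Let B0 : 0 <= B. Proof. exact: normr_ge0. Qed.

Let dB0 : 0 <= dB. Proof. exact: mulr_ge0. Qed.

Let K0 : 0 <= K. Proof. exact: mulr_ge0. Qed.

Lemma bmeas_Qval th : bmeas (Qval th).
Proof. exact: bmeas_resolvent rU. Qed.

Lemma Qval_bound th x : `|Qval th x| <= M.
Proof. exact: resolvent_bound. Qed.

Lemma Jval_bound th : `|Jval th| <= M.
Proof. by apply: act_bound => //; [exact: bmeas_Qval|exact: Qval_bound]. Qed.

Lemma bmeas_score_Qval th i : bmeas (fun x => score pol x.1 x.2 th 0 i * Qval th x).
Proof. apply: bmeasM; [exact: (bmeas_score hpol hpos hdiff hB)|exact: bmeas_Qval]. Qed.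

Lemma Jgrad_bound th i : `|Jgrad th 0 i| <= B * M / (1 - gamma).
Proof.
rewrite mxE; apply: occupancy_bound => //; first exact: bmeas_score_Qval.
by move=> x; rewrite normrM ler_pM//; [exact: (score_bound hB)|exact: Qval_bound].
Qed.

(** For [|h| <= 1] the log-ratio is at most [dB * |h| <= dB], so the exponential bounds apply with
    [expR dB]. In [c2] the term [d%:R * K] is the second-order error of the log-policy itself. *)
Let c1 := dB * expR dB.
Let c2 := dB ^+ 2 * expR dB + d%:R * K.

Section Perturbation.
Variables (th h : 'rV[R]_d).
Hypothesis h1 : `|h| <= 1.

Let ell x := log_pol pol x (th + h) - log_pol pol x th.
Let rho x := expR (ell x).
Let lin x := dot (score pol x.1 x.2 th) h.

Lemma ell_bound x : `|ell x| <= dB * `|h|.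
Proof.
apply: first_order_bound => // y; first exact: (log_pol_differentiable hpos hdiff).
move=> i; exact: (score_bound hB).
Qed.

Lemma ell_bound1 x : `|ell x| <= dB.
Proof. by rewrite (le_trans (ell_bound x))// ler_piMr. Qed.

Lemma ell_second_order x : `|ell x - lin x| <= d%:R * K * `|h| ^+ 2.
Proof.
apply: (second_order_bound (f := log_pol pol x)) => // y.
  exact: (log_pol_differentiable hpos hdiff).
move=> z i; exact: (score_lipschitz hL).
Qed.

Lemma ratio_bound x : `|rho x - 1| <= c1 * `|h|.
Proof.
rewrite (le_trans (expR_sub1_bound _))// /c1 mulrAC ler_pM//.
- exact: ell_bound.
- by rewrite ler_expR ell_bound1.
Qed.

Lemma ratio_second_order x : `|rho x - 1 - lin x| <= c2 * `|h| ^+ 2.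
Proof.
have -> : rho x - 1 - lin x = (rho x - 1 - ell x) + (ell x - lin x) by ring.
rewrite (le_trans (ler_normD _ _))// /c2 mulrDl lerD//; last exact: ell_second_order.
rewrite (le_trans (expR_sub1x_bound _))// [X in _ <= X]mulrAC -exprMn ler_pM ?sqr_ge0//.
- rewrite -(real_normK (num_real (ell x))) lerXn2r ?nnegrE ?mulr_ge0//; exact: ell_bound.
- by rewrite ler_expR ell_bound1.
Qed.

Lemma lin_bound x : `|lin x| <= dB * `|h|.
Proof. by apply: dot_le => // i; exact: (score_bound hB). Qed.

Lemma bmeas_rho : bmeas rho.
Proof.
split.
  apply: measurableT_comp => //; apply: measurable_funB;
  exact: (measurable_log_pol hpol).
exists (c1 * `|h| + 1) => x; have -> : rho x = (rho x - 1) + 1 by rewrite subrK.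
by rewrite (le_trans (ler_normD _ _))// normr1 lerD2r ratio_bound.
Qed.

Lemma rhoE s a : pol (th + h) s a = pol th s a * rho (s, a).
Proof.
rewrite /rho /ell /log_pol /= expRB !lnK ?posrE// mulrCA mulfV ?mulr1//.
by rewrite lt0r_neq0.
Qed.

Lemma bmeas_lin : bmeas lin.
Proof.
apply: bmeas_sum => i; apply: bmeasM; last exact: bmeas_cst.
exact: (bmeas_score hpol hpos hdiff hB).
Qed.

Lemma dot_Jgrad : dot (Jgrad th) h =
  occupancy nu p gamma (pol th) s0 (fun x => lin x * Qval th x).
Proof.
have -> : (fun x => lin x * Qval th x) =
    (fun x => \sum_(i < d) h 0 i * (score pol x.1 x.2 th 0 i * Qval th x)).
  apply/funext => x; rewrite /lin /dot big_distrl /=; apply: eq_bigr => i _.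
  by rewrite mulrCA mulrA.
rewrite (occupancy_sum p g01 (hpol th) s0 (index_enum 'I_d)
  (g := fun i x => h 0 i * (score pol x.1 x.2 th 0 i * Qval th x))).
  apply: eq_bigr => i _; rewrite (occupancyZ p g01 (hpol th) s0 _ (bmeas_score_Qval th i)).
  by rewrite mxE mulrC.
by move=> i; apply: bmeasZ; exact: bmeas_score_Qval.
Qed.

Lemma Jval_local_second_order :
  `|Jval (th + h) - Jval th - dot (Jgrad th) h| <=
  (c2 * M + dB * (c1 * M * (1 / (1 - gamma) + 1))) / (1 - gamma) * `|h| ^+ 2.
Proof.
have PD := performance_difference p g01 (hpol th) (hpol (th + h)) bmeas_rho rhoE br rU s0.
rewrite /Jval -/(Qval _) in PD *; rewrite PD dot_Jgrad.
pose u x := (rho x - 1) * Qval (th + h) x.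
pose v x := lin x * Qval th x.
have bu : bmeas u.
  apply: bmeasM; last exact: bmeas_Qval.
  by apply: bmeasB; [exact: bmeas_rho|exact: bmeas_cst].
have bv : bmeas v by apply: bmeasM; [exact: bmeas_lin|exact: bmeas_Qval].
have -> : occupancy nu p gamma (pol th) s0 u - occupancy nu p gamma (pol th) s0 v =
    occupancy nu p gamma (pol th) s0 (fun x => u x + -1 * v x).
  rewrite (occupancyD p g01 (hpol th) s0 bu (bmeasZ (-1) bv)).
  by rewrite (occupancyZ p g01 (hpol th) s0 (-1) bv) mulN1r.
rewrite mulrAC; apply: (occupancy_bound p g01 (hpol th)).
  by apply: bmeasD => //; exact: bmeasZ.
(* Both summands are quadratic in [h]: a second-order error times a bounded value, and a product of
   two first-order terms. *)
move=> x; have -> : u x + -1 * v x = (rho x - 1 - lin x) * Qval (th + h) x +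
    lin x * (Qval (th + h) x - Qval th x).
  rewrite /u /v; move: (rho x) (lin x) (Qval _ x) (Qval _ x) => a b e f; ring.
have Qc : `|Qval (th + h) x - Qval th x| <= c1 * `|h| * M * (1 / (1 - gamma) + 1).
  by apply: (Qvalue_change p g01 (hpol th) (hpol (th + h)) bmeas_rho rhoE br rU) => y;
    exact: ratio_bound.
rewrite (le_trans (ler_normD _ _))// [X in _ <= X]mulrDl lerD// normrM.
  by rewrite mulrAC ler_pM//; [exact: ratio_second_order|exact: Qval_bound].
have -> : dB * (c1 * M * (1 / (1 - gamma) + 1)) * `|h| ^+ 2 =
    (dB * `|h|) * (c1 * `|h| * M * (1 / (1 - gamma) + 1)).
  by move: (1 / (1 - gamma) + 1) `|h| dB c1 M => a b e f g; ring.
by rewrite ler_pM//; exact: lin_bound.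
Qed.

End Perturbation.

Lemma Jval_second_order : exists2 C, 0 <= C & second_order Jval Jgrad C.
Proof.
pose C1 := (c2 * M + dB * (c1 * M * (1 / (1 - gamma) + 1))) / (1 - gamma).
pose C2 := M + M + d%:R * (B * M / (1 - gamma)).
have BM0 : 0 <= B * M / (1 - gamma) by apply: divr_ge0; [exact: mulr_ge0|exact: ltW].
exists (Num.max C1 C2); first by rewrite le_max; apply/orP; right; rewrite !addr_ge0// mulr_ge0.
move=> th h; have [h1|h1] := leP `|h| 1.
  rewrite (le_trans (Jval_local_second_order th h1))// -/C1 ler_wpM2r ?sqr_ge0//.
  by rewrite le_max lexx.
have hh : 1 <= `|h| ^+ 2 by rewrite expr_ge1// ltW.
have hh' : `|h| <= `|h| ^+ 2 by rewrite expr2 ler_peMr// ltW.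
rewrite (@le_trans _ _ (C2 * `|h| ^+ 2))//; last first.
  by rewrite ler_wpM2r ?sqr_ge0// le_max lexx orbT.
rewrite (le_trans (ler_normB _ _))// /C2 mulrDl lerD//.
  rewrite (le_trans (ler_normB _ _))// (@le_trans _ _ (M + M))//.
    by rewrite lerD//; exact: Jval_bound.
  by rewrite ler_peMr// addr_ge0.
rewrite (@le_trans _ _ (d%:R * (B * M / (1 - gamma)) * `|h|))//.
  by apply: dot_le => // i; exact: Jgrad_bound.
by rewrite ler_wpM2l// mulr_ge0.
Qed.

End PolicyGradient.

(** * Expected update *)

Lemma measurable_Qhat {R : realType} {dO dS dA : measure_display} {Om : measurableType dO}
    {S : measurableType dS} {A : measurableType dA} (G : set_system Om)
    (r : S * A -> R) (gamma : R) (x : draws S A Om) :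
  measurable_fun setT r -> events2 x `<=` G ->
  @measurable_fun _ _ (g_sigma_algebraType G) R setT (Qhat r gamma x).
Proof.
move=> mr xG; pose W := g_sigma_algebraType G.
have mN : @measurable_fun _ _ W nat setT (hor2 x).
  by apply: measurable_fun_events => B NB; apply: xG; left; left.
have ms t : @measurable_fun _ _ W S setT (st2 x t).
  by apply: measurable_fun_events => B NB; apply: xG; left; right; exists t.
have ma t : @measurable_fun _ _ W A setT (ac2 x t).
  by apply: measurable_fun_events => B NB; apply: xG; right; exists t.
apply: (@measurable_fun_select _ _ W R (hor2 x) (fun n w =>
  \sum_(0 <= t < n.+1) gamma `^ (t%:R / 2) * r (st2 x t w, ac2 x t w))) => // n.
apply: measurable_sum => t; apply: measurable_funM => //.
by apply: (measurableT_comp mr); exact: measurable_fun_pair.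
Qed.

Section Algorithm.
Context {R : realType} {dS dA : measure_display}.
Context {S : measurableType dS} {A : measurableType dA} {d : nat}.
Variables (nu : {sigma_finite_measure set A -> \bar R}).
Variables (p : R.-pker (S * A)%type ~> S) (gamma : R).
Hypothesis g01 : 0 < gamma < 1.
Local Notation X := (S * A)%type.
Variables (r : X -> R) (U : R).
Hypotheses (mr : measurable_fun setT r) (rU : forall x, `|r x| <= U).
Variable pol : 'rV[R]_d -> S -> A -> R.
Variables (L_Theta B_Theta : R).
Hypothesis hpol : forall th, is_policy nu (pol th).
Hypothesis hpos : forall th s a, 0 < pol th s a.
Hypothesis hdiff : forall th s a, differentiable (fun th' => pol th' s a) th.
Hypothesis hL : forall s a th1 th2,
  norm2 (score pol s a th1 - score pol s a th2) <= L_Theta * norm2 (th1 - th2).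
Hypothesis hB : forall s a th, norm2 (score pol s a th) <= B_Theta.
Variable s0 : S.

Let br : bmeas r. Proof. by split=> //; exists U. Qed.

Lemma bmeas_Qval_param {dU : measure_display} {Z : measurableType dU} (th : Z -> 'rV[R]_d) :
  (forall i, measurable_fun setT (fun u => th u 0 i)) ->
  bmeas (fun z : Z * X => Qval nu p gamma r pol (th z.1) z.2).
Proof.
move=> mth; have mpi := measurable_pol_param hpol hdiff mth.
have brZ : bmeas (fun z : Z * X => r z.2) by exact: bmeas_comp.
exact: (bmeas_resolvent_param p g01 (pi := fun u => pol (th u)) (fun u => hpol (th u)) mpi brZ).
Qed.

Lemma bmeas_Jgrad_param {dU : measure_display} {Z : measurableType dU} (th : Z -> 'rV[R]_d) i :
  (forall j, measurable_fun setT (fun u => th u 0 j)) ->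
  bmeas (fun u => Jgrad nu p gamma r pol s0 (th u) 0 i).
Proof.
move=> mth; have mpi := measurable_pol_param hpol hdiff mth.
have bg := bmeasM (bmeas_score_param hpol hpos hdiff hL hB mth i) (bmeas_Qval_param mth).
have bres := bmeas_resolvent_param p g01 (pi := fun u => pol (th u))
  (fun u => hpol (th u)) mpi bg.
have bact := bmeas_act_param (pi := fun u => pol (th u)) (fun u => hpol (th u)) mpi bres.
have -> : (fun u => Jgrad nu p gamma r pol s0 (th u) 0 i) = (fun u =>
   act nu (pol (th u)) (resolvent nu p gamma (pol (th u)) (fun x =>
     score pol x.1 x.2 (th u) 0 i * Qval nu p gamma r pol (th u) x)) s0).
  by apply/funext => u; rewrite mxE.
exact: (bmeas_comp bact (measurable_pair2 s0)).
Qed.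

Lemma bmeas_Jval_param {dU : measure_display} {Z : measurableType dU} (th : Z -> 'rV[R]_d) :
  (forall j, measurable_fun setT (fun u => th u 0 j)) ->
  bmeas (fun u => Jval nu p gamma r pol s0 (th u)).
Proof.
move=> mth; have mpi := measurable_pol_param hpol hdiff mth.
have bact := bmeas_act_param (pi := fun u => pol (th u)) (fun u => hpol (th u)) mpi
  (bmeas_Qval_param mth).
exact: (bmeas_comp bact (measurable_pair2 s0)).
Qed.

Context {dO : measure_display} {Om : measurableType dO}.
Variable P : probability Om R.

Section Iteration.
Variables (F : set_system Om) (th : Om -> 'rV[R]_d) (x : draws S A Om).
Hypothesis FM : F `<=` measurable.
Local Notation W := (g_sigma_algebraType F).
Hypothesis mth : forall i, @measurable_fun _ _ W R setT (fun w => th w 0 i).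
Hypothesis hx : iteration_draws nu p gamma pol s0 P F th x.

Let mpi : measurable_fun setT (fun z : W * X => pol (th z.1) z.2.1 z.2.2).
Proof. exact: (measurable_pol_param hpol hdiff (th := th : W -> 'rV[R]_d) mth). Qed.

Let polpi (w : W) : is_policy nu (pol (th w)). Proof. exact: hpol. Qed.

Lemma iteration_measurable1 : events1 x `<=` measurable.
Proof.
have [T_geom traj _ _] := hx; have mT : measurable_fun setT (hor1 x) by case: T_geom.
move=> B [[/(events_measurable mT)//|]|] [t _]; apply: events_measurable;
  by case: (measurable_from_state traj t).
Qed.

Let FE1 : F `<=` F `|` events1 x. Proof. by move=> B; left. Qed.

Let F1M : F `|` events1 x `<=` measurable.
Proof. by move=> B [/FM//|]; exact: iteration_measurable1. Qed.

Local Notation W1 := (g_sigma_algebraType (F `|` events1 x)).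

Lemma measurable_last_pair (G : set_system Om) : events1 x `<=` G ->
  @measurable_fun _ _ (g_sigma_algebraType G) S setT (last_state x) /\
  @measurable_fun _ _ (g_sigma_algebraType G) A setT (last_action x).
Proof.
move=> EG; have mT : @measurable_fun _ _ (g_sigma_algebraType G) nat setT (hor1 x).
  by apply: measurable_fun_events => B NB; apply: EG; left; left.
split; apply: measurable_fun_select => // t; apply: measurable_fun_events => B NB; apply: EG.
  by left; right; exists t.
by right; exists t.
Qed.

Lemma iteration_measurable2 : events2 x `<=` measurable.
Proof.
have [_ _ N_geom traj] := hx; have mN : measurable_fun setT (hor2 x) by case: N_geom.
have [msT maT] : @measurable_fun _ _ W1 S setT (last_state x) /\
    @measurable_fun _ _ W1 A setT (last_action x).
  by apply: measurable_last_pair => B; right.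
move=> B [[/(events_measurable mN)//|]|] [t _]; apply: events_measurable;
  by case: (measurable_from_pair F1M msT maT traj t).
Qed.

Lemma Qhat_bound w : `|Qhat r gamma x w| <= U / (1 - gamma `^ (1 / 2)).
Proof. exact: estimator_bound. Qed.

Definition increment (w : Om) : 'rV[R]_d :=
  Qhat r gamma x w *: score pol (last_state x w) (last_action x w) (th w).

Lemma increment_bound w i :
  `|increment w 0 i| <= U / (1 - gamma `^ (1 / 2)) * `|B_Theta|.
Proof.
rewrite mxE normrM ler_pM//; first exact: Qhat_bound.
exact: (score_bound hB (last_state x w, last_action x w)).
Qed.

Lemma bmeas_increment (G : set_system Om) i : F `<=` G -> events1 x `<=` G -> events2 x `<=` G ->
  @bmeas R _ (g_sigma_algebraType G) (fun w => increment w 0 i).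
Proof.
move=> FG E1G E2G; split; last by eexists => w; exact: increment_bound.
pose W' := g_sigma_algebraType G.
have mth' j : @measurable_fun _ _ W' R setT (fun w => th w 0 j).
  exact: (measurable_fun_mono FG).
have [msT maT] := measurable_last_pair E1G.
have [ms _] := bmeas_score_param hpol hpos hdiff hL hB (th := th : W' -> _) mth' i.
have -> : (fun w => increment w 0 i) = (fun w => Qhat r gamma x w *
    score pol (last_state x w) (last_action x w) (th w) 0 i).
  by apply/funext => w; rewrite mxE.
apply: measurable_funM; first exact: measurable_Qhat.
apply: (measurableT_comp ms (g := fun w : W' => (w, (last_state x w, last_action x w)))).
by apply: measurable_fun_pair => //; exact: measurable_fun_pair.
Qed.

(** Weighting by a coordinate of the gradient, which is known from [F], replaces a conditional
    expectation. The factor [1 - gamma] is the normalisation of the geometric horizon; the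
    [1 / (1 - gamma)] in the update cancels it. *)
Lemma increment_Ex i :
  Ex P (fun w => Jgrad nu p gamma r pol s0 (th w) 0 i * increment w 0 i) =
  (1 - gamma) * Ex P (fun w => Jgrad nu p gamma r pol s0 (th w) 0 i ^+ 2).
Proof.
have [T_geom traj1 N_geom traj2] := hx.
have [msT maT] : @measurable_fun _ _ W1 S setT (last_state x) /\
    @measurable_fun _ _ W1 A setT (last_action x).
  by apply: measurable_last_pair => B; right.
have mth1 j : @measurable_fun _ _ W1 R setT (fun w => th w 0 j).
  exact: (measurable_fun_mono FE1).
have mpi1 := measurable_pol_param hpol hdiff (th := th : W1 -> _) mth1.
pose G w := Jgrad nu p gamma r pol s0 (th w) 0 i.
pose sc w (y : X) := score pol y.1 y.2 (th w) 0 i.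
pose pT w := (last_state x w, last_action x w).
have bG : @bmeas R _ W G by exact: bmeas_Jgrad_param.
have bG1 : @bmeas R _ W1 G by exact: bmeas_Jgrad_param.
have bsc := bmeas_score_param hpol hpos hdiff hL hB (th := th : W -> _) mth i.
have bsc1 := bmeas_score_param hpol hpos hdiff hL hB (th := th : W1 -> _) mth1 i.
have mpT : measurable_fun setT (fun w : W1 => (w, pT w)).
  by apply: measurable_fun_pair => //; exact: measurable_fun_pair.
have bu : @bmeas R _ W1 (fun w => G w * sc w (pT w)).
  by apply: bmeasM => //; exact: (bmeas_comp bsc1 mpT).
(* Integrate out the second horizon and trajectory: given the first pair, gradient and score are
   known, and the estimator averages to [Qval] at that pair. *)
have E1 := estimator_Ex g01 F1M (pi := fun w : W1 => pol (th w)) (fun w => hpol (th w)) mpi1 msT maT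
  N_geom traj2 mr rU bu.
transitivity (Ex P (fun w => G w * sc w (pT w) * Qhat r gamma x w)).
  congr (Ex P _); apply/funext => w; rewrite [X in _ * X]mxE -mulrA.
  by congr (_ * _); exact: mulrC.
rewrite [LHS]E1.
pose v (z : W * X) := G z.1 * (sc z.1 z.2 * Qval nu p gamma r pol (th z.1) z.2).
have bv : bmeas v.
  apply: bmeasM; first exact: (bmeas_comp bG measurable_fst).
  by apply: bmeasM => //; exact: (bmeas_Qval_param (th := th : W -> _) mth).
(* Integrate out the first pair, given only [F]. *)
have E2 := first_pair_Ex g01 FM polpi mpi T_geom traj1 bv.
transitivity (Ex P (fun w => v (w, pT w))).
  by congr (Ex P _); apply/funext => w; rewrite /v /= mulrA.
rewrite [LHS]E2; congr (_ * Ex P _); apply/funext => w.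
rewrite -/(occupancy nu p gamma (pol (th w)) s0 _).
have bs := bmeas_score_Qval p g01 br rU hpol hpos hdiff hB (th w) i.
rewrite (occupancyZ p g01 (hpol (th w)) s0 (G w) bs).
by rewrite expr2; congr (_ * _); rewrite /G mxE.
Qed.

End Iteration.

End Algorithm.

(** * Almost sure convergence *)

(** By monotone convergence the sum has expectation at most [M], hence is almost surely finite. *)
Lemma ae_summable {R : realType} {dO : measure_display} {Om : measurableType dO}
    (P : probability Om R) (f : nat -> Om -> R) (M : R) :
  (forall k, bmeas (f k)) -> (forall k w, 0 <= f k w) ->
  (forall n, \sum_(0 <= k < n) Ex P (f k) <= M) ->
  {ae P, forall w, cvgn (series (fun k => f k w))}.
Proof.
move=> bf f0 fM; pose F w := (\sum_(0 <= k <oo) (f k w)%:E)%E.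
have mf k : measurable_fun setT (fun w => (f k w)%:E) by apply/measurable_EFinP; case: (bf k).
have F0 w : (0 <= F w)%E by apply: nneseries_ge0 => k _ _; rewrite lee_fin.
have iF : (\int[P]_w F w <= M%:E)%E.
  rewrite integral_nneseries//; last by move=> k w _; rewrite lee_fin.
  apply: lime_le.
    by apply: is_cvg_nneseries => k _ _; apply: integral_ge0 => w _; rewrite lee_fin.
  apply: nearW => n; rewrite (eq_bigr (fun k => (Ex P (f k))%:E)); last first.
    by move=> k _; rewrite ExE.
  by rewrite sumEFin lee_fin.
have intF : P.-integrable setT F.
  apply/integrableP; split; first by apply: ge0_emeasurable_sum => // k w _ _; rewrite lee_fin.
  rewrite (eq_integral F); first by rewrite (le_lt_trans iF)// ltry.
  by move=> w _; rewrite gee0_abs.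
have := integrable_ae measurableT intF; apply: filterS => w /(_ I) Fw.
apply: nondecreasing_is_cvgn; first by apply: nondecreasing_series => k _ _.
exists (fine (F w)) => _ [n _ <-]; rewrite -lee_fin fineK// seriesEnat /= -sumEFin.
by apply: nneseries_lim_ge => k _ _; rewrite lee_fin.
Qed.

Lemma sum_telescope_le {R : realType} (a v b : nat -> R) (c : R) n :
  (forall k, a k <= v k.+1 - v k + c * b k) ->
  \sum_(0 <= k < n) a k <= v n - v 0%N + c * series b n.
Proof.
move=> h; elim: n => [|n IH]; first by rewrite big_geq// subrr add0r seriesEnat /= big_geq// mulr0.
rewrite big_nat_recr// seriesSr mulrDr; have := h n.
move: IH; rewrite /=; lra.
Qed.

Section Sequence.
Context {R : realType} {dS dA : measure_display}.
Context {S : measurableType dS} {A : measurableType dA} {d : nat}.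
Variables (nu : {sigma_finite_measure set A -> \bar R}).
Variables (p : R.-pker (S * A)%type ~> S) (gamma : R).
Hypothesis g01 : 0 < gamma < 1.
Local Notation X := (S * A)%type.
Variables (r : X -> R) (U : R).
Hypotheses (mr : measurable_fun setT r) (rU : forall x, `|r x| <= U).
Variable pol : 'rV[R]_d -> S -> A -> R.
Variables (L_Theta B_Theta : R).
Hypothesis hpol : forall th, is_policy nu (pol th).
Hypothesis hpos : forall th s a, 0 < pol th s a.
Hypothesis hdiff : forall th s a, differentiable (fun th' => pol th' s a) th.
Hypothesis hL : forall s a th1 th2,
  norm2 (score pol s a th1 - score pol s a th2) <= L_Theta * norm2 (th1 - th2).
Hypothesis hB : forall s a th, norm2 (score pol s a th) <= B_Theta.
Variable s0 : S.
Variables (alpha : nat -> R) (th0 : 'rV[R]_d).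
Hypothesis halpha : forall k, 0 < alpha k.
Hypothesis halpha1 : series alpha @ \oo --> +oo.
Hypothesis halpha2 : cvgn (series (fun k => alpha k ^+ 2)).
Context {dO : measure_display} {Om : measurableType dO}.
Variables (P : probability Om R) (x : nat -> draws S A Om).
Hypothesis hx : rpg_draws nu p r gamma pol s0 P th0 alpha x.

Local Notation theta := (rpg r gamma pol th0 alpha x).
Local Notation G := (Jgrad nu p gamma r pol s0).
Local Notation J := (Jval nu p gamma r pol s0).
Local Notation inc k := (increment gamma r pol (theta k) (x k)).

Let br : bmeas r. Proof. by split=> //; exists U. Qed.

Lemma thetaS k w : theta k.+1 w = theta k w + (alpha k / (1 - gamma)) *: inc k w.
Proof. by rewrite /= /increment scalerA. Qed.

Lemma pastS k : past x k `<=` past x k.+1.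
Proof. by move=> B [j jk Bj]; exists j => //=; exact: leqW. Qed.

Lemma past_events1 k : events1 (x k) `<=` past x k.+1.
Proof. by move=> B EB; exists k => //=; left. Qed.

Lemma past_events2 k : events2 (x k) `<=` past x k.+1.
Proof. by move=> B EB; exists k => //=; right. Qed.

(** Each iterate is measurable for the sigma-algebra of the earlier draws, not just for [Om]: this
    is what makes the policy known when the draws of the iteration are made. *)
Lemma past_measurable k : past x k `<=` measurable /\
  forall i, @measurable_fun _ _ (g_sigma_algebraType (past x k)) R setT (fun w => theta k w 0 i).
Proof.
elim: k => [|k [pM mth]].
  by split=> [B [j]//|i]; exact: measurable_cst.
split.
  move=> B [j /=]; rewrite ltnS leq_eqVlt => /orP[/eqP ->|jk Bj]; last by apply: pM; exists j.
  move=> [|]; first exact: (iteration_measurable1 (hx k)).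
  exact: (iteration_measurable2 pM (hx k)).
move=> i; have -> : (fun w => theta k.+1 w 0 i) =
    (fun w => theta k w 0 i + alpha k / (1 - gamma) * inc k w 0 i).
  by apply/funext => w; rewrite thetaS mxE [X in _ + X]mxE.
apply: measurable_funD; first exact: (measurable_fun_mono (@pastS k)).
apply: measurable_funM => //.
have [] := bmeas_increment g01 mr rU hpol hpos hdiff hL hB mth i (@pastS k)
  (@past_events1 k) (@past_events2 k).
by [].
Qed.

Let pM k : past x k `<=` measurable. Proof. by case: (past_measurable k). Qed.

Let mth k : forall i, @measurable_fun _ _ (g_sigma_algebraType (past x k)) R setT
  (fun w => theta k w 0 i).
Proof. by case: (past_measurable k). Qed.

Lemma bmeas_inc k i : bmeas (fun w => inc k w 0 i).
Proof.
apply: (bmeas_sub (@pM k.+1)).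
by apply: (bmeas_increment g01 mr rU hpol hpos hdiff hL hB (@mth k));
  [exact: pastS|exact: past_events1|exact: past_events2].
Qed.

Lemma bmeas_Jgrad_theta k i : bmeas (fun w => G (theta k w) 0 i).
Proof.
apply: (bmeas_sub (@pM k)).
exact: (bmeas_Jgrad_param p g01 mr rU hpol hpos hdiff hL hB s0 i (@mth k)).
Qed.

Lemma bmeas_Jval_theta k : bmeas (fun w => J (theta k w)).
Proof.
apply: (bmeas_sub (@pM k)).
exact: (bmeas_Jval_param p g01 mr rU hpol hdiff s0 (@mth k)).
Qed.

Definition grad_sqr k w : R := \sum_(i < d) G (theta k w) 0 i ^+ 2.

Lemma bmeas_grad_sqr k : bmeas (grad_sqr k).
Proof.
by apply: bmeas_sum => i; under eq_fun do rewrite expr2;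
  apply: bmeasM; exact: bmeas_Jgrad_theta.
Qed.

Let Dinc := U / (1 - gamma `^ (1 / 2)) * `|B_Theta|.

Let Dinc0 : 0 <= Dinc.
Proof.
have /andP[q0 q1] := half_discount01 g01.
rewrite mulr_ge0// divr_ge0//; first by rewrite (le_trans _ (rU point)).
by rewrite subr_ge0 ltW.
Qed.

Lemma inc_norm k w : `|inc k w| <= Dinc.
Proof. by apply: norm_le_coord => // i; exact: (increment_bound g01 rU hB). Qed.

Let g1 : 0 < 1 - gamma. Proof. by rewrite subr_gt0; case/andP: g01. Qed.

Lemma step_norm k w : `|(alpha k / (1 - gamma)) *: inc k w| <= alpha k * (Dinc / (1 - gamma)).
Proof.
rewrite normrZ ger0_norm; last by rewrite divr_ge0// ltW.
rewrite mulrAC mulrA mulrAC -mulrA -[leRHS]mulrA ler_wpM2l ?(ltW (halpha k))//.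
by rewrite mulrC ler_wpM2r ?invr_ge0 ?(ltW g1)// inc_norm.
Qed.

(** Expand [J] along one update. The linear term has expectation [alpha k * Ex P (grad_sqr k)] by
    [increment_Ex], and the remainder is bounded surely, because the increments are. *)
Lemma expected_ascent C k : 0 <= C -> second_order J G C ->
  alpha k * Ex P (grad_sqr k) <=
  Ex P (fun w => J (theta k.+1 w)) - Ex P (fun w => J (theta k w)) +
  C * (Dinc / (1 - gamma)) ^+ 2 * alpha k ^+ 2.
Proof.
move=> C0 JG; have dP := density_probability P.
pose e := C * (Dinc / (1 - gamma)) ^+ 2 * alpha k ^+ 2.
pose m w := dot (G (theta k w)) (inc k w).
have bm : bmeas m.
  by apply: bmeas_sum => i; apply: bmeasM; [exact: bmeas_Jgrad_theta|exact: bmeas_inc].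
have Em : Ex P m = (1 - gamma) * Ex P (grad_sqr k).
  rewrite {1}/Ex /m /dot (avg_sum dP (index_enum 'I_d)
    (g := fun i w => G (theta k w) 0 i * inc k w 0 i)); last first.
    by move=> i; apply: bmeasM; [exact: bmeas_Jgrad_theta|exact: bmeas_inc].
  rewrite /Ex /grad_sqr (avg_sum dP (index_enum 'I_d)
    (g := fun i w => G (theta k w) 0 i ^+ 2)); last first.
    by move=> i; under eq_fun do rewrite expr2; apply: bmeasM; exact: bmeas_Jgrad_theta.
  rewrite big_distrr /=; apply: eq_bigr => i _.
  exact: (increment_Ex g01 mr rU hpol hpos hdiff hL hB (@pM k) (@mth k) (hx k) i).
(* Only the lower half of the two-sided expansion is used. *)
have key w : alpha k / (1 - gamma) * m w <= (J (theta k.+1 w) - J (theta k w)) + e.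
  have := JG (theta k w) ((alpha k / (1 - gamma)) *: inc k w).
  rewrite -thetaS dotZr -/(m w).
  have : C * `|(alpha k / (1 - gamma)) *: inc k w| ^+ 2 <= e.
    rewrite /e -mulrA -exprMn ler_wpM2l// lerXn2r ?nnegrE//.
      by rewrite mulr_ge0 ?divr_ge0 ?(ltW g1) ?(ltW (halpha k)).
    by rewrite [X in _ <= X]mulrC step_norm.
  move=> h1 h2; have := le_trans h2 h1; rewrite ler_norml => /andP[h3 _].
  by move: h3; move: (alpha k / _ * _) (J _) (J _) => u v z; lra.
have bJ := bmeas_Jval_theta.
have bd : bmeas (fun w => J (theta k.+1 w) - J (theta k w)) by exact: bmeasB.
have := avg_le dP (bmeasZ _ bm) (bmeasD bd (bmeas_cst e)) key.
rewrite (avgD dP bd (bmeas_cst e)) (avg_cst dP) (avgB dP (bJ k.+1) (bJ k)).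
rewrite (avgZ dP _ bm) -/(Ex P m) Em mulrA divfK//.
by rewrite lt0r_neq0.
Qed.

Lemma expected_sum_bounded : exists M, forall n,
  \sum_(0 <= k < n) Ex P (fun w => alpha k * grad_sqr k w) <= M.
Proof.
have [C C0 JG] := Jval_second_order p g01 br rU hpol hpos hdiff hL hB s0.
have dP := density_probability P.
pose c := C * (Dinc / (1 - gamma)) ^+ 2.
have c0 : 0 <= c by rewrite mulr_ge0// sqr_ge0.
pose L := limn (series (fun k => alpha k ^+ 2)).
pose M := U / (1 - gamma).
have EJ k : `|Ex P (fun w => J (theta k w))| <= M.
  apply: (avg_bound dP (bmeas_Jval_theta k)) => w.
  exact: (Jval_bound p g01 br rU hpol s0).
have EZ k : Ex P (fun w => alpha k * grad_sqr k w) = alpha k * Ex P (grad_sqr k).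
  exact: (avgZ dP _ (bmeas_grad_sqr k)).
(* [M + M] bounds the two ends of the telescoping sum of the expected values, [c * L] the
   accumulated remainders. *)
exists (M + M + c * L) => n.
have step k : Ex P (fun w => alpha k * grad_sqr k w) <=
    Ex P (fun w => J (theta k.+1 w)) - Ex P (fun w => J (theta k w)) + c * alpha k ^+ 2.
  by rewrite EZ; exact: expected_ascent.
have := sum_telescope_le (a := fun k => Ex P (fun w => alpha k * grad_sqr k w))
  (v := fun k => Ex P (fun w => J (theta k w))) n step.
move=> /le_trans; apply; apply: lerD.
  rewrite lerD//; first by have := EJ n; rewrite ler_norml => /andP[].
  by have := EJ 0; rewrite ler_norml lerNl => /andP[].
rewrite ler_wpM2l//; apply: nondecreasing_cvgn_le => //.
by apply: nondecreasing_series => k _ _; exact: sqr_ge0.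
Qed.

Lemma alpha_cvg0 : alpha @ \oo --> 0.
Proof.
apply/cvgrPdist_lt => e e0; have := cvg_series_cvg_0 halpha2.
have e2 : 0 < e ^+ 2 by rewrite exprn_gt0.
move=> /cvgrPdist_lt /(_ _ e2); apply: filterS => k.
rewrite !sub0r !normrN normrX ltr_pXn2r ?nnegrE ?(ltW e0)//.
Qed.

Lemma grad_cvg0 : {ae P, forall w, forall i, `|G (theta k w) 0 i| @[k --> \oo] --> 0}.
Proof.
have [C C0 JG] := Jval_second_order p g01 br rU hpol hpos hdiff hL hB s0.
have [M hM] := expected_sum_bounded.
have gs0 k w : 0 <= grad_sqr k w by apply: sumr_ge0 => i _; exact: sqr_ge0.
have bf k : bmeas (fun w => alpha k * grad_sqr k w) by apply: bmeasZ; exact: bmeas_grad_sqr.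
have f0 k w : 0 <= alpha k * grad_sqr k w by rewrite mulr_ge0// ltW.
have := ae_summable bf f0 hM; apply: filterS => w cw i.
(* The constant is the Lipschitz constant of a gradient coordinate times the bound on an update per
   unit of [alpha k]. *)
apply: (@slowly_varying_cvg0 _ alpha _ (6 * C * (Dinc / (1 - gamma)))) => //.
- by apply: mulr_ge0; [exact: mulr_ge0|apply: divr_ge0 => //; exact: ltW].
- move=> k; have := second_order_lipschitz (theta k w)
    ((alpha k / (1 - gamma)) *: inc k w) i C0 JG.
  rewrite -thetaS => h; rewrite -lerBlDl (le_trans (lerB_dist _ _))// (le_trans h)//.
  rewrite -[X in _ <= X]mulrA ler_wpM2l ?mulr_ge0//.
  by rewrite [X in _ <= X]mulrC step_norm.
- exact: alpha_cvg0.
(* The square of one coordinate is dominated by [grad_sqr], whose weighted series converges at this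
   [w]. *)
- apply: nondecreasing_is_cvgn.
    by apply: nondecreasing_series => k _ _; rewrite mulr_ge0 ?sqr_ge0// ltW.
  exists (limn (series (fun k => alpha k * grad_sqr k w))) => _ [n _ <-].
  rewrite (@le_trans _ _ (series (fun k => alpha k * grad_sqr k w) n))//.
    rewrite !seriesEnat /=; apply: ler_sum => k _; rewrite ler_wpM2l ?(ltW (halpha k))//.
    rewrite real_normK ?num_real// /grad_sqr (bigD1 i)//= lerDl.
    by apply: sumr_ge0 => j _; exact: sqr_ge0.
  apply: nondecreasing_cvgn_le => //.
  by apply: nondecreasing_series => k _ _; exact: f0.
Qed.

End Sequence.

(** A cluster point is approached by late iterates, whose gradients are small; Lipschitz continuity
    of [G] carries this to the point. Existence of a limit is not involved. *)
Lemma cluster_gradient_zero {R : realType} {d : nat} (J : 'rV[R]_d -> R)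
    (G : 'rV[R]_d -> 'rV[R]_d) (C : R) (theta : nat -> 'rV[R]_d) :
  0 <= C -> second_order J G C ->
  (forall i, `|G (theta k) 0 i| @[k --> \oo] --> 0) ->
  cluster (theta k @[k --> \oo]) `<=` [set th | G th = 0].
Proof.
move=> C0 JG cG y cy; apply/rowP => i; rewrite mxE; apply/eqP.
rewrite -normr_le0 leNgt; apply/negP => e0; set e := `|G y 0 i| in e0.
have C6 : 0 < 6 * C + 1 by rewrite ltr_wpDl// mulr_ge0.
(* Half of [e] for the gradient at the nearby iterate, half for the variation of [G] up to [y]; the
   [+ 1] covers [C = 0]. *)
have e2 : 0 < e / 2 by rewrite divr_gt0.
have eC : 0 < e / 2 / (6 * C + 1) by rewrite divr_gt0.
have : (theta k @[k --> \oo]) [set th | `|G th 0 i| < e / 2].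
  have /cvgrPdist_lt /(_ _ e2) := cG i; apply: filterS => k.
  by rewrite /= sub0r normrN normr_id.
have : \forall th \near y, `|y - th| < e / 2 / (6 * C + 1).
  by apply/nbhs_normP; exists (e / 2 / (6 * C + 1)) => //=.
move=> nB nA; have [z [/= zA zB]] := cy _ _ nA nB.
have := second_order_lipschitz z (y - z) i C0 JG; rewrite [z + _]addrC subrK.
have : (6 * C) * `|y - z| <= (6 * C + 1) * `|y - z| by rewrite ler_wpM2r// lerDl.
move: zB; rewrite -/(_ < _) ltr_pdivlMr// [_ * (6 * C + 1)]mulrC => h1 h2 h3.
have := le_lt_trans (le_trans h3 h2) h1.
have := ler_normD (G y 0 i - G z 0 i) (G z 0 i); rewrite subrK -/e.
by move: (`|G y 0 i - _|) zA => u; lra.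
Qed.

Theorem theorem4p2 (R : realType)
    (dS dA : measure_display) (S : measurableType dS) (A : measurableType dA)
    (hS : finite_or_compact R S) (hA : finite_or_compact R A)
    (nu : {sigma_finite_measure set A -> \bar R})
    (p : R.-pker (S * A)%type ~> S) (r : S * A -> R) (gamma : R)
    (hr : measurable_fun setT r) (hgamma : 0 < gamma < 1)
    (d : nat) (pol : 'rV[R]_d -> S -> A -> R)
    (hpol : forall th, is_policy nu (pol th))
    (s0 : S) (V : 'rV[R]_d -> S -> R)
    (hV : forall th s, is_value nu p r gamma (pol th) s (V th s))
    (U_R L_Theta B_Theta : R)
    (hU : forall s a, `|r (s, a)| <= U_R)
    (hpos : forall th s a, 0 < pol th s a)
    (hdiff : forall th s a, differentiable (fun th' => pol th' s a) th)
    (hL : forall s a th1 th2,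
       norm2 (score pol s a th1 - score pol s a th2) <= L_Theta * norm2 (th1 - th2))
    (hB : forall s a th, norm2 (score pol s a th) <= B_Theta)
    (alpha : nat -> R) (halpha : forall k, 0 < alpha k)
    (halpha1 : series alpha @ \oo --> +oo)
    (halpha2 : cvgn (series (fun k => alpha k ^+ 2)))
    (th0 : 'rV[R]_d)
    (dO : measure_display) (Om : measurableType dO) (P : probability Om R)
    (x : nat -> draws S A Om)
    (hx : rpg_draws nu p r gamma pol s0 P th0 alpha x) :
  let J := fun th => V th s0 in
  let theta := rpg r gamma pol th0 alpha x in
  (forall th, differentiable J th) /\
  {ae P, forall w,
     cluster (theta k w @[k --> \oo]) `<=` stationary_points J /\
     grad J (theta k w) @[k --> \oo] --> (0 : 'rV[R]_d)}.
Proof.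
  move=> J theta.
have rU (x' : S * A) : `|r x'| <= U_R by case: x' => s a; exact: hU.
have br : bmeas r by split=> //; exists U_R.
(* The values [V] are given only through [is_value]; this replaces them by the analytic formula to
   which the smoothness results apply. *)
have JE : J = Jval nu p gamma r pol s0.
  by apply/funext => th; exact: (value_resolvent hgamma hr rU (hpol th) (hV th s0)).
have [C C0 JG] := Jval_second_order p hgamma br rU hpol hpos hdiff hL hB s0.
rewrite -JE in JG.
have dJ th := second_order_grad th C0 JG.
split; first by move=> th; case: (dJ th).
have := grad_cvg0 hgamma hr rU hpol hpos hdiff hL hB halpha halpha1 halpha2 hx.
apply: filterS => w cG; split.
  move=> y /(cluster_gradient_zero C0 JG cG) /= Gy; split; first by case: (dJ y).
  by case: (dJ y) => _ ->.
apply/cvgrPdist_le => e e0.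
have : \forall k \near \oo, forall i, `|Jgrad nu p gamma r pol s0 (theta k w) 0 i| <= e.
  (* There are finitely many coordinates, so their convergence is uniform and gives convergence in
     the sup norm. *)
  apply: filter_forall => i; have /cvgrPdist_le /(_ _ e0) := cG i.
  by apply: filterS => k; rewrite sub0r normrN normr_id.
apply: filterS => k ke; case: (dJ (theta k w)) => _ ->.
rewrite sub0r normrN; apply: norm_le_coord => //; exact: ltW.
Qed.
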